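(* Let $k\ge 2$, $m\ge 1$ be integers. Let $\tilde{\xi}=\tilde{\xi}(x)$ be a continuous function on $\mathbb{R}_+^m\setminus\{0\}$. Assume that there exists $r>0$ such that, in the neighbourhood of $0$, $$|\tilde{\xi}(x)|=\mathcal{O}\left(\frac{1}{\|x\|^r}\right).$$ Then the map $$b(\theta):=\mathbb{E}\left[\tilde{\xi}(\Gamma^{(1)},\dots,\Gamma^{(m)})\right]-\theta$$ is continuously differentiable, and, as $\theta\to\infty$, $$\mathbb{E}\left[\left(\tilde{\xi}(X_{(k),1},\dots,X_{(k),m})-\theta\right)^2\right]\ \geq\ \frac{\theta^2}{km}\left(1+b'(\theta)\right)^2+\mathrm{o}(\theta^2).$$ If furthermore $\tilde{\xi}$ is unbiased in the asymptotic model, i.e. $\mathbb{E}[\tilde{\xi}(\Gamma^{(1)},\dots,\Gamma^{(m)})]=\theta$, then $$\mathbb{E}\left[\left(\tilde{\xi}(X_{(k),1},\dots,X_{(k),m})-\theta\right)^2\right]\ \geq\ \mathbb{E}\left[(\hat{\xi}-\theta)^2\right]+\mathrm{o}(\theta^2)\ =\ \frac{\theta^2}{km-2}+\mathrm{o}(\theta^2),$$ where $\hat{\xi}=\dfrac{km-1}{\sum_{i=1}^m X_{(k),i}}$.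
   Context: Actual model for $X_{(k),i}$: for a positive integer $\theta$ (the unknown number of distinct elements), let $U_1,\dots,U_\theta$ be independent random variables uniform on $[0,1]$ (the distinct hashed values). For $1\le i\le m$, let $Z_{(k),i}$ be the $k$-th smallest of the values $U_j$ lying in $[\frac{i-1}{m},\frac{i}{m})$, with $Z_{(k),i}=\frac{i}{m}$ if fewer than $k$ of the $U_j$ lie in this interval. Set $X_{(k),i}=Z_{(k),i}-\frac{i-1}{m}$. Asymptotic model: for $\theta>0$, $\Gamma^{(1)},\dots,\Gamma^{(m)}$ are i.i.d. random variables with distribution Gamma$(k,\theta)$, i.e. with density $\frac{t^{k-1}}{\Gamma(k)}\theta^k e^{-\theta t}\mathbf{1}_{t\ge 0}$.
   Formalization: As printed the first inequality can fail when b' is unbounded; the formal version multiplies its main term by (1 - c/θ) for a constant c, harmless if (1+b')² = o(θ), and assumes the expectation defining b is finite for every θ > 0. *)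

(* Defs.v *)
From HB Require Import structures.
From mathcomp Require Import all_boot all_order all_algebra.
From mathcomp Require Import all_classical all_reals all_analysis.

Set Implicit Arguments.
Unset Strict Implicit.
Unset Printing Implicit Defensive.

Import Order.TTheory GRing.Theory Num.Theory.
Import numFieldNormedType.Exports.

Local Open Scope classical_set_scope.
Local Open Scope ring_scope.

(* Taking [B i = setT] for some of the indices gives the product rule for every
   subfamily. *)
Definition mutually_independent d (T : measurableType d) (R : realType)
    (P : probability T R) (I : finType) (X : I -> {RV P >-> R}) : Prop :=
  forall B : I -> set R, (forall i, measurable (B i)) ->
    P (\bigcap_(i in [set: I]) (X i @^-1` B i)) =
    (\prod_(i : I) P (X i @^-1` B i))%E.

Definition uniform01_sample d (T : measurableType d) (R : realType)
    (P : probability T R) (n : nat) (U : 'I_n -> {RV P >-> R}) : Prop :=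
  mutually_independent U /\
  forall i (A : set R), measurable A ->
    distribution P (U i) A = uniform_prob (@ltr01 R) A.

(* Density of Gamma(k, theta) for an integer shape k >= 1, for which
   Gamma(k) = (k - 1)!; theta is the rate. *)
Definition gamma_pdf (R : realType) (k : nat) (theta t : R) : R :=
  if 0 <= t then t ^+ k.-1 / (k.-1)`!%:R * theta ^+ k * expR (- (theta * t))
  else 0.

Definition gamma_sample d (T : measurableType d) (R : realType)
    (P : probability T R) (m k : nat) (theta : R)
    (G : 'I_m -> {RV P >-> R}) : Prop :=
  mutually_independent G /\
  forall i (A : set R), measurable A ->
    distribution P (G i) A =
    (\int[@lebesgue_measure R]_(t in A) (gamma_pdf k theta t)%:E)%E.

(* Buckets are numbered from 0: bucket i is [i/m, (i+1)/m). The list holds the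
   values that fall into it, in increasing order, and the default value of [nth]
   is what is returned when there are fewer than k of them. *)
Definition kth_min (R : realType) (k m n : nat) (u : 'I_n -> R) (i : 'I_m) : R :=
  nth (i.+1%:R / m%:R)
      (sort <=%R [seq u j | j <- enum 'I_n
                          & i%:R / m%:R <= u j < i.+1%:R / m%:R])
      k.-1.

Definition shifted_minima (R : realType) (k m n : nat) (u : 'I_n -> R) : 'rV[R]_m :=
  \row_(i < m) (kth_min k u i - i%:R / m%:R).

Definition punctured_orthant (R : realType) (m : nat) : set 'rV[R]_m :=
  [set x | (forall i, 0 <= x ord0 i) /\ x != 0].

(* A function on the punctured orthant is represented by a total function xi whose
   values elsewhere are discarded: [xi \_ D] is xi on D and 0 off D. The points
   at which it is evaluated below almost surely lie in the punctured orthant. *)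
Definition estimate (R : realType) (m : nat) (xi : 'rV[R]_m -> R) : 'rV[R]_m -> R :=
  xi \_ (@punctured_orthant R m).

Definition xi_hat (R : realType) (k m : nat) (x : 'rV[R]_m) : R :=
  (k * m - 1)%:R / \sum_(i < m) x ord0 i.

(* Extended-real valued, since it may be infinite. *)
Definition quadratic_risk d (T : measurableType d) (R : realType)
    (P : probability T R) (k m n : nat) (U : 'I_n -> {RV P >-> R})
    (xi : 'rV[R]_m -> R) : \bar R :=
  'E_P[fun w => (estimate xi (shifted_minima k m (fun j => U j w)) - n%:R) ^+ 2].

Definition gamma_estimate d (T : measurableType d) (R : realType)
    (P : probability T R) (m : nat) (G : 'I_m -> {RV P >-> R})
    (xi : 'rV[R]_m -> R) : T -> R :=
  fun w => estimate xi (\row_(i < m) G i w).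

(* Main.v *)
(* Put K = km, and let s be the sum of the m Gamma variables at rate 1. Passing from
   rate 1 to rate t multiplies the law by t^K e^(-(t-1)s), so that the mean of an
   estimator Y at rate t is t^K times a Laplace transform in t, hence smooth.

   The uniform sample is compared with the same rate 1 law. Label each U_j according to
   whether it is the k-th smallest value of a bucket, one of the k-1 values below it, or
   none of these. All labellings contribute equally, and summing over them shows that
   near 0 the shifted minima have the density n(n-1)...(n-K+1) (1-s)^(n-K) e^s relative
   to the rate 1 Gamma law. It depends on s only and is n^K e^(-(n-1)s) (1 + O(1/n)) in
   the range s = O(1/n), while s of order 1 contributes a negligible remainder.

   The lower bounds are then of Cramer-Rao type: complete the square of Y - n against a
   function h of s. The score h = K/n - s gives the general one. For an unbiased Y of
   finite risk, Y/s is integrable, and its Laplace transform is known because its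
   derivative is that of -Y; taking h = (K-1)/s - n, the error of the optimal estimator,
   replaces 1/K by 1/(K-2). For K = 2 no unbiased estimator has finite risk. *)
Require Import Defs.
From HB Require Import structures.
From mathcomp Require Import all_boot all_order all_algebra.
From mathcomp Require Import all_classical all_reals all_analysis.
From mathcomp Require Import measurable_realfun.
From mathcomp Require Import ring lra zify.

Set Implicit Arguments.
Unset Strict Implicit.
Unset Printing Implicit Defensive.

Import Order.TTheory GRing.Theory Num.Theory.
Import numFieldNormedType.Exports.

Local Open Scope classical_set_scope.
Local Open Scope ring_scope.

(** An estimator [Y] is only assumed integrable at each rate, so no error term may involve [Y ^+ 2].
    This dictates the form of the lower bound. If [p] is the weight of the minima and [g] that of
    the Gamma law at rate [n], completing the square gives [A ^+ 2 * p >= 2 * t * A * h * g - t ^+ 2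
    * h ^+ 2 * g ^+ 2 / p] with [A = Y - n]: on the right [Y] enters linearly and against [g]
    exactly, and the comparison of [g] with [p] touches only [h], an explicit function of [s]. The
    restriction to small [s] is paid by first moments of [Y] on [s >= a], which decay exponentially
    in the rate. The scale [t] is free. For the score its optimum is [n ^+ 2 / K] times the slope of
    the mean, so the errors quadratic in [t] scale with the square of that slope: this is the origin
    of the factor [1 - c / n]. For the error of the optimal estimator the mean of [A * h] equals
    that of [h ^+ 2], and the scale is 1. *)

Section density.
Local Open Scope ereal_scope.
Context d (T : measurableType d) (R : realType).
Variables (mu : {measure set T -> \bar R}) (g : T -> \bar R).
Hypotheses (mg : measurable_fun setT g) (g0 : forall x, 0 <= g x).

(** The two proofs are arguments so that [density mg g0] can carry the structure of a measure, which
    depends on them. *)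
Definition density of measurable_fun setT g & (forall x, 0 <= g x) :
  set T -> \bar R := fun A => \int[mu]_(x in A) g x.

Let nu := density mg g0.

Let density0 : nu set0 = 0.
Proof. by rewrite /nu /density integral_set0. Qed.

Let density_ge0 A : 0 <= nu A.
Proof. exact: integral_ge0. Qed.

Let density_sigma_additive : semi_sigma_additive nu.
Proof.
move=> /= F mF tF mUF; rewrite /nu /density; apply: cvg_toP.
  apply: ereal_nondecreasing_is_cvgn => m n mn.
  by apply: lee_sum_nneg_natr => // k _ _; exact: density_ge0.
rewrite ge0_integral_bigcup//=.
exact: measurable_funTS.
Qed.

HB.instance Definition _ := isMeasure.Build _ _ _ (density mg g0)
  density0 density_ge0 density_sigma_additive.

Import HBNNSimple.

Let integral_density_nnsfun (f : {nnsfun T >-> R}) :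
  \int[density mg g0]_x (f x)%:E = \int[mu]_x ((f x)%:E * g x).
Proof.
under [LHS]eq_integral do rewrite fimfunE -fsumEFin//.
rewrite [LHS]ge0_integral_fsum//; last 2 first.
  - by move=> r; exact/measurable_EFinP/measurableT_comp.
  - by move=> n x _; rewrite EFinM nnfun_muleindic_ge0.
under [RHS]eq_integral.
  move=> x xD; rewrite fimfunE -fsumEFin// ge0_mule_fsuml; last first.
    by move=> r; rewrite EFinM nnfun_muleindic_ge0.
  over.
rewrite [RHS]ge0_integral_fsum//; last 2 first.
  - move=> r; apply: emeasurable_funM => //.
    by apply/measurable_EFinP; apply/measurableT_comp => //.
  - by move=> n x _; rewrite mule_ge0// EFinM nnfun_muleindic_ge0.
apply: eq_fsbigr => r _.
rewrite (integralZl_indic_nnsfun)//= integral_indic//= setIT.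
transitivity (\int[mu]_x (r%:E * ((\1_(f @^-1` [set r]) x)%:E * g x))).
  have [r0|r0] := ltP r 0%R.
    rewrite preimage_nnfun0// measure0 mule0 integral0_eq// => x _.
    by rewrite indic0 mul0e mule0.
  rewrite ge0_integralZl//; last 2 first.
  - apply: emeasurable_funM => //; apply/measurable_EFinP.
    exact: measurable_indic.
  - by move=> x _; rewrite mule_ge0// lee_fin.
  congr (_ * _); rewrite /density integral_mkcond; apply: eq_integral => x _.
  by rewrite patchE indicE; case: ifPn; rewrite ?mul1e ?mul0e.
by apply: eq_integral => x _; rewrite EFinM muleA.
Qed.

Lemma integral_density (f : T -> \bar R) :
  measurable_fun setT f -> (forall x, 0 <= f x) ->
  \int[density mg g0]_x f x = \int[mu]_x (f x * g x).
Proof.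
move=> mf f0.
pose f_ := nnsfun_approx measurableT mf.
transitivity (lim (\int[density mg g0]_x (f_ n x)%:E @[n --> \oo])).
  rewrite -monotone_convergence//=.
  - apply: eq_integral => ? /[!inE] xD; apply/esym/cvg_lim => //=.
    exact: cvg_nnsfun_approx.
  - by move=> n; exact/measurable_EFinP/measurable_funTS.
  - by move=> n ? _; rewrite lee_fin.
  - by move=> ? _ ? ? mn; rewrite lee_fin; exact/lefP/nd_nnsfun_approx.
rewrite [RHS](_ : _ = lim (\int[mu]_x ((f_ n x)%:E * g x) @[n --> \oo])).
  by apply: congr_lim; apply/funext => n /=; exact: integral_density_nnsfun.
rewrite -monotone_convergence//=.
- apply: eq_integral => x _; apply/esym/cvg_lim => //.
  have fx : (f_ n x)%:E @[n --> \oo] --> f x by exact: cvg_nnsfun_approx.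
  (* Where [g x] is infinite, multiplication by it is not continuous at 0. Either all approximations
     vanish, and so does [f x], or the products equal [+oo] from the first positive approximation
     on. *)
  have [gx|] := boolP (g x \is a fin_num); first exact: cvgeZr.
  rewrite ge0_fin_numE// -leNgt leye_eq => /eqP gx; rewrite gx.
  have nd_f m n : (m <= n)%N -> (f_ m x <= f_ n x)%R.
    by move=> mn; exact/lefP/nd_nnsfun_approx.
  have fE : f x = ereal_sup (range (fun n => (f_ n x)%:E)).
    rewrite -(cvg_lim _ fx)//; apply/cvg_lim => //.
    by apply: ereal_nondecreasing_cvgn => a b ab; rewrite lee_fin nd_f.
  have [f_0|] := pselect (forall n, f_ n x = 0%R).
    have fx0 : f x = 0.
      rewrite -(cvg_lim _ fx)//; apply/cvg_lim => //.
      by under eq_fun do rewrite f_0; exact: cvg_cst.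
    by rewrite fx0 mul0e; under eq_fun do rewrite f_0 mul0e; exact: cvg_cst.
  move=> /existsNP[N /eqP fN0].
  have {}fN0 : 0 < (f_ N x)%:E by rewrite lte_fin lt_neqAle eq_sym fN0 fun_ge0.
  have fx0 : 0 < f x.
    by rewrite (lt_le_trans fN0)// fE; apply: ereal_sup_ubound; exists N.
  rewrite gt0_muley// -(cvg_shiftn N).
  rewrite [X in X @ _ --> _](_ : _ = cst +oo); first exact: cvg_cst.
  apply/funext => n /=; rewrite gt0_muley// (lt_le_trans fN0)// lee_fin nd_f//.
  exact: leq_addl.
- move=> n; apply: emeasurable_funM => //.
  exact/measurable_EFinP/measurable_funTS.
- by move=> n ? _; rewrite mule_ge0// lee_fin.
- move=> ? _ ? ? ?; rewrite lee_wpmul2r// lee_fin.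
  exact/lefP/nd_nnsfun_approx.
Qed.

End density.

(** * Measures on finite products of the real line *)

(** A generator closed under intersection, so that finite measures agreeing on it coincide. It has
    the shape of the sets in [mutually_independent], and plain functions as points let one
    coordinate be replaced by [upd]. *)
Definition boxes (I : Type) (R : realType) : set (set (I -> R)) :=
  [set A | exists2 B : I -> set R, (forall i, measurable (B i)) &
             A = [set u | forall i, B i (u i)]].

Notation fspace I R := (g_sigma_algebraType (@boxes I R)).

Definition upd (I : eqType) (S : Type) (i : I) (u : I -> S) (t : S) : I -> S :=
  fun j => if j == i then t else u j.

Section fspace_theory.
Context (I : finType) (R : realType).

Lemma measurable_fun_eval (i : I) :
  measurable_fun setT (fun u : fspace I R => u i).
Proof.
move=> _ B mB; rewrite setTI; apply: sub_sigma_algebra.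
exists (fun j => if j == i then B else setT); first by move=> j; case: ifP.
apply/seteqP; split => [u Bu j|u /(_ i)] /=; last by rewrite eqxx.
by case: eqP => // ->.
Qed.

Lemma measurable_fun_fspace d (T : measurableType d) (f : T -> fspace I R) :
  (forall i, measurable_fun setT (f ^~ i)) -> measurable_fun setT f.
Proof.
move=> mf; apply: (@measurability _ _ _ _ _ f (@boxes I R)) => //.
move=> _ [_ [B mB ->] <-]; rewrite setTI.
rewrite [X in measurable X](_ : _ = \bigcap_(i in [set: I]) ((f ^~ i) @^-1` B i)).
  apply: fin_bigcap_measurable => // i _.
  by rewrite -[X in measurable X]setTI; exact: mf.
by apply/seteqP; split=> [x Bx i _|x Bx i]; apply: Bx.
Qed.

Lemma fspace_measure_unique (m1 m2 : {measure set (fspace I R) -> \bar R}) :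
  (m1 setT < +oo)%E ->
  (forall B : I -> set R, (forall i, measurable (B i)) ->
     m1 [set u | forall i, B i (u i)] = m2 [set u | forall i, B i (u i)]) ->
  forall A : set (fspace I R), measurable A -> m1 A = m2 A.
Proof.
move=> m1oo m12 A mA.
have boxT : @boxes I R setT.
  by exists (fun _ => setT) => //; apply/seteqP; split.
apply: (@g_sigma_algebra_measure_unique _ R (fspace I R) (@boxes I R) _ (fun _ => setT)) => //.
- exact: sub_sigma_algebra.
- by apply/seteqP; split => // x _; exists 0%N.
- move=> _ _ [B1 mB1 ->] [B2 mB2 ->].
  exists (fun i => B1 i `&` B2 i); first by move=> i; exact: measurableI.
  apply/seteqP; split => [u [h1 h2] i|u h]; first by split; [exact: h1|exact: h2].
  by split => i; have [] := h i.
- by move=> _ [B mB ->]; exact: m12.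
Qed.

Lemma measurable_fun_upd (i : I) :
  measurable_fun setT (fun z : fspace I R * R => upd i z.1 z.2 : fspace I R).
Proof.
apply: measurable_fun_fspace => j; rewrite /upd.
case: eqP => _; first exact: measurable_snd.
apply: (measurableT_comp (measurable_fun_eval j)).
exact: measurable_fst.
Qed.

End fspace_theory.

Section resample.
Local Open Scope ereal_scope.
Context d (T : measurableType d) (R : realType) (P : probability T R).
Context (I : finType) (X : I -> {RV P >-> R}).
Hypothesis indX : mutually_independent X.

Definition rvec (w : T) : fspace I R := fun i => X i w.

Lemma measurable_rvec : measurable_fun setT rvec.
Proof. by apply: measurable_fun_fspace => i; exact: measurable_funP. Qed.

(** For independent coordinates, the conditional expectation of [F] given all coordinates but
    [i]. *)
Definition resamp (i : I) (F : fspace I R -> \bar R) : fspace I R -> \bar R :=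
  fun u => \int[distribution P (X i)]_t F (upd i u t).

Lemma measurable_resamp i F : measurable_fun setT F -> (forall u, 0 <= F u) ->
  measurable_fun setT (resamp i F).
Proof.
move=> mF F0.
have := @measurable_fun_fubini_tonelli_F _ _ (fspace I R) R R
  (distribution P (X i)) (fun z => F (upd i z.1 z.2)).
apply => //.
exact: (measurableT_comp mF (@measurable_fun_upd I R i)).
Qed.

Lemma resamp_ge0 i F : (forall u, 0 <= F u) -> forall u, 0 <= resamp i F u.
Proof. by move=> F0 u; exact: integral_ge0. Qed.

(** By independence, redrawing coordinate [i] from its own law leaves the joint law unchanged, as is
    checked on boxes. Tonelli then gives the identity. *)
Lemma resampleE i F : measurable_fun setT F -> (forall u, 0 <= F u) ->
  \int[P]_w F (rvec w) = \int[P]_w resamp i F (rvec w).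
Proof.
move=> mF F0.
pose V : {mfun T >-> fspace I R} :=
  HB.pack rvec (isMeasurableFun.Build _ _ _ _ _ measurable_rvec).
pose mu : probability (fspace I R) R := distribution P V.
pose nu : probability R R := distribution P (X i).
pose Psi : {mfun (fspace I R * R)%type >-> fspace I R} :=
  HB.pack (fun z : fspace I R * R => upd i z.1 z.2 : fspace I R)
    (isMeasurableFun.Build _ _ _ _ _ (@measurable_fun_upd I R i)).
pose mu2 : probability _ R := (mu \x nu).
pose mu' : probability (fspace I R) R := distribution mu2 Psi.
have muB (B : I -> set R) : (forall j, measurable (B j)) ->
    mu [set u | forall j, B j (u j)] = \prod_j P (X j @^-1` B j).
  move=> mB; rewrite -indX//.
  suff -> : \bigcap_(j in [set: I]) (X j @^-1` B j) =
            V @^-1` [set u | forall j, B j (u j)] by [].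
  by apply/seteqP; split=> [w Bw j|w Bw j _]; exact: Bw.
have mumu' A : measurable A -> mu A = mu' A.
  apply: fspace_measure_unique.
    by rewrite [ltLHS](probability_setT mu) ltry.
  move=> B mB.
  (* The vector before redrawing is left unconstrained at [i], where only the fresh value counts. *)
  pose B' j := if j == i then setT else B j.
  have mB' j : measurable (B' j) by rewrite /B'; case: ifP.
  transitivity (mu2 ([set u : fspace I R | forall j, B' j (u j)] `*` B i)).
    have mbox : measurable ([set u : fspace I R | forall j, B' j (u j)]).
      by apply: sub_sigma_algebra; exists B'.
    rewrite [RHS](@product_measure1E _ _ _ _ R mu nu)//.
    transitivity (\prod_j P (X j @^-1` B j)); first exact: muB.
    transitivity ((\prod_j P (X j @^-1` B' j)) * P (X i @^-1` B i)); last first.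
      by congr (_ * _); exact/esym/muB.
    rewrite (bigD1 i)//= [in RHS](bigD1 i)//= {1}/B' eqxx preimage_setT.
    rewrite probability_setT mul1e muleC; congr (_ * _).
    by apply: eq_bigr => j /negbTE ji; rewrite /B' ji.
  suff -> : [set u : fspace I R | forall j, B' j (u j)] `*` B i =
            Psi @^-1` [set u | forall j, B j (u j)] by [].
  apply/seteqP; split=> [[u t] /= [h Bit] j|[u t] /= h].
    by have := h j; rewrite /upd /B'; case: eqP => // ->.
  split; last by have := h i; rewrite /upd eqxx.
  by move=> j; have := h j; rewrite /upd /B'; case: eqP.
transitivity (\int[mu]_u F u).
  by rewrite /mu ge0_integral_distribution.
rewrite (eq_measure_integral mu'); last by move=> A mA _; exact: mumu'.
rewrite ge0_integral_distribution//.
transitivity (\int[mu \x nu]_z F (upd i z.1 z.2)); first by [].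
rewrite (@fubini_tonelli1 _ _ _ _ R mu nu)//; last first.
  exact: (measurableT_comp mF (@measurable_fun_upd I R i)).
rewrite ge0_integral_distribution//; first exact: measurable_resamp.
exact: resamp_ge0.
Qed.

Definition free_of (i : I) (F : fspace I R -> \bar R) :=
  forall u t, F (upd i u t) = F u.

Lemma measurable_slice i (F : fspace I R -> \bar R) (u : fspace I R) : measurable_fun setT F ->
  measurable_fun setT (fun t => F (upd i u t)).
Proof.
move=> mF.
apply: (measurableT_comp mF).
apply: measurable_fun_fspace => j; rewrite /upd.
by case: eqP => _; [exact: measurable_id|exact: measurable_cst].
Qed.

Lemma resamp_free i (F G : fspace I R -> \bar R) u : measurable_fun setT G -> (forall u, 0 <= G u) ->
  (forall u, 0 <= F u) -> free_of i F ->
  resamp i (fun u => F u * G u) u = F u * resamp i G u.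
Proof.
move=> mG G0 F0 iF; rewrite /resamp -ge0_integralZl//.
  by apply: eq_integral => t _; rewrite iF.
exact: measurable_slice.
Qed.

Lemma free_of_resamp i j F : i != j -> free_of i F -> free_of i (resamp j F).
Proof.
move=> ij iF u t; apply: eq_integral => t' _; rewrite -[RHS](iF _ t).
congr F; apply/funext => l; rewrite /upd.
by case: (eqVneq l j) => // ->; rewrite eq_sym (negbTE ij).
Qed.

(** Among the coordinates in [s], each [H j] sees only coordinate [j], so the factors are
    conditionally independent given the coordinates outside [s]. One coordinate is integrated out at
    a time, everything else being [free_of] it. *)
Lemma prod_resample (s : seq I) (F : fspace I R -> \bar R) (H : I -> fspace I R -> \bar R) : uniq s ->
  measurable_fun setT F -> (forall u, 0 <= F u) ->
  (forall j, measurable_fun setT (H j)) -> (forall j u, 0 <= H j u) ->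
  (forall i, i \in s -> free_of i F) ->
  (forall i j, i \in s -> j \in s -> i != j -> free_of i (H j)) ->
  \int[P]_w (F (rvec w) * \prod_(j <- s) H j (rvec w)) =
  \int[P]_w (F (rvec w) * \prod_(j <- s) resamp j (H j) (rvec w)).
Proof.
move=> + mF F0 mH H0.
elim: s F mF F0 => [|i s IH] F mF F0 /=.
  by move=> *; apply: eq_integral => w _; rewrite !big_nil.
move=> /andP[iNs us] fF fH.
have mprod (K : I -> fspace I R -> \bar R) r :
    (forall j, measurable_fun setT (K j)) ->
    measurable_fun setT (fun u => \prod_(j <- r) K j u).
  move=> mK; elim: r => [|j r IHr].
    apply: (eq_measurable_fun (cst 1)) => [u _|]; last exact: measurable_cst.
    by rewrite big_nil.
  apply: (eq_measurable_fun (fun u => K j u * \prod_(l <- r) K l u)) => [u _|].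
    by rewrite big_cons.
  exact: emeasurable_funM.
have prod0 (K : I -> fspace I R -> \bar R) r u : (forall j u, 0 <= K j u) ->
    0 <= \prod_(j <- r) K j u.
  by move=> K0; elim/big_ind : _ => // x y; exact: mule_ge0.
have mR j : measurable_fun setT (resamp j (H j)).
  by apply: measurable_resamp => //; exact: H0.
have R0 j u : 0 <= resamp j (H j) u by apply: resamp_ge0; exact: H0.
have inS j : j \in s -> j \in i :: s by rewrite inE => ->; rewrite orbT.
have neq_i j : j \in s -> j != i by apply: contraTneq => ->.
transitivity (\int[P]_w ((F (rvec w) * H i (rvec w)) *
                          \prod_(j <- s) H j (rvec w))).
  by apply: eq_integral => w _; rewrite big_cons muleA.
rewrite (IH (fun u => F u * H i u))//; first last.
- by move=> a b sa sb; apply: fH; exact: inS.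
- move=> a sa u t; by rewrite fF ?inS// (fH a i (inS _ sa) (mem_head _ _) (neq_i _ sa)).
- by move=> u; exact: mule_ge0.
- exact: emeasurable_funM.
pose K u := F u * \prod_(j <- s) resamp j (H j) u.
have mK : measurable_fun setT K by apply: emeasurable_funM => //;
  exact: (mprod (fun j => resamp j (H j))).
have K0 u : 0 <= K u by apply: mule_ge0 => //; exact: (prod0 (fun j => resamp j (H j))).
have fK : free_of i K.
  move=> u t; rewrite /K fF ?mem_head//; congr (_ * _).
  apply: eq_big_seq => j js; apply: free_of_resamp.
    by rewrite eq_sym neq_i.
  by apply: fH; [exact: mem_head|exact: inS|rewrite eq_sym neq_i].
transitivity (\int[P]_w (K (rvec w) * H i (rvec w))).
  by apply: eq_integral => w _; rewrite /K -!muleA [X in _ * X]muleC.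
rewrite (resampleE i (F := fun u => K u * H i u)); first last.
- by move=> u; exact: mule_ge0.
- exact: emeasurable_funM.
apply: eq_integral => w _.
by rewrite resamp_free// /K big_cons -muleA [X in _ * X]muleC.
Qed.

Lemma expectation_prod (h : I -> R -> \bar R) :
  (forall i, measurable_fun setT (h i)) -> (forall i t, 0 <= h i t) ->
  \int[P]_w (\prod_i h i (X i w)) = \prod_i \int[P]_w h i (X i w).
Proof.
move=> mh h0.
have mhe i : measurable_fun setT (fun u : fspace I R => h i (u i)).
  exact: (measurableT_comp (mh i) (@measurable_fun_eval I R i)).
transitivity (\int[P]_w (cst 1 (rvec w) *
    \prod_(i <- index_enum I) (h i (rvec w i)))).
  by apply: eq_integral => w _; rewrite mul1e.
rewrite (@prod_resample _ _ (fun i u => h i (u i)))//; first last.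
- by move=> i j _ _ ij u t; rewrite /upd eq_sym (negbTE ij).
- exact: index_enum_uniq.
transitivity (\int[P]_w (\prod_i \int[P]_w h i (X i w))).
  apply: eq_integral => w _; rewrite mul1e; apply: eq_bigr => i _.
  rewrite /resamp; under eq_integral do rewrite /upd eqxx.
  by rewrite ge0_integral_distribution//; exact: h0.
by rewrite integral_cst// [X in _ * X]probability_setT mule1.
Qed.

End resample.

(** * Change of law for independent coordinates *)

Section change_of_law.
Local Open Scope ereal_scope.
Context (R : realType) (I : finType).
Context d (T : measurableType d) (P : probability T R) (X : I -> {RV P >-> R}).
Context d' (T' : measurableType d') (Q : probability T' R)
  (Y : I -> {RV Q >-> R}).
Hypotheses (indX : mutually_independent X) (indY : mutually_independent Y).
Variables (phi : I -> R -> R) (q r : I -> R -> \bar R).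
Hypotheses (mphi : forall i, measurable_fun setT (phi i)).
Hypotheses (mq : forall i, measurable_fun setT (q i)).
Hypotheses (mr : forall i, measurable_fun setT (r i)).
Hypotheses (q0 : forall i t, 0 <= q i t) (r0 : forall i t, 0 <= r i t).
Hypothesis qoo : forall i, \int[P]_w q i (X i w) < +oo.
Hypothesis qr : forall i (A : set R), measurable A ->
  \int[P]_w ((\1_A (phi i (X i w)))%:E * q i (X i w)) =
  \int[Q]_w ((\1_A (Y i w))%:E * r i (Y i w)).

Let mprod e (S : measurableType e) (K : I -> S -> \bar R) :
  (forall j, measurable_fun setT (K j)) ->
  measurable_fun setT (fun u => \prod_j K j u).
Proof.
move=> mK; elim: (index_enum I) => [|j s IHs].
  apply: (eq_measurable_fun (cst 1)) => [u _|]; last exact: measurable_cst.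
  by rewrite big_nil.
apply: (eq_measurable_fun (fun u => K j u * \prod_(l <- s) K l u)) => [u _|].
  by rewrite big_cons.
exact: emeasurable_funM.
Qed.

Let prod0 S (K : I -> S -> \bar R) u : (forall j u, 0 <= K j u) ->
  0 <= \prod_j K j u.
Proof. by move=> K0; elim/big_ind : _ => // x y; exact: mule_ge0. Qed.

Let prod_indic (B : I -> set R) (u : I -> R) :
  (\1_([set u : fspace I R | forall i, B i (u i)]) u)%:E =
  \prod_i (\1_(B i) (u i))%:E :> \bar R.
Proof.
rewrite indicE; have [Bu|nBu] := pselect (forall i, B i (u i)).
  by rewrite mem_set// big1// => i _; rewrite indicE mem_set//; exact: Bu.
rewrite memNset//; move/existsNP : nBu => [i nBi].
by rewrite (bigD1 i)//= indicE memNset// mul0e.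
Qed.

Let wq w := \prod_i q i (X i w).
Let wr w := \prod_i r i (Y i w).

Let mwq : measurable_fun setT wq.
Proof. by apply: mprod => i; apply: measurableT_comp => //; exact: mq. Qed.
Let mwr : measurable_fun setT wr.
Proof. by apply: mprod => i; apply: measurableT_comp => //; exact: mr. Qed.
Let wq0 w : 0 <= wq w.
Proof. exact: (@prod0 _ (fun i w => q i (X i w)) w (fun i v => q0 i (X i v))). Qed.
Let wr0 w : 0 <= wr w.
Proof. exact: (@prod0 _ (fun i w => r i (Y i w)) w (fun i v => r0 i (Y i v))). Qed.

Let phiX (w : T) : fspace I R := fun i => phi i (X i w).

Let mphiX : measurable_fun setT phiX.
Proof.
by apply: measurable_fun_fspace => i; apply: measurableT_comp => //; exact: mphi.
Qed.

(** Both sides are integrals of [F] against images of weighted laws. On a box these factor over the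
    coordinates, where [qr] identifies the factors; [qoo] makes the first measure finite, so that
    boxes determine it. *)
Lemma change_of_law (F : fspace I R -> \bar R) :
  measurable_fun setT F -> (forall u, 0 <= F u) ->
  \int[P]_w (F (fun i => phi i (X i w)) * \prod_i q i (X i w)) =
  \int[Q]_w (F (rvec Y w) * \prod_i r i (Y i w)).
Proof.
move=> mF F0.
pose V : {mfun T >-> fspace I R} :=
  HB.pack phiX (isMeasurableFun.Build _ _ _ _ _ mphiX).
pose W : {mfun T' >-> fspace I R} :=
  HB.pack (rvec Y) (isMeasurableFun.Build _ _ _ _ _ (measurable_rvec Y)).
pose D1 : {measure set T -> \bar R} := density P mwq wq0.
pose D2 : {measure set T' -> \bar R} := density Q mwr wr0.
pose pD1 : {measure set (fspace I R) -> \bar R} := pushforward D1 V.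
pose pD2 : {measure set (fspace I R) -> \bar R} := pushforward D2 W.
pose m1 := pD1 (measurable_funP V).
pose m2 := pD2 (measurable_funP W).
have m12 (B : I -> set R) : (forall i, measurable (B i)) ->
    m1 [set u | forall i, B i (u i)] = m2 [set u | forall i, B i (u i)].
  move=> mB.
  have mBi i : measurable_fun setT (fun t => (\1_(B i) t)%:E : \bar R).
    by apply/measurable_EFinP; exact: measurable_indic.
  transitivity (\int[P]_w \prod_i ((\1_(B i) (phi i (X i w)))%:E * q i (X i w))).
    transitivity (\int[P]_(w in phiX @^-1` [set u | forall i, B i (u i)]) wq w).
      by [].
    rewrite integral_mkcond.
    apply: eq_integral => w _; rewrite big_split/= -prod_indic patchE indicE.
    have [h|h] := pselect (forall i, B i (phi i (X i w))).
      by rewrite !mem_set// mul1e.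
    by rewrite !memNset// mul0e.
  transitivity (\int[Q]_w \prod_i ((\1_(B i) (Y i w))%:E * r i (Y i w))).
    rewrite (expectation_prod indX
      (h := fun i t => (\1_(B i) (phi i t))%:E * q i t)); first last.
    - by move=> i t; rewrite mule_ge0// lee_fin.
    - move=> i; apply: emeasurable_funM => //.
      exact: (measurableT_comp (mBi i) (mphi i)).
    rewrite (expectation_prod indY
      (h := fun i t => (\1_(B i) t)%:E * r i t)); first last.
    - by move=> i t; rewrite mule_ge0// lee_fin.
    - by move=> i; exact: emeasurable_funM.
    by apply: eq_bigr => i _; exact: qr.
  transitivity (\int[Q]_(w in rvec Y @^-1` [set u | forall i, B i (u i)]) wr w);
    last by [].
  rewrite [RHS]integral_mkcond.
  apply: eq_integral => w _; rewrite big_split/= -prod_indic patchE indicE.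
  have [h|h] := pselect (forall i, B i (Y i w)).
    by rewrite !mem_set// mul1e.
  by rewrite !memNset// mul0e.
have m1oo : m1 setT < +oo.
  rewrite [ltLHS](_ : _ = \int[P]_w wq w)// expectation_prod//.
  have : 0 <= \prod_i \int[P]_w q i (X i w) /\ \prod_i \int[P]_w q i (X i w) < +oo.
    elim/big_ind : _ => [|x y [x0 xoo] [y0 yoo]|i _].
    - by split; [exact: lee01|exact: ltry].
    - by split; [exact: mule_ge0|rewrite lte_mul_pinfty// ge0_fin_numE].
    - by split; [apply: integral_ge0 => w _; exact: q0|exact: qoo].
  by case.
transitivity (\int[m1]_u F u).
  rewrite ge0_integral_pushforward// preimage_setT integral_density//.
    exact: (measurableT_comp mF mphiX).
  by move=> w; exact: F0.
transitivity (\int[m2]_u F u).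
  by apply: eq_measure_integral => A mA _; exact: fspace_measure_unique.
rewrite ge0_integral_pushforward// preimage_setT integral_density//.
  exact: (measurableT_comp mF (measurable_rvec Y)).
by move=> w; exact: F0.
Qed.

End change_of_law.

(** * Gamma samples *)

Section law_density.
Local Open Scope ereal_scope.
Context (R : realType).
Local Notation leb := (@lebesgue_measure R).

Lemma integral_rv_density d (T : measurableType d) (P : probability T R)
    (X : {RV P >-> R}) (g : R -> R) (h : R -> \bar R) :
  measurable_fun setT g -> (forall t, 0 <= g t)%R ->
  (forall A : set R, measurable A ->
     distribution P X A = \int[leb]_(t in A) (g t)%:E) ->
  measurable_fun setT h -> (forall t, 0 <= h t) ->
  \int[P]_w h (X w) = \int[leb]_t (h t * (g t)%:E).
Proof.
move=> mg g0 XA mh h0.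
have mg' : measurable_fun (setT : set (measurableTypeR R)) (EFin \o g).
  exact/measurable_EFinP.
have g0' (t : measurableTypeR R) : 0 <= (EFin \o g) t by rewrite lee_fin.
(* [R] and [measurableTypeR R] have the same measurable sets but are distinct
   measurable types, and Lebesgue measure lives on the latter. *)
have mX : measurable_fun setT (X : T -> measurableTypeR R).
  exact: (measurable_funP X).
pose X' : {mfun T >-> measurableTypeR R} :=
  HB.pack (X : T -> measurableTypeR R) (isMeasurableFun.Build _ _ _ _ _ mX).
transitivity (\int[distribution P X']_t h t).
  by rewrite ge0_integral_distribution.
rewrite (eq_measure_integral (density leb mg' g0')).
  by rewrite integral_density.
by move=> A mA _; exact: XA.
Qed.

Lemma integral_lebesgue_shift (c : R) (h : R -> \bar R) :
  measurable_fun setT h -> (forall t, 0 <= h t) ->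
  \int[leb]_t h (t - c)%R = \int[leb]_t h t.
Proof.
move=> mh h0.
have mc : measurable_fun setT
    ((fun t : R => t - c)%R : measurableTypeR R -> measurableTypeR R).
  have : measurable_fun setT (fun t : R => t - c)%R by exact: measurable_funB.
  exact.
pose sh : {mfun measurableTypeR R >-> measurableTypeR R} :=
  HB.pack ((fun t : R => t - c)%R : measurableTypeR R -> measurableTypeR R)
  (isMeasurableFun.Build _ _ _ _ _ mc).
have -> : \int[leb]_t h t = \int[pushforward leb sh]_t h t.
  apply: eq_measure_integral => A mA _.
  apply/lebesgue_measure_unique => //= _ [[a b]] _ <-.
  rewrite /pushforward/=.
  rewrite (_ : _ @^-1` _ = `]a + c, b + c]%classic)%R; last first.
    by apply/seteqP; split => x /=; rewrite !in_itv/= ltrBrDr lerBlDr.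
  rewrite !lebesgue_measure_itv/= !lte_fin ltrD2r.
  by case: ifP => // _; rewrite -!EFinB; congr EFin; ring.
by rewrite ge0_integral_pushforward// preimage_setT.
Qed.

End law_density.

Section gamma_density.
Context (R : realType).

Lemma gamma_pdf_ge0 k (theta t : R) : 0 <= theta -> 0 <= gamma_pdf k theta t.
Proof.
move=> th0; rewrite /gamma_pdf; case: ifPn => // t0.
by rewrite !mulr_ge0 ?expR_ge0 ?exprn_ge0 ?invr_ge0.
Qed.

Lemma measurable_gamma_pdf k (theta : R) :
  measurable_fun setT (gamma_pdf k theta).
Proof.
rewrite /gamma_pdf; apply: measurable_fun_ifT => //.
  exact: measurable_fun_ler.
apply: measurable_funM.
  by apply: measurable_funM => //; apply: measurable_funM => //; exact: measurable_funX.
by apply: measurableT_comp => //; exact: measurableT_comp.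
Qed.

Lemma gamma_pdf_rate k (theta t : R) : 0 < theta ->
  gamma_pdf k theta t =
  theta ^+ k * expR (- ((theta - 1) * `|t|)) * gamma_pdf k 1 t.
Proof.
move=> th0; rewrite /gamma_pdf; case: ifPn => [t0|_]; last by rewrite mulr0.
rewrite ger0_norm// expr1n mulr1 mul1r.
rewrite (_ : - (theta * t) = - ((theta - 1) * t) + - t); last by ring.
by rewrite expRD; ring.
Qed.

End gamma_density.

Section gamma_change_of_rate.
Local Open Scope ereal_scope.
Context (R : realType) (m k : nat).
Context d (T : measurableType d) (P : probability T R) (X : 'I_m -> {RV P >-> R}).
Context d' (T' : measurableType d') (Q : probability T' R)
  (Y : 'I_m -> {RV Q >-> R}).
Variable theta : R.
Hypothesis theta0 : (0 < theta)%R.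
Hypotheses (gX : gamma_sample k theta X) (gY : gamma_sample k 1 Y).

(** This is [change_of_law] with the identity map, weight 1 on one side and the ratio of the
    densities on the other. The absolute values are almost surely immaterial; they make the sum
    nonnegative everywhere. *)
Lemma gamma_change_of_rate (F : fspace 'I_m R -> \bar R) :
  measurable_fun setT F -> (forall u, 0 <= F u) ->
  \int[P]_w F (rvec X w) = \int[Q]_w (F (rvec Y w) *
    (theta ^+ (k * m) * expR (- ((theta - 1) * \sum_(i < m) `|Y i w|)))%:E).
Proof.
case: gX => indX lX; case: gY => indY lY mF F0.
pose r (i : 'I_m) (t : R) : \bar R :=
  (theta ^+ k * expR (- ((theta - 1) * `|t|)))%:E.
have mr i : measurable_fun setT (r i).
  apply/measurable_EFinP; apply: measurable_funM => //.
  apply: measurableT_comp => //; apply: measurableT_comp => //.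
  apply: measurable_funM => //; exact: measurableT_comp.
have r0 i t : 0 <= r i t.
  by rewrite lee_fin mulr_ge0 ?expR_ge0// exprn_ge0// ltW.
have := @change_of_law R _ _ _ P X _ _ Q Y indX indY (fun _ => id)
  (fun _ _ => 1) r.
move=> /(_ (fun _ => @measurable_id _ _ _)).
move=> /(_ (fun _ => @measurable_cst _ _ _ _ _ _)).
move=> /(_ mr (fun _ _ => lee01) r0).
have h1 : 'I_m -> \int[P]_w 1 < +oo.
  by move=> _; rewrite integral_cst// mul1e [ltLHS]probability_setT ltry.
move=> /(_ h1).
have h2 (i : 'I_m) (A : set R) : measurable A ->
  \int[P]_w ((\1_A (X i w))%:E * 1) = \int[Q]_w ((\1_A (Y i w))%:E * r i (Y i w)).
  move=> mA.
  have mA' : measurable_fun setT (fun t => (\1_A t)%:E : \bar R).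
    by apply/measurable_EFinP; exact: measurable_indic.
  under eq_integral do rewrite mule1.
  rewrite (integral_rv_density (h := fun t => (\1_A t)%:E) _ _ (lX i))//; first last.
  - by move=> t; exact/gamma_pdf_ge0/ltW.
  - exact: measurable_gamma_pdf.
  rewrite (integral_rv_density (h := fun t => (\1_A t)%:E * r i t) _ _ (lY i))//; first last.
  - by move=> t; rewrite mule_ge0// lee_fin.
  - exact: emeasurable_funM.
  - by move=> t; exact: gamma_pdf_ge0.
  - exact: measurable_gamma_pdf.
  by apply: eq_integral => t _; rewrite gamma_pdf_rate// EFinM -!muleA.
move=> /(_ h2 F mF F0) E.
transitivity (\int[P]_w (F (fun i => X i w) * \prod_(i < m) 1)).
  by apply: eq_integral => w _; rewrite big1// mule1.
rewrite E; apply: eq_integral => w _; congr (_ * _).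
rewrite /r prodEFin; congr EFin.
rewrite big_split/= prodr_const card_ord -exprM; congr (_ * _)%R.
by rewrite -expR_sum sumrN mulr_sumr.
Qed.

End gamma_change_of_rate.

(** * The law of the bucket minima *)

Section finite_counting.
Local Open Scope set_scope.

(** The multinomial coefficient, without division. Sorted by their head [x], the tuples have tails
    of content [c' x], and the product of the factorials of [c] is [c x] times that of [c' x]; the
    sum of the [c x] supplies the factor [n.+1]. *)
Lemma card_tuples_of_content (L : finType) (n : nat) (c : L -> nat) :
  (\sum_l c l)%N = n ->
  (#|[set t : n.-tuple L | [forall l, count_mem l t == c l]]| *
   \prod_l (c l)`! = n`!)%N.
Proof.
elim: n c => [|n IH] c cn.
  have c0 l : c l = 0%N.
    by apply/eqP; move/eqP: cn; rewrite sum_nat_eq0 => /forallP /(_ l).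
  rewrite big1 ?muln1 => [|l _]; last by rewrite c0.
  rewrite (_ : [set t | _] = [set [tuple]]) ?cards1//.
  apply/finset.setP => t; rewrite !inE tuple0 eqxx; apply/forallP => l.
  by rewrite /= c0.
pose c' x l := (c l - (l == x))%N.
(* When [c x = 0], truncated subtraction leaves [c' x] equal to [c], so this case is set apart. *)
have tupE x : #|[set t : n.+1.-tuple L | (thead t == x) &&
      [forall l, count_mem l t == c l]]| =
    if (0 < c x)%N then
      #|[set t : n.-tuple L | [forall l, count_mem l t == c' x l]]| else 0%N.
  case: ifPn => [cx|]; last first.
    rewrite -eqn0Ngt => /eqP cx; apply/eqP; rewrite cards_eq0; apply/eqP/finset.setP => t.
    rewrite !inE; apply/negP => /andP[/eqP tx /forallP /(_ x)].
    by rewrite (tuple_eta t) /= tx eqxx cx.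
  rewrite -[RHS](card_imset (f := fun t : n.-tuple L => [tuple of x :: t])).
    apply: eq_card => t; rewrite !inE; apply/idP/imsetP.
      move=> /andP[/eqP tx /forallP ct].
      exists [tuple of behead t]; last first.
        by rewrite {1}(tuple_eta t) tx.
      rewrite inE; apply/forallP => l; have /eqP := ct l.
      rewrite {1}(tuple_eta t) tx /c' /= => <-.
      by rewrite [l == x]eq_sym addKn.
    move=> [t' ct' ->]; rewrite theadE eqxx /=.
    move: ct'; rewrite inE => /forallP ct'; apply/forallP => l.
    rewrite /= (eqP (ct' l)) /c' [x == l]eq_sym addnC subnK//.
    by case: eqP => // ->.
  by move=> t1 t2 /(congr1 val) [] /val_inj.
have setE : #|[set t : n.+1.-tuple L | [forall l, count_mem l t == c l]]| =
    (\sum_x #|[set t : n.+1.-tuple L | (thead t == x) &&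
      [forall l, count_mem l t == c l]]|)%N.
  rewrite -sum1_card (partition_big (fun t => thead t) xpredT)//=.
  apply: eq_bigr => x _; rewrite -sum1_card; apply: eq_bigl => t.
  by rewrite !inE andbC.
rewrite setE big_distrl/= factS -[in RHS]cn big_distrl/=.
apply: eq_bigr => x _; rewrite tupE; case: ifPn => [cx|]; last first.
  by rewrite -eqn0Ngt => /eqP ->; rewrite !mul0n.
have c'n : (\sum_l c' x l)%N = n.
  apply: succn_inj; rewrite -cn -addn1.
  rewrite (bigD1 x)//= [in RHS](bigD1 x)//= /c' eqxx.
  rewrite (eq_bigr c) => [|l /negbTE ->]; last by rewrite subn0.
  by rewrite addnAC subnK.
have -> : (\prod_l (c l)`! = c x * \prod_l (c' x l)`!)%N.
  rewrite (bigD1 x)//= [in RHS](bigD1 x)//= /c' eqxx.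
  rewrite [in RHS](eq_bigr (fun l => (c l)`!)) => [|l /negbTE ->]; last first.
    by rewrite subn0.
  by rewrite mulnA; case: (c x) cx => // a _; rewrite subn1 factS.
by rewrite mulnCA IH.
Qed.

End finite_counting.

Section kth_min_combinatorics.
Context (R : realType).

(** In a sorted list the elements satisfying a downward closed predicate form a prefix. If the list
    is too short the default is returned, which is why it has to fail [p]. *)
Lemma nth_sort_downclosed (p : pred R) (x0 : R) (s : seq R) (k : nat) :
  (forall x y, x <= y -> p y -> p x) -> ~~ p x0 -> (0 < k)%N ->
  p (nth x0 (sort <=%R s) k.-1) = (k <= count p s)%N.
Proof.
move=> pd px0; case: k => // k _ /=.
have -> : count p s = count p (sort <=%R s).
  by apply/permP; rewrite perm_sym; exact/permEl/perm_sort.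
have := sort_le_sorted s; elim: (sort _ s) k => [|x t IH] k.
  by rewrite nth_nil (negbTE px0).
move=> /= xt; have tsorted := path_sorted xt.
case: k => [|k] /=; last first.
  rewrite IH//; case px : (p x) => //=.
  have pt : count p t = 0%N.
    apply/eqP; rewrite -leqn0 leqNgt -has_count; apply/hasPn => y yt.
    have xy : x <= y.
      by move: xt; rewrite (path_sortedE le_trans) => /andP[/allP/(_ y yt)].
    by apply: contraFN px; exact: pd.
  by rewrite pt.
case px : (p x) => //=.
apply/esym/negbTE; rewrite -ltnNge ltnS leqn0; apply/eqP.
apply/eqP; rewrite -leqn0 leqNgt -has_count; apply/hasPn => y yt.
have xy : x <= y.
  by move: xt; rewrite (path_sortedE le_trans) => /andP[/allP/(_ y yt)].
by apply: contraFN px; exact: pd.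
Qed.

End kth_min_combinatorics.

(** * Labellings of the sample by rank within the buckets *)

Section labellings.
Context (R : realType) (k m n : nat).
Hypotheses (k0 : (0 < k)%N) (m0 : (0 < m)%N) (kmn : (k * m <= n)%N).
Implicit Types (u : 'I_n -> R) (i : 'I_m) (j : 'I_n).

Definition in_bucket i (x : R) : bool := i%:R / m%:R <= x < i.+1%:R / m%:R.

Lemma in_bucket_inj i i' x : in_bucket i x -> in_bucket i' x -> i = i'.
Proof.
move=> /andP[ix xi] /andP[i'x xi']; apply/val_inj/eqP; rewrite eqn_leq.
have m0' : (0 : R) < m%:R by rewrite ltr0n.
have := le_lt_trans ix xi'; rewrite ltr_pM2r ?invr_gt0// ltr_nat ltnS => -> /=.
by have := le_lt_trans i'x xi; rewrite ltr_pM2r ?invr_gt0// ltr_nat ltnS.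
Qed.

(** Treats [<] and [<=] at once. The default value of [kth_min] is the upper end of the bucket,
    whence the bounds on [x] in the two lemmas that follow. *)
Lemma kth_minE (p : pred R) u i :
  (forall x y, x <= y -> p y -> p x) -> ~~ p (i.+1%:R / m%:R) ->
  p (kth_min k u i) = (k <= #|[pred j | in_bucket i (u j) & p (u j)]|)%N.
Proof.
move=> pd pN; rewrite /kth_min nth_sort_downclosed//; congr (_ <= _)%N.
rewrite count_map count_filter enumT cardE /enum_mem size_filter.
by apply: eq_count => j /=; rewrite andbC.
Qed.

Lemma kth_min_lt u i x : x <= i.+1%:R / m%:R ->
  (kth_min k u i < x) =
  (k <= #|[pred j | in_bucket i (u j) & (u j < x)%R]|)%N.
Proof.
move=> xi; apply: (kth_minE (p := fun y => y < x)); last by rewrite -leNgt.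
by move=> a b ab; exact: le_lt_trans.
Qed.

Lemma kth_min_le u i x : x < i.+1%:R / m%:R ->
  (kth_min k u i <= x) =
  (k <= #|[pred j | in_bucket i (u j) & (u j <= x)%R]|)%N.
Proof.
move=> xi; apply: (kth_minE (p := fun y => y <= x)); last by rewrite -ltNge.
by move=> a b ab; exact: le_trans.
Qed.

Lemma kth_min_ge u i : i%:R / m%:R <= kth_min k u i.
Proof.
rewrite leNgt kth_min_lt; last first.
  by rewrite ler_pM2r ?invr_gt0 ?ltr0n// ler_nat.
rewrite eq_card0 -?ltnNge// => j; rewrite !inE /in_bucket.
by apply/negP => /andP[/andP[a _] b]; move: (lt_le_trans b a); rewrite ltxx.
Qed.

Lemma kth_min_le_hi u i : kth_min k u i <= i.+1%:R / m%:R.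
Proof.
rewrite /kth_min; set s := sort _ _.
have [ks|ks] := ltnP k.-1 (size s); last by rewrite nth_default.
have := mem_nth (i.+1%:R / m%:R) ks; rewrite mem_sort => /mapP[j].
by rewrite mem_filter => /andP[/andP[_ /ltW h] _ ->].
Qed.

(* A point is labelled [Some (i, true)] if it is the k-th smallest in bucket i,
   [Some (i, false)] if it lies below that one in bucket i, and [None] otherwise. *)
Definition label : finType := option ('I_m * bool).

Definition content (l : label) : nat :=
  match l with
  | Some (_, true) => 1
  | Some (_, false) => k.-1
  | None => n - k * m
  end.

Definition valid (t : n.-tuple label) : bool :=
  [forall l, count_mem l t == content l].

Lemma sum_content : (\sum_l content l)%N = n.
Proof.
rewrite (bigD1 None)//=.
have -> : (\sum_(l : label | l != None) content l = \sum_(p : 'I_m * bool) content (Some p))%N.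
  by rewrite (reindex_omap Some id) => [|[]]//=; apply: eq_bigl => p; rewrite eqxx.
rewrite (eq_bigr (fun p => content (Some (p.1, p.2)))) => [|[]//].
rewrite -(pair_bigA _ (fun i b => content (Some (i, b))))/=.
rewrite (eq_bigr (fun _ => k)) => [|i _]; last first.
  by rewrite big_bool /= add1n prednK.
by rewrite /= sum_nat_const card_ord (mulnC m) subnK.
Qed.

Lemma card_valid :
  (#|[pred t | valid t]| * ((k.-1)`! ^ m * (n - k * m)`!) = n`!)%N.
Proof.
have <- := card_tuples_of_content sum_content.
congr (_ * _)%N; first by apply: eq_card => t; rewrite !inE.
rewrite [in RHS](bigD1 None)//= mulnC; congr (_ * _)%N.
have -> : (\prod_(l : label | l != None) (content l)`! = \prod_(p : 'I_m * bool) (content (Some p))`!)%N.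
  by rewrite (reindex_omap Some id) => [|[]]//=; apply: eq_bigl => p; rewrite eqxx.
rewrite (eq_bigr (fun p => (content (Some (p.1, p.2)))`!)) => [|[]//].
rewrite -(pair_bigA _ (fun i b => (content (Some (i, b)))`!))/=.
rewrite (eq_bigr (fun _ => (k.-1)`!)) => [|i _]; last first.
  by rewrite big_bool /= mul1n.
by rewrite prod_nat_const card_ord.
Qed.

Lemma count_label (t : n.-tuple label) l :
  count_mem l t = #|[pred j | tnth t j == l]|.
Proof.
rewrite -{1}(map_tnth_enum t) count_map enumT cardE /enum_mem size_filter.
exact: eq_count.
Qed.

Variable j0 : 'I_n.

(** The fallback to [j0] does not occur for a valid labelling, in which this label is borne by
    exactly one point. *)
Definition pivot (t : n.-tuple label) i : 'I_n :=
  odflt j0 [pick j | tnth t j == Some (i, true)].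

Lemma pivotP t i j : valid t -> (tnth t j == Some (i, true)) = (j == pivot t i).
Proof.
move=> /forallP /(_ (Some (i, true))) /=; rewrite count_label => /eqP/esym.
rewrite /pivot; case: pickP => [j' /= /eqP j'E c1|h].
  have /card1P[a ea] : #|[pred j | tnth t j == Some (i, true)]| == 1%N by rewrite -c1.
  have /eqP ja : j' == a by have := ea j'; rewrite !inE j'E eqxx => <-.
  by have := ea j; rewrite !inE /= ja.
by rewrite eq_card0.
Qed.

Lemma tnth_pivot t i : valid t -> tnth t (pivot t i) = Some (i, true).
Proof. by move=> vt; apply/eqP; rewrite pivotP. Qed.

Lemma pivot_inj t : valid t -> injective (pivot t).
Proof.
move=> vt i i' /(congr1 (tnth t)); rewrite !tnth_pivot//.
by move=> -[].
Qed.

(** Depends on [u j] and the pivots only, so that given the pivots the conditions on different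
    points are independent. Pivots always pass; their own position is tested in [consistent]. *)
Definition fits (t : n.-tuple label) u j : bool :=
  match tnth t j with
  | Some (_, true) => true
  | Some (i, false) => i%:R / m%:R <= u j < u (pivot t i)
  | None => [forall i : 'I_m, ~~ (i%:R / m%:R <= u j <= u (pivot t i))]
  end.

Definition consistent (t : n.-tuple label) u : bool :=
  [forall i, in_bucket i (u (pivot t i))] && [forall j, fits t u j].

Lemma consistent_below t u i j : valid t -> consistent t u ->
  (tnth t j == Some (i, false)) = in_bucket i (u j) && (u j < u (pivot t i)).
Proof.
move=> vt /andP[/forallP ib /forallP /(_ j)]; rewrite /fits.
case tj : (tnth t j) => [[i' [|]]|] => [_|/andP[a b]|/forallP/(_ i) h].
- move/eqP : tj; rewrite pivotP// => /eqP ->.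
  apply/idP/idP => [/eqP[]//|/andP[/in_bucket_inj /(_ (ib i')) ->]].
  by rewrite ltxx.
- have ibj : in_bucket i' (u j).
    rewrite /in_bucket a (lt_trans b)//.
    by have /andP[] := ib i'.
  apply/eqP/andP => [[<-]//|[/in_bucket_inj/(_ ibj) -> //]].
- apply/idP/idP => [/eqP//|/andP[/andP[a _] b]].
  by move: h; rewrite a (ltW b).
Qed.

(** Exactly [k.-1] points of the bucket lie strictly below the pivot; with the pivot itself, at
    least [k] lie at or below it. *)
Lemma consistent_kth t u i : valid t -> consistent t u ->
  kth_min k u i = u (pivot t i).
Proof.
move=> vt ct; have /andP[/forallP ib _] := ct.
have /andP[ib1 ib2] := ib i.
have cb : #|[pred j | in_bucket i (u j) & (u j < u (pivot t i))%R]| = k.-1.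
  have /forallP /(_ (Some (i, false))) := vt; rewrite count_label => /eqP /= <-.
  by apply: eq_card => j; rewrite !inE (consistent_below _ _ vt ct).
apply/eqP; rewrite eq_le [X in _ && X]leNgt kth_min_lt ?(ltW ib2)// cb.
rewrite -ltnNge prednK// leqnn andbT kth_min_le//.
rewrite -[leqLHS](prednK k0) -cb -add1n -(card1 (pivot t i)).
rewrite -cardUI [X in (_ + X)%N](_ : _ = 0%N); last first.
  apply: eq_card0 => j; rewrite !inE.
  by case: eqP => //= ->; rewrite ltxx andbF.
rewrite addn0; apply: subset_leq_card; apply/fintype.subsetP => j; rewrite !inE.
by case/orP => [/eqP ->|/andP[-> /ltW ->]//]; rewrite ib lexx.
Qed.

(** The labelling read off the sample. For distinct values, a valid consistent labelling must agree
    with it, which gives uniqueness, and it is itself consistent when every bucket holds [k]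
    points. *)
Definition label_of u j : label :=
  if [pick i | in_bucket i (u j)] is Some i then
    if u j == kth_min k u i then Some (i, true)
    else if u j < kth_min k u i then Some (i, false) else None
  else None.

Lemma label_ofE u i j : in_bucket i (u j) -> label_of u j =
    if u j == kth_min k u i then Some (i, true)
    else if u j < kth_min k u i then Some (i, false) else None.
Proof.
move=> ij; rewrite /label_of; case: pickP => [i' i'j|/(_ i)]; last by rewrite ij.
by rewrite (in_bucket_inj i'j ij).
Qed.

Lemma consistent_label_of t u j : valid t -> consistent t u -> injective u ->
  tnth t j = label_of u j.
Proof.
move=> vt ct uinj; have /andP[/forallP ib /forallP /(_ j)] := ct; rewrite /fits.
case tj : (tnth t j) => [[i [|]]|] h.
- move/eqP : tj; rewrite pivotP// => /eqP jE.
  by rewrite (@label_ofE _ i) jE ?ib// (consistent_kth _ vt ct) eqxx.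
- have := consistent_below i j vt ct; rewrite tj eqxx => /esym/andP[ij ji].
  by rewrite (label_ofE ij) (consistent_kth _ vt ct) ji lt_eqF.
- rewrite /label_of; case: pickP => // i ij.
  move/forallP : h => /(_ i); have /andP[-> _] /= := ij; rewrite -ltNge.
  rewrite (consistent_kth _ vt ct) => iu.
  by rewrite gt_eqF// ltNge (ltW iu).
Qed.

Lemma consistent_unique t t' u : valid t -> valid t' -> injective u ->
  consistent t u -> consistent t' u -> t = t'.
Proof.
move=> vt vt' uinj ct ct'; apply: eq_from_tnth => j.
by rewrite (consistent_label_of j vt ct)// (consistent_label_of j vt' ct').
Qed.

Lemma consistent_exists u : injective u ->
  (forall i, kth_min k u i < i.+1%:R / m%:R) -> exists2 t, valid t & consistent t u.
Proof.
move=> uinj kh.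
pose t : n.-tuple label := [tuple label_of u j | j < n].
have tE j : tnth t j = label_of u j by rewrite tnth_mktuple.
have trueE i j : (label_of u j == Some (i, true)) =
    in_bucket i (u j) && (u j == kth_min k u i).
  rewrite /label_of; case: pickP => [i' i'j|-> //].
  apply/eqP/andP => [|[ij /eqP uj]].
    by case: eqP => [ui' [<-]|_]; [split => //; exact/eqP|case: ifP].
  by rewrite (in_bucket_inj i'j ij) uj eqxx.
have falseE i j : (label_of u j == Some (i, false)) =
    in_bucket i (u j) && (u j < kth_min k u i).
  rewrite /label_of; case: pickP => [i' i'j|-> //].
  apply/eqP/andP => [|[ij uj]].
    by case: eqP => // _; case: ifP => // ui' [<-].
  by rewrite (in_bucket_inj i'j ij) lt_eqF// uj.
(* By injectivity at most one point equals the k-th value; at least [k] are at or below it and fewer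
   than [k] strictly below. Hence exactly one is equal and exactly [k.-1] are below. *)
have c1 i : (#|[pred j | in_bucket i (u j) & (u j == kth_min k u i)%R]| <= 1)%N.
  apply/card_le1_eqP => a b; rewrite !inE => /andP[_ /eqP au] /andP[_ /eqP bu].
  by apply: uinj; rewrite au bu.
have cle i : #|[pred j | in_bucket i (u j) & (u j <= kth_min k u i)%R]| =
   (#|[pred j | in_bucket i (u j) & (u j == kth_min k u i)%R]| +
    #|[pred j | in_bucket i (u j) & (u j < kth_min k u i)%R]|)%N.
  rewrite -cardUI [X in (_ + X)%N](_ : _ = 0%N) ?addn0.
    by apply: eq_card => j; rewrite !inE le_eqVlt andb_orr.
  apply: eq_card0 => j; rewrite !inE.
  by case: (in_bucket i (u j)) => //=; case: eqP => //= ->; rewrite ltxx.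
have kle i : (k <= #|[pred j | in_bucket i (u j) & (u j <= kth_min k u i)%R]|)%N.
  by rewrite -kth_min_le.
have klt i : (#|[pred j | in_bucket i (u j) & (u j < kth_min k u i)%R]| < k)%N.
  by rewrite ltnNge -kth_min_lt ?ltxx// ltW.
have e1 i : #|[pred j | in_bucket i (u j) & (u j == kth_min k u i)%R]| = 1%N.
  by have := c1 i; have := kle i; have := klt i; rewrite cle; lia.
have e2 i : #|[pred j | in_bucket i (u j) & (u j < kth_min k u i)%R]| = k.-1.
  by have := kle i; have := klt i; rewrite cle e1; lia.
have ct i : count_mem (Some (i, true) : label) t = 1%N.
  rewrite count_label -[RHS](e1 i); apply: eq_card => j.
  by rewrite !inE tE trueE.
have cf i : count_mem (Some (i, false) : label) t = k.-1.
  rewrite count_label -[RHS](e2 i); apply: eq_card => j.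
  by rewrite !inE tE falseE.
(* The last label is counted by subtraction from the total [n]. *)
have cN : count_mem (None : label) t = (n - k * m)%N.
  have : (\sum_(l : label) count_mem l t = n)%N.
    rewrite -[RHS](size_tuple t); elim: (tval t) => [|x s IHs] /=.
      by rewrite big1.
    rewrite big_split /= IHs (bigD1 x)//= eqxx big1 ?addn0// => l lx.
    by rewrite eq_sym (negbTE lx).
  have := sum_content; rewrite (bigD1 None)//= => E.
  rewrite (bigD1 None)//= -[RHS]E.
  rewrite (eq_bigr content); last first.
    by move=> [[i []]|] // _; rewrite ?ct ?cf.
  by move=> /eqP; rewrite eqn_add2r => /eqP.
have vt : valid t.
  by apply/forallP => -[[i []]|]; rewrite ?ct ?cf ?cN.
have piv i : in_bucket i (u (pivot t i)) && (u (pivot t i) == kth_min k u i).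
  by have := pivotP i (pivot t i) vt; rewrite eqxx tE trueE.
have pe i : u (pivot t i) = kth_min k u i by have /andP[_ /eqP] := piv i.
exists t => //; apply/andP; split.
  by apply/forallP => i; have /andP[] := piv i.
apply/forallP => j.
rewrite /fits; case tj : (tnth t j) => [[i []]|] //.
  have /eqP := tj; rewrite tE falseE pe => /andP[/andP[-> _] ->] //.
apply/forallP => i; apply/negP => /andP[a]; rewrite pe => b.
have ij : in_bucket i (u j) by rewrite /in_bucket a (le_lt_trans b).
have := tj; rewrite tE (label_ofE ij).
by case: eqP => // /eqP ne; rewrite lt_neqAle ne b.
Qed.

End labellings.

(** * Measurability of order statistics *)

Section measurable_boolean.
Context d (T : measurableType d) (R : realType).

Lemma measurable_forallb (I : finType) (b : I -> T -> bool) :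
  (forall i, measurable_fun setT (b i)) ->
  measurable_fun setT (fun x => [forall i, b i x]).
Proof.
move=> mb; apply: (@measurable_fun_bool _ _ setT _ true); rewrite setTI.
rewrite (_ : _ @^-1` _ = \bigcap_(i in [set: I]) (b i @^-1` [set true])).
  apply: fin_bigcap_measurable => // i _.
  by rewrite -[X in measurable X]setTI; exact: mb.
apply/seteqP; split => [x /= /forallP h i _|x /= h]; first exact: h.
by apply/forallP => i; exact: h.
Qed.

Lemma measurable_natr_bool (b : T -> bool) : measurable_fun setT b ->
  measurable_fun setT (fun x => (b x)%:R : R).
Proof.
move=> mb; apply: (eq_measurable_fun (fun x => if b x then 1 else 0 : R)).
  by move=> x _; case: (b x).
exact: measurable_fun_ifT.
Qed.

Lemma measurable_leq_card (I : finType) (k : nat) (b : I -> T -> bool) :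
  (forall i, measurable_fun setT (b i)) ->
  measurable_fun setT (fun x => (k <= #|[pred i | b i x]|)%N).
Proof.
move=> mb; apply: (eq_measurable_fun (fun x => k%:R <= \sum_i (b i x)%:R :> R)).
  move=> x _; rewrite -(ler_nat R) -sum1_card natr_sum [in RHS]big_mkcond /=.
  by congr (_ <= _); apply: eq_bigr => i _; rewrite inE; case: (b i x).
apply: measurable_fun_ler => //; apply: measurable_sum => i.
exact: measurable_natr_bool.
Qed.

Lemma measurable_fun_lt_level (f : T -> R) :
  (forall x, measurable_fun setT (fun t => f t < x)) -> measurable_fun setT f.
Proof.
move=> mf; apply: (measurability _ (RGenInftyO.measurableE R)).
move=> _ [_ [x -> <-]]; rewrite setTI.
rewrite (_ : _ @^-1` _ = (fun t => f t < x) @^-1` [set true]).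
  by rewrite -[X in measurable X]setTI; exact: mf.
by apply/seteqP; split => t /=; rewrite in_itv/=.
Qed.

End measurable_boolean.

Section measurable_kth_min.
Context (R : realType) (k m n : nat).
Hypotheses (k0 : (0 < k)%N) (m0 : (0 < m)%N).

(** For a level up to the upper end of the bucket, the sublevel set is a condition on a number of
    points; beyond that end it is the whole space. *)
Lemma measurable_kth_min (i : 'I_m) :
  measurable_fun setT (fun u : fspace 'I_n R => kth_min k u i).
Proof.
apply: measurable_fun_lt_level => x.
have [xi|ix] := leP x (i.+1%:R / m%:R : R).
  rewrite (_ : (fun u => _) = (fun u : fspace 'I_n R =>
      (k <= #|[pred j | in_bucket i (u j) && (u j < x)%R]|)%N)); last first.
    by apply/funext => u; rewrite kth_min_lt.
  apply: (@measurable_leq_card _ (fspace 'I_n R) R 'I_n k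
    (fun j u => in_bucket i (u j) && (u j < x))) => j.
  have me := @measurable_fun_eval 'I_n R j.
  apply: measurable_and; last exact: measurable_fun_ltr.
  by apply: measurable_and; [exact: measurable_fun_ler|exact: measurable_fun_ltr].
apply: (eq_measurable_fun (cst true)) => [u _|]; last exact: measurable_cst.
by rewrite /= (le_lt_trans _ ix)// kth_min_le_hi.
Qed.

Definition shifted_kth (u : fspace 'I_n R) : fspace 'I_m R :=
  fun i => kth_min k u i - i%:R / m%:R.

Lemma measurable_shifted_kth : measurable_fun setT shifted_kth.
Proof.
apply: measurable_fun_fspace => i; apply: measurable_funB => //.
exact: measurable_kth_min.
Qed.

End measurable_kth_min.

(** * Uniform samples *)

Section uniform_sample.
Local Open Scope ereal_scope.
Context (R : realType) (n : nat).
Context d (T : measurableType d) (P : probability T R) (U : 'I_n -> {RV P >-> R}).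
Hypothesis hU : uniform01_sample U.

Lemma integral_uniform_rv (j : 'I_n) (h : R -> \bar R) :
  measurable_fun setT h -> (forall t, 0 <= h t) ->
  \int[distribution P (U j)]_t h t =
  \int[@lebesgue_measure R]_t (h t * (uniform_pdf 0%R 1%R t)%:E).
Proof.
move=> mh h0; rewrite ge0_integral_distribution//.
apply: (integral_rv_density _ _ (hU.2 j)) => //.
- exact: measurable_uniform_pdf.
- by move=> t; exact: uniform_pdf_ge0.
Qed.

Lemma uniform_indic (j : 'I_n) (b : R -> bool) (i : interval R) :
  (forall t, b t = (t \in i)) -> [set` i] `<=` `[0%R, 1%R]%classic ->
  \int[distribution P (U j)]_t ((b t)%:R)%:E = lebesgue_measure [set` i].
Proof.
move=> bi i01.
have mb : measurable_fun setT (fun t : R => ((b t)%:R)%:E : \bar R).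
  apply/measurable_EFinP/measurable_natr_bool.
  apply: (@measurable_fun_bool _ _ setT _ true); rewrite setTI.
  rewrite (_ : _ @^-1` _ = [set` i])//.
  by apply/seteqP; split => t /=; rewrite bi.
rewrite integral_uniform_rv//.
rewrite -[RHS]mul1e -integral_cst// [RHS]integral_mkcond.
apply: eq_integral => t _; rewrite patchE mem_setE /= bi.
case: ifPn => [ti|ti]; last by rewrite mul0e.
have := i01 t ti; rewrite /= in_itv/= /uniform_pdf => ->.
by rewrite subr0 invr1 mule1.
Qed.

Lemma uniform_itv_cc (j : 'I_n) (c e : R) : (0 <= c)%R -> (c <= e)%R -> (e <= 1)%R ->
  \int[distribution P (U j)]_t ((c <= t <= e)%R%:R)%:E = (e - c)%:E.
Proof.
move=> c0 ce e1; rewrite (@uniform_indic j _ `[c, e]).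
- rewrite lebesgue_measure_itv/= lte_fin -EFinB.
  by move: ce; rewrite le_eqVlt => /orP[/eqP ->|->]; rewrite ?ltxx ?subrr.
- by move=> t; rewrite in_itv.
- by apply: subset_itv; rewrite bnd_simp.
Qed.

Lemma uniform_itv_co (j : 'I_n) (c e : R) : (0 <= c)%R -> (c <= e)%R -> (e <= 1)%R ->
  \int[distribution P (U j)]_t ((c <= t < e)%R%:R)%:E = (e - c)%:E.
Proof.
move=> c0 ce e1; rewrite (@uniform_indic j _ `[c, e[).
- rewrite lebesgue_measure_itv/= lte_fin -EFinB.
  by move: ce; rewrite le_eqVlt => /orP[/eqP ->|->]; rewrite ?ltxx ?subrr.
- by move=> t; rewrite in_itv.
- by apply: subset_itv; rewrite bnd_simp.
Qed.

Lemma uniform_eq (j : 'I_n) (c : R) :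
  \int[distribution P (U j)]_t ((t == c)%:R)%:E = 0.
Proof.
have [c01|c01] := boolP (c \in `[0%R, 1%R]).
  rewrite -[RHS](lebesgue_measure_set1 c) -set_itv1.
  apply: uniform_indic => [t|]; first by rewrite in_itv/= -eq_le eq_sym.
  by rewrite set_itv1 => t ->.
rewrite -[RHS](@measure0 _ _ _ (@lebesgue_measure R)).
have mc : measurable_fun setT (fun t : R => ((t == c)%:R)%:E : \bar R).
  by apply/measurable_EFinP/measurable_natr_bool; exact: measurable_fun_eqr.
rewrite integral_uniform_rv//.
rewrite measure0; apply: integral0_eq => t _.
case: eqP => [->|_]; last by rewrite mul0e.
by move: c01; rewrite in_itv/= /uniform_pdf => /negbTE ->; rewrite mule0.
Qed.

Lemma ae_neq (j : 'I_n) (c : R) : {ae P, forall w, U j w != c}.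
Proof.
have mE : measurable [set w | U j w == c].
  have : measurable_fun setT (fun w => U j w == c) by exact: measurable_fun_eqr.
  move=> /(_ measurableT [set true] I); rewrite setTI => mE.
  by rewrite (_ : [set w | _] = (fun w => U j w == c) @^-1` [set true]).
exists [set w | U j w == c]; split => //.
  rewrite -[LHS]mul1e -integral_cst// integral_mkcond.
  rewrite -[RHS](uniform_eq j c) ge0_integral_distribution//; last first.
    by apply/measurable_EFinP/measurable_natr_bool; exact: measurable_fun_eqr.
  apply: eq_integral => w _; rewrite patchE /=.
  have [h|h] := boolP (U j w == c); first by rewrite mem_set.
  by rewrite memNset//; exact/negP.
by move=> w /= /negP; rewrite negbK.
Qed.

(** With [U j] held fixed, redrawing [U i] hits its value with probability 0, and there are finitely
    many pairs. *)
Lemma ae_injective : {ae P, forall w, injective (rvec U w)}.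
Proof.
have h (p : 'I_n * 'I_n) : p.1 != p.2 -> {ae P, forall w, U p.1 w != U p.2 w}.
  case: p => i j /= ij.
  have mD : measurable_fun setT (fun u : fspace 'I_n R => ((u i == u j)%:R)%:E : \bar R).
    apply/measurable_EFinP/measurable_natr_bool.
    by apply: measurable_fun_eqr; exact: measurable_fun_eval.
  have mE : measurable [set w | U i w == U j w].
    have : measurable_fun setT (fun w => U i w == U j w) by exact: measurable_fun_eqr.
    move=> /(_ measurableT [set true] I); rewrite setTI => mE.
    by rewrite (_ : [set w | _] = (fun w => U i w == U j w) @^-1` [set true]).
  exists [set w | U i w == U j w]; split => //.
    rewrite -[LHS]mul1e -integral_cst// integral_mkcond.
    transitivity (\int[P]_w ((rvec U w i == rvec U w j)%:R)%:E).
      apply: eq_integral => w _; rewrite patchE /= /rvec.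
      have [h|h] := boolP (U i w == U j w); first by rewrite mem_set.
      by rewrite memNset//; exact/negP.
    rewrite (resampleE hU.1 i mD); last by move=> u; rewrite lee_fin.
    apply: integral0_eq => w _; rewrite /resamp -[RHS](uniform_eq i (U j w)).
    by apply: eq_integral => t _; rewrite /upd eqxx [j == i]eq_sym (negbTE ij).
  by move=> w /= /negP; rewrite negbK.
have : {ae P, forall w, forall p : 'I_n * 'I_n, p.1 != p.2 -> U p.1 w != U p.2 w}.
  apply: filter_forall => p; have [->|pp] := eqVneq p.1 p.2.
    by apply: aeW => w; rewrite eqxx.
  by apply: filterS (h p pp) => w wp _.
apply: filterS => w wp i j uij; apply/eqP; apply/negPn/negP => ij.
by have := wp (i, j) ij; rewrite /= -/(rvec U w i) uij eqxx.
Qed.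

End uniform_sample.

Lemma independent_subfamily d (T : measurableType d) (R : realType)
    (P : probability T R) (I J : finType) (X : I -> {RV P >-> R}) (f : J -> I) :
  injective f -> mutually_independent X ->
  mutually_independent (fun j => X (f j)).
Proof.
move=> finj indX B mB.
pose B' i := if [pick j | f j == i] is Some j then B j else setT.
have B'f j : B' (f j) = B j.
  by rewrite /B'; case: pickP => [j' /eqP/finj -> //|/(_ j)]; rewrite eqxx.
have B'N i : i \notin codom f -> B' i = setT.
  rewrite /B'; case: pickP => // j /eqP <-; by rewrite codom_f.
have mB' i : measurable (B' i) by rewrite /B'; case: pickP.
transitivity (P (\bigcap_(i in [set: I]) (X i @^-1` B' i))).
  congr (P _); apply/seteqP; split=> w h i _ /=; last first.
    by rewrite -B'f; exact: h.
  have [/codomP[j ->]|/B'N -> //] := boolP (i \in codom f).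
  by rewrite B'f; exact: h.
rewrite indX// (bigID (fun i => i \in codom f))/= [X in (_ * X)%E]big1 ?mule1.
  rewrite (eq_bigl (fun i => i \in f @: [set: J])%SET) => [|i]; last first.
    by apply/codomP/imsetP => -[j]; [exists j|exists j].
  rewrite big_imset/=; last by move=> ? ? _ _; exact: finj.
  by apply: eq_big => [j|j _]; rewrite ?inE// B'f.
by move=> i /B'N ->; rewrite preimage_setT probability_setT.
Qed.

(** * Integration over the labelled points *)

Section bucket_law.
Local Open Scope ereal_scope.
Context (R : realType) (k m n : nat).
Hypotheses (k0 : (0 < k)%N) (m0 : (0 < m)%N) (kmn : (k * m <= n)%N).
Context d (T : measurableType d) (P : probability T R) (U : 'I_n -> {RV P >-> R}).
Hypothesis hU : uniform01_sample U.
Context d' (T' : measurableType d') (Q : probability T' R)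
  (Y : 'I_m -> {RV Q >-> R}).
Hypothesis gY : gamma_sample k 1 Y.

Let n0 : (0 < n)%N.
Proof. by rewrite (leq_trans _ kmn)// muln_gt0 k0. Qed.
Let j0 : 'I_n := Ordinal n0.

Let lo (i : 'I_m) : R := (i%:R / m%:R)%R.

Let lo0 i : (0 <= lo i)%R. Proof. by rewrite divr_ge0. Qed.

Let hi1 (i : 'I_m) : (i.+1%:R / m%:R <= 1 :> R)%R.
Proof. by rewrite ler_pdivrMr ?ltr0n// mul1r ler_nat. Qed.

Let loS (i : 'I_m) : (m%:R^-1 + lo i = i.+1%:R / m%:R)%R.
Proof. by rewrite /lo addrC -[X in (_ + X)%R]mul1r -mulrDl natr1. Qed.

(** Conditional probability, given pivots at distances [x] above the lower ends of their buckets,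
    that a point labelled [l] satisfies [fits]. Pivots count 1 here because their own law is
    integrated later. *)
Definition label_mass (x : 'I_m -> R) (l : label m) : R :=
  match l with
  | Some (_, true) => 1
  | Some (i, false) => x i
  | None => (1 - \sum_i x i)%R
  end.

Lemma prod_label_mass (t : n.-tuple (label m)) x : valid k t ->
  (\prod_(j < n) label_mass x (tnth t j) =
   (\prod_i x i) ^+ k.-1 * (1 - \sum_i x i) ^+ (n - k * m))%R.
Proof.
move=> /forallP vt.
rewrite (partition_big (fun j => tnth t j) xpredT)//=.
rewrite (eq_bigr (fun l => label_mass x l ^+ content k n l)%R); last first.
  move=> l _; rewrite (eq_bigr (fun=> label_mass x l)) => [|j /eqP -> //].
  by rewrite prodr_const -(eqP (vt l)) count_label.
rewrite (bigD1 None)//= mulrC; congr (_ * _)%R.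
rewrite (reindex_omap Some id) => [|[]]//=.
rewrite (eq_bigl xpredT) => [|p]; last by rewrite eqxx.
rewrite (eq_bigr (fun p => label_mass x (Some (p.1, p.2)) ^+
  content k n (Some (p.1, p.2)))%R) => [|[]//].
rewrite -(pair_bigA _ (fun i b => label_mass x (Some (i, b)) ^+
  content k n (Some (i, b)))%R)/=.
rewrite -prodrXl; apply: eq_bigr => i _.
by rewrite big_bool /= expr1n mul1r.
Qed.

Variable F : fspace 'I_m R -> \bar R.
Hypotheses (mF : measurable_fun setT F) (F0 : forall x, 0 <= F x).
Hypothesis Fsupp : forall x, F x != 0 -> forall i, (0 < x i < m%:R^-1)%R.

Let shift (t : n.-tuple (label m)) (u : 'I_n -> R) : fspace 'I_m R :=
  fun i => (u (pivot j0 t i) - lo i)%R.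

Let mshift t : measurable_fun setT (shift t : fspace 'I_n R -> fspace 'I_m R).
Proof.
apply: measurable_fun_fspace => i; apply: measurable_funB => //.
exact: measurable_fun_eval.
Qed.

(** Where [F] is nonzero, [Fsupp] puts every k-th value below the upper end of its bucket, so
    exactly one valid labelling is consistent. Elsewhere all terms vanish. *)
Let sum_consistent u : injective u ->
  F (shifted_kth k u) =
  \sum_(t : n.-tuple (label m) | valid k t)
     (F (shift t u) * ((consistent j0 t u)%:R)%:E).
Proof.
move=> uinj.
have cF t : valid k t -> consistent j0 t u -> shift t u = shifted_kth k u.
  by move=> vt ct; apply/funext => i; rewrite /shifted_kth (consistent_kth k0 m0 _ vt ct).
have [FX|FX] := eqVneq (F (shifted_kth k u)) 0.
  rewrite FX big1// => t vt; case ct : (consistent j0 t u); last by rewrite mule0.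
  by rewrite cF// FX mul0e.
have [i|t vt ct] := consistent_exists k0 m0 kmn j0 uinj.
  have /(_ i)/andP[_] := Fsupp FX.
  by rewrite /shifted_kth ltrBlDr loS.
rewrite (bigD1 t)//= ct mule1 cF// big1 ?adde0// => t' /andP[vt' tt'].
case ct' : (consistent j0 t' u); last by rewrite mule0.
by rewrite (consistent_unique k0 m0 vt vt' uinj ct ct') eqxx in tt'.
Qed.

Let G (x : fspace 'I_m R) : \bar R :=
  F x * (((\prod_i x i) ^+ k.-1 * (1 - \sum_i x i) ^+ (n - k * m))%R)%:E.

Let mG : measurable_fun setT G.
Proof.
apply: emeasurable_funM => //; apply/measurable_EFinP.
apply: measurable_funM; apply: measurable_funX.
  by apply: measurable_prod => i _; exact: measurable_fun_eval.
apply: measurable_funB => //; apply: measurable_sum => i.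
exact: measurable_fun_eval.
Qed.

Let sum_le1 (x : fspace 'I_m R) : F x != 0 -> (\sum_i x i <= 1)%R.
Proof.
move=> Fx; apply: (@le_trans _ _ (\sum_(i < m) m%:R^-1)%R).
  by apply: ler_sum => i _; have /andP[_ /ltW] := Fsupp Fx i.
by rewrite sumr_const card_ord -[leLHS]mulr_natr mulVf// pnatr_eq0 -lt0n.
Qed.

Let G0 x : 0 <= G x.
Proof.
rewrite /G; have [->|Fx] := eqVneq (F x) 0; first by rewrite mul0e.
rewrite mule_ge0// lee_fin mulr_ge0// exprn_ge0//.
  by apply: prodr_ge0 => i _; have /andP[/ltW] := Fsupp Fx i.
by rewrite subr_ge0 sum_le1.
Qed.

Let resamp_fits t j u : valid k t -> F (shift t u) != 0 ->
  ~~ (if tnth t j is Some (_, true) then true else false) ->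
  resamp U j (fun v => ((fits j0 t v j)%:R)%:E) u =
  (label_mass (shift t u) (tnth t j))%:E.
Proof.
move=> vt Fu tj.
have updp i s : upd j u s (pivot j0 t i) = u (pivot j0 t i).
  by rewrite /upd; case: eqP => // pj; move: tj; rewrite -pj (tnth_pivot _ _ vt).
have lop i : (lo i < u (pivot j0 t i))%R.
  by have := Fsupp Fu i; rewrite /shift subr_gt0 => /andP[].
have pih i : (u (pivot j0 t i) < i.+1%:R / m%:R)%R.
  by have := Fsupp Fu i; rewrite /shift ltrBlDr loS => /andP[].
have p1 i : (u (pivot j0 t i) <= 1)%R.
  by apply: le_trans (hi1 i); exact/ltW/pih.
rewrite /resamp /fits; case: (tnth t j) tj => [[i []]|]//= _.
  under eq_integral do rewrite updp {1 2}/upd eqxx.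
  exact: (uniform_itv_co hU j (lo0 i) (ltW (lop i)) (p1 i)).
transitivity (\int[distribution P (U j)]_s
    (([forall i : 'I_m, ~~ (lo i <= s <= u (pivot j0 t i))%R])%:R)%:E).
  apply: eq_integral => s _; congr ((nat_of_bool _)%:R%:E).
  by apply: eq_forallb => i; rewrite updp /upd eqxx.
have mb i : measurable_fun setT (fun s : R => (lo i <= s <= u (pivot j0 t i))%R).
  by apply: measurable_and; exact: measurable_fun_ler.
have msum : measurable_fun setT (fun s : R =>
    \sum_(i < m) (((lo i <= s <= u (pivot j0 t i))%R)%:R)%:E : \bar R).
  by apply: emeasurable_sum => i; apply/measurable_EFinP/measurable_natr_bool.
have mall : measurable_fun setT (fun s : R =>
    (([forall i : 'I_m, ~~ (lo i <= s <= u (pivot j0 t i))%R])%:R)%:E : \bar R).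
  apply/measurable_EFinP/measurable_natr_bool/measurable_forallb => i.
  exact: measurable_neg.
(* The intervals from the lower end of a bucket to its pivot are disjoint, so the probability of
   avoiding all of them is 1 minus the sum of their lengths. *)
have split1 (s : R) : 1 =
    (([forall i : 'I_m, ~~ (lo i <= s <= u (pivot j0 t i))%R])%:R)%:E +
    \sum_(i < m) (((lo i <= s <= u (pivot j0 t i))%R)%:R)%:E :> \bar R.
  case: (boolP [forall i : 'I_m, _]) => [/forallP h|].
    by rewrite big1 ?adde0// => i _; rewrite (negbTE (h i)).
  rewrite negb_forall => /existsP[i]; rewrite negbK => his.
  rewrite (bigD1 i)//= his big1 ?adde0 ?add0e// => i' ii'.
  case: (boolP (lo i' <= s <= _)%R) => // hi's.
  have inb a : (lo a <= s <= u (pivot j0 t a))%R -> in_bucket a s.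
    by move=> /andP[la sa]; rewrite /in_bucket la (le_lt_trans sa (pih a)).
  by move: ii'; rewrite (in_bucket_inj m0 (inb _ his) (inb _ hi's)) eqxx.
have E1 : 1 = \int[distribution P (U j)]_s
    (([forall i : 'I_m, ~~ (lo i <= s <= u (pivot j0 t i))%R])%:R)%:E +
    (\sum_(i < m) shift t u i)%:E.
  rewrite -[LHS](@probability_setT _ _ _ (distribution P (U j))).
  rewrite -[LHS]mul1e -integral_cst//.
  rewrite (eq_integral (fun s : R =>
    (([forall i : 'I_m, ~~ (lo i <= s <= u (pivot j0 t i))%R])%:R)%:E +
    \sum_(i < m) (((lo i <= s <= u (pivot j0 t i))%R)%:R)%:E)); last first.
    by move=> s _; rewrite -split1.
  rewrite ge0_integralD//; last by move=> s _; exact: sume_ge0.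
  congr (_ + _); rewrite ge0_integral_sum//; last first.
    by move=> i; apply/measurable_EFinP/measurable_natr_bool.
  rewrite -sumEFin; apply: eq_bigr => i _.
  exact: (uniform_itv_cc hU j (lo0 i) (ltW (lop i)) (p1 i)).
by rewrite EFinB E1 addeK.
Qed.

(** An instance of [prod_resample] over the points that are not pivots: [shift] is free of them and
    each [fits] involves only one of them. *)
Let integral_consistent t : valid k t ->
  \int[P]_w (F (shift t (rvec U w)) * ((consistent j0 t (rvec U w))%:R)%:E) =
  \int[P]_w G (shift t (rvec U w)).
Proof.
move=> vt.
pose np j := ~~ (if tnth t j is Some (_, true) then true else false).
pose s := [seq j <- index_enum 'I_n | np j].
have us : uniq s by rewrite filter_uniq// index_enum_uniq.
have snp j : j \in s -> np j by rewrite mem_filter => /andP[].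
have updp i j v r : np j -> upd j v r (pivot j0 t i) = v (pivot j0 t i) :> R.
  move=> npj; rewrite /upd; case: eqP => // pj.
  by move: npj; rewrite /np -pj (tnth_pivot _ _ vt).
have prodT (g : label m -> \bar R) : (forall i, g (Some (i, true)) = 1) ->
    \prod_(j <- s) g (tnth t j) = \prod_j g (tnth t j).
  move=> g1; rewrite big_filter [RHS](bigID np)/= [X in _ = _ * X]big1 ?mule1//.
  by move=> j; rewrite /np negbK; case: (tnth t j) => [[i []]|].
have consE u : F (shift t u) * ((consistent j0 t u)%:R)%:E =
    F (shift t u) * \prod_(j <- s) ((fits j0 t u j)%:R)%:E.
  have [->|Fu] := eqVneq (F (shift t u)) 0; first by rewrite !mul0e.
  congr (_ * _); rewrite /consistent (_ : [forall i, _] = true) /=; last first.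
    apply/forallP => i; have := Fsupp Fu i.
    rewrite /shift subr_gt0 ltrBlDr loS /in_bucket => /andP[/ltW -> ->] //.
  rewrite big_filter; case: (boolP [forall j, _]) => [/forallP h|].
    by rewrite big1// => j _; rewrite h.
  rewrite negb_forall => /existsP[j nj]; rewrite (bigD1 j)/= ?(negbTE nj) ?mul0e//.
  by move: nj; rewrite /fits /np; case: (tnth t j) => [[i []]|].
transitivity (\int[P]_w (F (shift t (rvec U w)) *
    \prod_(j <- s) ((fits j0 t (rvec U w) j)%:R)%:E)).
  by apply: eq_integral => w _; exact: consE.
rewrite (prod_resample hU.1 (F := fun u => F (shift t u))
  (H := fun j u => ((fits j0 t u j)%:R)%:E) us).
- apply: eq_integral => w _; rewrite /G.
  have [->|Fu] := eqVneq (F (shift t (rvec U w))) 0; first by rewrite !mul0e.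
  congr (_ * _); rewrite -(prod_label_mass _ vt) -prodEFin.
  rewrite -(prodT (fun l => (label_mass (shift t (rvec U w)) l)%:E))//.
  by apply: eq_big_seq => j js; rewrite resamp_fits//; exact: snp.
- exact: measurableT_comp.
- by move=> u; exact: F0.
- move=> j; apply/measurable_EFinP/measurable_natr_bool; rewrite /fits.
  have me i := @measurable_fun_eval 'I_n R i.
  case: (tnth t j) => [[i []]|].
  + exact: measurable_cst.
  + by apply: measurable_and; [exact: measurable_fun_ler|exact: measurable_fun_ltr].
  + apply: measurable_forallb => i; apply: measurable_neg.
    by apply: measurable_and; exact: measurable_fun_ler.
- by move=> j u; rewrite lee_fin.
- move=> j js u r; congr F; apply/funext => i.
  by rewrite /shift updp//; exact: snp.
- move=> i j si sj ij u r; congr ((nat_of_bool _)%:R%:E); rewrite /fits.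
  have ji : upd i u r j = u j by rewrite /upd eq_sym (negbTE ij).
  case: (tnth t j) => [[a []]|]//; first by rewrite ji updp ?snp.
  by apply: eq_forallb => a; rewrite ji updp ?snp.
Qed.

(** The pivots are [m] independent uniform variables. On the interval from 0 to [1 / m], Lebesgue
    measure weighted by [x ^+ k.-1] is the Gamma law at rate 1 weighted by [expR x] times the
    factorial of [k.-1]; this dictates [q] and [r]. *)
Let integral_shift t : valid k t ->
  \int[P]_w G (shift t (rvec U w)) =
  \int[Q]_w (F (rvec Y w) * ((((k.-1)`! ^ m)%:R *
    (1 - \sum_i Y i w) ^+ (n - k * m) * expR (\sum_i Y i w))%R)%:E).
Proof.
move=> vt.
pose sl (x : R) : R := ((0 < x < m%:R^-1)%R%:R)%R.
have msl : measurable_fun setT sl.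
  by apply/measurable_natr_bool/measurable_and; exact: measurable_fun_ltr.
have sl0 x : (0 <= sl x)%R by rewrite /sl.
have sl1 x : (0 < x < m%:R^-1)%R -> sl x = 1%R by rewrite /sl => ->.
pose q (i : 'I_m) (x : R) : \bar R := (sl (x - lo i) * (x - lo i) ^+ k.-1)%:E.
pose r (i : 'I_m) (x : R) : \bar R := (sl x * (k.-1)`!%:R * expR x)%:E.
have mlo i : measurable_fun setT (fun x : R => (x - lo i)%R).
  exact: measurable_funB.
have mq i : measurable_fun setT (q i).
  apply/measurable_EFinP; apply: measurable_funM.
    exact: (measurableT_comp msl (mlo i)).
  exact: measurable_funX.
have mr i : measurable_fun setT (r i).
  by apply/measurable_EFinP; apply: measurable_funM => //; exact: measurable_funM.
have q0 i x : 0 <= q i x.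
  rewrite lee_fin /sl; case: (boolP (0 < _ < _)%R) => [/andP[/ltW h _]|].
    by rewrite mul1r exprn_ge0.
  by rewrite mul0r.
have r0 i x : 0 <= r i x by rewrite lee_fin !mulr_ge0// expR_ge0.
pose p := pivot j0 t.
have qoo i : \int[P]_w q i (U (p i) w) < +oo.
  apply: (@le_lt_trans _ _ (\int[P]_w cst 1 w)).
    apply: ge0_le_integral => //.
    - exact: (measurableT_comp (mq i)).
    - move=> w _; rewrite lee_fin /sl.
      case: (boolP (0 < _ < _)%R) => [/andP[/ltW h h1]|]; last by rewrite mul0r.
      rewrite mul1r exprn_ile1// (le_trans (ltW h1))//.
      by rewrite invf_le1 ?ltr0n// ler1n.
  by rewrite integral_cst// mul1e [ltLHS]probability_setT ltry.
have qr i (A : set R) : measurable A ->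
    \int[P]_w ((\1_A (U (p i) w - lo i))%:E * q i (U (p i) w)) =
    \int[Q]_w ((\1_A (Y i w))%:E * r i (Y i w)).
  move=> mA.
  have mA' : measurable_fun setT (fun x : R => (\1_A x)%:E : \bar R).
    by apply/measurable_EFinP; exact: measurable_indic.
  pose h x : \bar R := (\1_A x)%:E * (sl x * x ^+ k.-1)%:E.
  have mh : measurable_fun setT h.
    apply: emeasurable_funM => //; apply/measurable_EFinP.
    by apply: measurable_funM => //; exact: measurable_funX.
  have h0 x : 0 <= h x.
    rewrite /h mule_ge0 ?lee_fin// /sl.
    case: (boolP (0 < _ < _)%R) => [/andP[/ltW x0 _]|]; last by rewrite mul0r.
    by rewrite mul1r exprn_ge0.
  transitivity (\int[@lebesgue_measure R]_x h x).
    have mh' : measurable_fun setT (fun x : R => h (x - lo i)%R).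
      exact: (measurableT_comp mh (mlo i)).
    transitivity (\int[P]_w (fun x : R => h (x - lo i)%R) (U (p i) w)); first by [].
    rewrite (integral_rv_density _ _ (hU.2 (p i)) mh')//; first last.
    - by move=> x; exact: uniform_pdf_ge0.
    - exact: measurable_uniform_pdf.
    rewrite -[RHS](integral_lebesgue_shift (lo i))//.
    apply: eq_integral => x _; rewrite /h /sl.
    case: (boolP (0 < _ < _)%R) => [/andP[a b]|]; last first.
      by rewrite mul0r mule0 mul0e.
    rewrite /uniform_pdf ifT ?subr0 ?invr1 ?mule1//.
    move: a b; rewrite subr_gt0 ltrBlDr loS => a b.
    by rewrite (le_trans (lo0 i) (ltW a)) (le_trans (ltW b))// hi1.
  transitivity (\int[Q]_w (fun x => (\1_A x)%:E * r i x) (Y i w)); last by [].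
  rewrite (integral_rv_density (h := fun x => (\1_A x)%:E * r i x) _ _ (gY.2 i))//; first last.
  - by move=> x; rewrite mule_ge0// lee_fin.
  - exact: emeasurable_funM.
  - by move=> x; exact: gamma_pdf_ge0.
  - exact: measurable_gamma_pdf.
  apply: eq_integral => x _; rewrite /h /r /gamma_pdf /sl -muleA; congr (_ * _).
  case: (boolP (0 < _ < _)%R) => [/andP[a _]|]; last by rewrite !mul0r mul0e.
  rewrite (ltW a) -EFinM; congr EFin.
  rewrite !mul1r expr1n mulr1 expRN mulrACA [X in (_ = X * _)%R]mulrC.
  by rewrite divfK ?mulfV ?mulr1 ?gt_eqF ?expR_gt0// ltr0n fact_gt0.
have pinj : injective p by exact: pivot_inj vt.
have indX := independent_subfamily pinj hU.1.
have [indY _] := gY.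
pose F' (x : fspace 'I_m R) : \bar R :=
  F x * (((1 - \sum_i x i) ^+ (n - k * m))%R)%:E.
have mF' : measurable_fun setT F'.
  apply: emeasurable_funM => //; apply/measurable_EFinP; apply: measurable_funX.
  apply: measurable_funB => //; apply: measurable_sum => i.
  exact: measurable_fun_eval.
have F'0 x : 0 <= F' x.
  rewrite /F'; have [->|Fx] := eqVneq (F x) 0; first by rewrite mul0e.
  by rewrite mule_ge0// lee_fin exprn_ge0// subr_ge0 sum_le1.
have := change_of_law indX indY (phi := fun i x => (x - lo i)%R)
  mlo mq mr q0 r0 qoo qr mF' F'0.
set lhs := integral _ _ _; set rhs := integral _ _ _ => E.
transitivity lhs.
  apply: eq_integral => w _; rewrite /G /F'.
  have [->|Fx] := eqVneq (F (shift t (rvec U w))) 0; first by rewrite !mul0e.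
  rewrite -muleA; congr (_ * _); rewrite prodEFin -EFinM mulrC; congr EFin.
  congr (_ * _)%R; rewrite -prodrXl; apply: eq_bigr => i _.
  by rewrite sl1 ?mul1r//; exact: (Fsupp Fx i).
rewrite E; apply: eq_integral => w _; rewrite /F'.
have [->|Fx] := eqVneq (F (rvec Y w)) 0; first by rewrite !mul0e.
rewrite -muleA; congr (_ * _); rewrite prodEFin -EFinM; congr EFin.
rewrite [X in (_ * X)%R](eq_bigr (fun i => (k.-1)`!%:R * expR (Y i w))%R).
  by rewrite big_split/= prodr_const card_ord expR_sum natrX mulrCA mulrA.
by move=> i _; rewrite sl1 ?mul1r//; exact: (Fsupp Fx i).
Qed.

(* Each of the [n! / ((k-1)!^m (n - km)!)] labellings contributes the same integral. *)
Lemma integral_shifted_kth :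
  \int[P]_w F (shifted_kth k (rvec U w)) =
  \int[Q]_w (F (rvec Y w) * (((n ^_ (k * m))%:R *
    (1 - \sum_i Y i w) ^+ (n - k * m) * expR (\sum_i Y i w))%R)%:E).
Proof.
have mcons t : measurable_fun setT (fun u : fspace 'I_n R =>
    ((consistent j0 t u)%:R)%:E : \bar R).
  have me i := @measurable_fun_eval 'I_n R i.
  apply/measurable_EFinP/measurable_natr_bool/measurable_and.
    apply: measurable_forallb => i; apply: measurable_and.
      exact: measurable_fun_ler.
    exact: measurable_fun_ltr.
  apply: measurable_forallb => j; rewrite /fits.
  case: (tnth t j) => [[i []]|].
  - exact: measurable_cst.
  - by apply: measurable_and; [exact: measurable_fun_ler|exact: measurable_fun_ltr].
  - apply: measurable_forallb => i; apply: measurable_neg.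
    by apply: measurable_and; exact: measurable_fun_ler.
have mterm t : measurable_fun setT (fun w =>
    F (shift t (rvec U w)) * ((consistent j0 t (rvec U w))%:R)%:E).
  have mt : measurable_fun setT (fun u : fspace 'I_n R =>
      F (shift t u) * ((consistent j0 t u)%:R)%:E).
    by apply: emeasurable_funM => //; exact: (measurableT_comp mF (mshift t)).
  exact: (measurableT_comp mt (measurable_rvec U)).
have term0 t w : 0 <= F (shift t (rvec U w)) * ((consistent j0 t (rvec U w))%:R)%:E.
  by rewrite mule_ge0// lee_fin.
transitivity (\int[P]_w \sum_(t : n.-tuple (label m) | valid k t)
     (F (shift t (rvec U w)) * ((consistent j0 t (rvec U w))%:R)%:E)).
  apply: ge0_ae_eq_integral => //.
  - have mX := measurableT_comp mF (@measurable_shifted_kth R k m n k0).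
    exact: (measurableT_comp mX (measurable_rvec U)).
  - under eq_fun do rewrite big_mkcond/=.
    by apply: emeasurable_sum => t; case: (valid k t).
  - by move=> w _; apply: sume_ge0 => t _; exact: term0.
  - apply: filterS (ae_injective hU) => w inj _; exact: sum_consistent.
under eq_integral do rewrite big_mkcond/=.
rewrite ge0_integral_sum//; last 2 first.
- by move=> t; case: (valid k t).
- by move=> t w _; case: (valid k t).
pose c : R := (((k.-1)`! ^ m)%:R)%R.
pose I0 := \int[Q]_w (F (rvec Y w) * ((c *
    (1 - \sum_i Y i w) ^+ (n - k * m) * expR (\sum_i Y i w))%R)%:E).
have H0 w : 0 <= F (rvec Y w) * ((c *
    (1 - \sum_i Y i w) ^+ (n - k * m) * expR (\sum_i Y i w))%R)%:E.
  have [->|Fx] := eqVneq (F (rvec Y w)) 0; first by rewrite mul0e.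
  rewrite mule_ge0// lee_fin !mulr_ge0// ?expR_ge0// exprn_ge0// subr_ge0.
  exact: (sum_le1 Fx).
have mYsum : measurable_fun setT (fun w => \sum_i Y i w)%R.
  by apply: measurable_sum => i; exact: measurable_funP.
have mH : measurable_fun setT (fun w => F (rvec Y w) * ((c *
    (1 - \sum_i Y i w) ^+ (n - k * m) * expR (\sum_i Y i w))%R)%:E).
  apply: emeasurable_funM; first exact: (measurableT_comp mF (measurable_rvec Y)).
  apply/measurable_EFinP; apply: measurable_funM; last exact: measurableT_comp.
  apply: measurable_funM => //; apply: measurable_funX; exact: measurable_funB.
transitivity (\sum_(t : n.-tuple (label m) | valid k t) I0).
  rewrite [RHS]big_mkcond/=; apply: eq_bigr => t _.
  case: ifPn => vt; last by rewrite integral0.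
  by rewrite integral_consistent// integral_shift.
rewrite big_const.
have cE : (#|[pred t : n.-tuple (label m) | valid k t]| * (k.-1)`! ^ m = n ^_ (k * m))%N.
  apply/eqP; rewrite -(eqn_pmul2r (fact_gt0 (n - k * m))) -mulnA card_valid//.
  by rewrite ffact_fact.
transitivity ((#|[pred t : n.-tuple (label m) | valid k t]|%:R)%:E * I0).
  elim: #|_| => [|a IHa] /=; first by rewrite mul0e.
  by rewrite IHa -natr1 EFinD ge0_muleDl ?lee_fin// mul1e addeC.
rewrite /I0 -ge0_integralZl//.
apply: eq_integral => w _; rewrite muleCA -EFinM -cE natrM !mulrA.
by [].
Qed.

End bucket_law.

(** * Measurability of estimators *)

Section measurable_estimate.
Context (R : realType) (m : nat).

(** An open set is the union of the rational cubes that it contains. These are countably many and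
    are listed through [pickle]. *)
Lemma measurable_open_row (V : set 'rV[R]_m) : open V ->
  measurable [set u : fspace 'I_m R | V (\row_i u i)].
Proof.
move=> oV.
pose B (p : {ffun 'I_m -> rat} * nat) : set (fspace 'I_m R) :=
  [set u | forall i, `|ratr (p.1 i) - u i| < p.2.+1%:R^-1].
have mB p : measurable (B p).
  apply: sub_sigma_algebra.
  exists (fun i => [set x | `|ratr (p.1 i) - x| < p.2.+1%:R^-1]) => // i.
  rewrite (_ : [set x | _] = ball (ratr (p.1 i) : R) p.2.+1%:R^-1)//.
  exact: measurable_ball.
pose W := [set u : fspace 'I_m R | V (\row_i u i)].
pose C n := if unpickle n is Some p then
  (if `[< B p `<=` W >] then B p else set0) else set0.
have mC n : measurable (C n).
  by rewrite /C; case: unpickle => // p; case: ifP.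
rewrite (_ : [set u | _] = \bigcup_n C n); first exact: bigcupT_measurable.
apply/seteqP; split=> u; last first.
  by move=> [n _]; rewrite /C; case: unpickle => // p; case: ifPn => // /asboolP; exact.
move=> /= Vu; have := oV; rewrite openE => /(_ _ Vu)/nbhs_ballP[e /= e0 eV].
(* A cube of half-side below [e / 2] whose centre is within that distance of [u] stays in the ball
   of radius [e]. *)
have [N N2] : exists N : nat, N.+1%:R^-1 < e / 2.
  have e20 : 0 < e / 2 by rewrite divr_gt0.
  have [N _ h] := near_infty_natSinv_lt (PosNum e20).
  by exists N; apply: h => /=.
have /choice[z hz] : forall i, exists q : rat, `|ratr q - u i| < N.+1%:R^-1.
  move=> i; have : u i - N.+1%:R^-1 < u i + N.+1%:R^-1 by rewrite ltrD2l gtrN ?invr_gt0.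
  move=> /rat_in_itvoo[q]; rewrite in_itv/= => /andP[a b]; exists q.
  by rewrite ltr_norml ltrBrDl a ltrBlDl b.
pose p := ([ffun i => z i], N).
exists (pickle p) => //; rewrite /C pickleK ifT; first by move=> i; rewrite ffunE.
apply/asboolP => v Bv; apply: eV; split => // a i; rewrite !mxE.
rewrite /ball /= /ball_.
have := hz i; have := Bv i; rewrite /= ffunE => h1 h2.
rewrite (_ : u i - v i = (ratr (z i) - v i) - (ratr (z i) - u i)); last by ring.
rewrite (le_lt_trans (ler_normB _ _))// [e]splitr.
by rewrite ltrD// (lt_trans _ N2).
Qed.

Lemma measurable_punctured_orthant :
  measurable [set u : fspace 'I_m R | punctured_orthant (\row_i u i)].
Proof.
rewrite (_ : [set u | _] = (\bigcap_(i in [set: 'I_m]) [set u | 0 <= u i]) `&`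
    ~` \bigcap_(i in [set: 'I_m]) [set u | u i = 0]); last first.
  apply/seteqP; split => u /=.
    move=> [u0 un0]; split; first by move=> i _ /=; have := u0 i; rewrite mxE.
    move=> h; have /eqP := un0; apply.
    by apply/funext => a; apply/funext => i; rewrite mxE; exact: h.
  move=> [u0 un0]; split; first by move=> i; rewrite mxE; exact: u0.
  apply/eqP => h; apply: un0 => i _ /=.
  by have := congr1 (fun x : 'I_1 -> 'I_m -> R => x ord0 i) h; rewrite !mxE.
apply: measurableI; last apply: measurableC;
    apply: fin_bigcap_measurable => // i _.
  have := @measurable_fun_eval 'I_m R i measurableT `[0, +oo[%classic.
  rewrite setTI => /(_ (measurable_itv _)); congr measurable.
  by apply/seteqP; split => u; rewrite /= in_itv/= andbT.
have := @measurable_fun_eval 'I_m R i measurableT [set 0].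
by rewrite setTI; exact.
Qed.

(** Continuity is relative to the punctured orthant: there the preimage of an interval is the trace
    of an open set, and elsewhere the estimate is the constant 0. *)
Lemma measurable_estimate (xi : 'rV[R]_m -> R) :
  {within @punctured_orthant R m, continuous xi} ->
  measurable_fun setT (fun u : fspace 'I_m R => estimate xi (\row_i u i)).
Proof.
move=> cxi; apply: (measurability _ (RGenOpens.measurableE R)).
move=> _ [_ [a [b ->]] <-]; rewrite setTI.
have [V oV VD] : exists2 V, open V &
    V `&` @punctured_orthant R m = xi @^-1` `]a, b[ `&` @punctured_orthant R m.
  by apply/open_subspaceP; move/continuousP : cxi; apply; exact: interval_open.
pose D := [set u : fspace 'I_m R | punctured_orthant (\row_i u i)].
rewrite (_ : _ @^-1` _ = (D `&` [set u : fspace 'I_m R | V (\row_i u i)]) `|`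
    (~` D `&` [set u | `]a, b[%classic 0])).
  apply: measurableU.
    by apply: measurableI;
      [exact: measurable_punctured_orthant|exact: measurable_open_row].
  apply: measurableI; first by apply: measurableC; exact: measurable_punctured_orthant.
  have [h|h] := pselect (`]a, b[%classic (0 : R)).
    by rewrite (_ : [set u | _] = setT)//; apply/seteqP; split.
  by rewrite (_ : [set u | _] = set0)//; apply/seteqP; split.
apply/seteqP; split => u /=.
  rewrite /estimate patchE; case: ifPn => [/set_mem uD h|/negP uD h].
    left; split => //.
    have : (xi @^-1` `]a, b[ `&` @punctured_orthant R m) (\row_i u i) by split.
    by rewrite -VD => -[].
  by right; split => //= /mem_set.
rewrite /estimate patchE => -[[uD uV]|[uD h]].
  rewrite mem_set//.
  have : (V `&` @punctured_orthant R m) (\row_i u i) by split.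
  by rewrite VD => -[].
by rewrite memNset.
Qed.

End measurable_estimate.

(** * Laplace transforms *)

Section real_integrable.
Context d (T : measurableType d) (R : realType) (mu : probability T R).
Implicit Types f g : T -> R.

Definition rintegrable f := mu.-integrable setT (EFin \o f).
Definition mean f : R := \int[mu]_x f x.

Lemma rintegrable_measurable f : rintegrable f -> measurable_fun setT f.
Proof. by move=> /measurable_int/measurable_EFinP. Qed.

Lemma rintegrable_le f g : measurable_fun setT f ->
  (forall x, `|f x| <= g x) -> rintegrable g -> rintegrable f.
Proof.
move=> mf fg; apply: le_integrable => //; first exact/measurable_EFinP.
by move=> x _ /=; rewrite lee_fin (le_trans (fg x))// ler_norm.
Qed.

Lemma rintegrableD f g : rintegrable f -> rintegrable g ->
  rintegrable (fun x => f x + g x).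
Proof.
by move=> hf hg; apply: eq_integrable (integrableD _ hf hg).
Qed.

Lemma rintegrableZ c f : rintegrable f -> rintegrable (fun x => c * f x).
Proof. by move=> hf; apply: eq_integrable (integrableZl _ c hf). Qed.

Lemma rintegrableB f g : rintegrable f -> rintegrable g ->
  rintegrable (fun x => f x - g x).
Proof.
by move=> hf hg; apply: eq_integrable (integrableB _ hf hg).
Qed.

Lemma rintegrable_norm f : rintegrable f -> rintegrable (fun x => `|f x|).
Proof. by move=> hf; apply: eq_integrable (integrable_abse hf). Qed.

Lemma meanD f g : rintegrable f -> rintegrable g ->
  mean (fun x => f x + g x) = mean f + mean g.
Proof. by move=> hf hg; exact: RintegralD. Qed.

Lemma meanB f g : rintegrable f -> rintegrable g ->
  mean (fun x => f x - g x) = mean f - mean g.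
Proof. by move=> hf hg; exact: RintegralB. Qed.

Lemma meanZ c f : rintegrable f -> mean (fun x => c * f x) = c * mean f.
Proof. by move=> hf; exact: RintegralZl. Qed.

Lemma mean_le f g : rintegrable f -> rintegrable g ->
  (forall x, f x <= g x) -> mean f <= mean g.
Proof. by move=> hf hg fg; exact: le_Rintegral. Qed.

Lemma mean_ge0 f : (forall x, 0 <= f x) -> 0 <= mean f.
Proof. by move=> f0; exact: Rintegral_ge0. Qed.

Lemma EFin_mean f : rintegrable f -> (mean f)%:E = (\int[mu]_x (f x)%:E)%E.
Proof. by move=> hf; rewrite fineK//; exact: integrable_fin_num. Qed.

Lemma eq_mean f g : f =1 g -> mean f = mean g.
Proof. by move=> fg; apply: eq_Rintegral => x _. Qed.

Lemma rintegrable_ge0 f (v : R) : measurable_fun setT f ->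
  (forall x, 0 <= f x) -> (\int[mu]_x (f x)%:E)%E = v%:E -> rintegrable f.
Proof.
move=> mf f0 fv; apply/integrableP; split; first exact/measurable_EFinP.
by under eq_integral do rewrite /= ger0_norm//; rewrite fv ltry.
Qed.

End real_integrable.

Lemma expR_ge_pow (R : realType) (q : nat) (x : R) : 0 <= x ->
  x ^+ q <= q`!%:R * expR x.
Proof.
case: q => [|q] x0.
  by rewrite expr0 fact0 mul1r -expR0 ler_expR.
have := expR_ge1Dxn q x0 => h.
rewrite mulrC -ler_pdivrMr ?ltr0n ?fact_gt0//.
by rewrite (le_trans _ h)// lerDr.
Qed.

Section laplace.
Context d (T : measurableType d) (R : realType) (mu : probability T R).
Variable s : T -> R.
Hypotheses (ms : measurable_fun setT s) (s0 : forall x, 0 <= s x).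

(* When [s] is the sum of the Gamma variables at rate 1, [t ^ K * tilt t] is the
   density of the model at rate [t]. *)
Definition tilt (t : R) (x : T) : R := expR (- ((t - 1) * s x)).

(** Integrability in the model at every rate, stated under the rate 1 law. *)
Definition tempered (Y : T -> R) :=
  forall t, 0 < t -> rintegrable mu (fun x => Y x * tilt t x).

Definition lapl (Y : T -> R) (t : R) : R := mean mu (fun x => Y x * tilt t x).

Lemma tilt_ge0 t x : 0 <= tilt t x. Proof. exact: expR_ge0. Qed.

Lemma measurable_tilt t : measurable_fun setT (tilt t).
Proof.
apply: measurableT_comp => //; apply: measurableT_comp => //.
exact: measurable_funM.
Qed.

Lemma tilt_le t t' x : t <= t' -> tilt t' x <= tilt t x.
Proof.
by move=> tt'; rewrite ler_expR lerN2 ler_wpM2r// lerB.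
Qed.

Lemma tiltD t e x : tilt t x * expR (e * s x) = tilt (t - e) x.
Proof. by rewrite /tilt -expRD; congr expR; ring. Qed.

Lemma tilt1 x : tilt 1 x = 1.
Proof. by rewrite /tilt subrr mul0r oppr0 expR0. Qed.

Lemma tempered_measurable Y : tempered Y -> measurable_fun setT Y.
Proof.
move=> /(_ 1 ltr01) /rintegrable_measurable; apply: eq_measurable_fun => x _.
by rewrite tilt1 mulr1.
Qed.

(** A factor [expR (e * s x)] only lowers the rate by [e], and with [e = t / 2] the rate stays
    positive. Polynomial factors in [s] are thus harmless. *)
Lemma tempered_le (Y Z : T -> R) : measurable_fun setT Z -> tempered Y ->
  (forall e, 0 < e -> exists C, forall x, `|Z x| <= C * `|Y x| * expR (e * s x)) ->
  tempered Z.
Proof.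
move=> mZ hY h t t0; have t20 : 0 < t / 2 by rewrite divr_gt0.
have [C hC] := h _ t20.
apply: (rintegrable_le (g := fun x => C * `|Y x * tilt (t / 2) x|)).
- by apply: measurable_funM => //; exact: measurable_tilt.
- move=> x; rewrite !normrM !(ger0_norm (tilt_ge0 _ _)).
  have -> : tilt (t / 2) x = tilt t x * expR (t / 2 * s x).
    by rewrite tiltD; congr (tilt _ x); field.
  rewrite (_ : C * _ = C * `|Y x| * expR (t / 2 * s x) * tilt t x); last by ring.
  by rewrite ler_wpM2r// tilt_ge0.
- exact/rintegrableZ/rintegrable_norm/hY.
Qed.

Lemma temperedD Y Z : tempered Y -> tempered Z -> tempered (fun x => Y x + Z x).
Proof.
move=> hY hZ t t0; have := rintegrableD (hY t t0) (hZ t t0).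
by apply: eq_integrable => // x _ /=; rewrite mulrDl.
Qed.

Lemma temperedZ c Y : tempered Y -> tempered (fun x => c * Y x).
Proof.
move=> hY t t0; have := rintegrableZ c (hY t t0).
by apply: eq_integrable => // x _ /=; rewrite mulrA.
Qed.

Lemma temperedB Y Z : tempered Y -> tempered Z -> tempered (fun x => Y x - Z x).
Proof.
move=> hY hZ t t0; have := rintegrableB (hY t t0) (hZ t t0).
by apply: eq_integrable => // x _ /=; rewrite mulrBl.
Qed.

Lemma tempered_norm Y : tempered Y -> tempered (fun x => `|Y x|).
Proof.
move=> hY t t0; have := rintegrable_norm (hY t t0).
by apply: eq_integrable => // x _ /=; rewrite normrM (ger0_norm (tilt_ge0 _ _)).
Qed.

Lemma tempered_mulX Y q : tempered Y -> tempered (fun x => s x ^+ q * Y x).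
Proof.
move=> hY; apply: (tempered_le _ hY).
  by apply: measurable_funM; [exact: measurable_funX|exact: tempered_measurable].
move=> e e0; exists (q`!%:R / e ^+ q) => x.
rewrite normrM ger0_norm ?exprn_ge0// mulrAC ler_wpM2r//.
rewrite mulrAC ler_pdivlMr ?exprn_gt0// -exprMn mulrC.
by rewrite expR_ge_pow// mulr_ge0// ltW.
Qed.

Lemma tempered_mul Y : tempered Y -> tempered (fun x => s x * Y x).
Proof. exact: (@tempered_mulX Y 1). Qed.

Lemma laplD Y Z (t : R) : tempered Y -> tempered Z -> 0 < t ->
  lapl (fun x => Y x + Z x) t = lapl Y t + lapl Z t.
Proof.
move=> hY hZ t0; rewrite -meanD; [|exact: hY|exact: hZ].
by apply: eq_mean => x; rewrite mulrDl.
Qed.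

Lemma laplB Y Z (t : R) : tempered Y -> tempered Z -> 0 < t ->
  lapl (fun x => Y x - Z x) t = lapl Y t - lapl Z t.
Proof.
move=> hY hZ t0; rewrite -meanB; [|exact: hY|exact: hZ].
by apply: eq_mean => x; rewrite mulrBl.
Qed.

Lemma laplZ c Y (t : R) : tempered Y -> 0 < t -> lapl (fun x => c * Y x) t = c * lapl Y t.
Proof.
move=> hY t0; rewrite -meanZ; last exact: hY.
by apply: eq_mean => x; rewrite mulrA.
Qed.

Lemma lapl_is_derive Y (t : R) : tempered Y -> 0 < t ->
  is_derive t 1 (lapl Y) (- lapl (fun x => s x * Y x) t).
Proof.
move=> hY t0; have t20 : 0 < t / 2 by rewrite divr_gt0.
pose f (t' : R) x := Y x * tilt t' x.
have df (t' : R) (x : T) : is_derive t' 1 (f ^~ x) (- (s x * Y x * tilt t' x)).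
  rewrite /f /tilt; apply: is_derive_eq; rewrite /GRing.scale /=; ring.
have dfE t' x : partial1of2 f t' x = - (s x * Y x * tilt t' x).
  by rewrite partial1of2E derive_val.
(* Between [t / 2] and [2 * t] the tilt is largest at the left end, so its value there dominates the
   derivative under the integral. *)
pose G x := `|s x * Y x * tilt (t / 2) x|.
have It : `]t / 2, 2 * t[%classic t by rewrite /= in_itv/=; lra.
have Ipos x : `]t / 2, 2 * t[%classic x -> 0 < x by rewrite /= in_itv/= => /andP[]; lra.
have hsY := tempered_mul hY.
have intf x : `]t / 2, 2 * t[%classic x -> mu.-integrable setT (EFin \o f x).
  by move=> /Ipos; exact: hY.
have derf x y : `]t / 2, 2 * t[%classic x -> setT y -> derivable (f ^~ y) x 1.
  by move=> _ _; have [] := df x y.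
have G0 y : 0 <= G y by exact: normr_ge0.
have iG : mu.-integrable setT (EFin \o G).
  by have := rintegrable_norm (hsY _ t20); apply: eq_integrable => // x _.
have Gub x y : `]t / 2, 2 * t[%classic x -> setT y -> `|partial1of2 f x y| <= G y.
  rewrite /= in_itv/= => /andP[tx _] _; rewrite dfE normrN /G !(normrM _ (tilt _ _)).
  by rewrite ler_wpM2l// !(ger0_norm (tilt_ge0 _ _)) tilt_le// ltW.
apply: DeriveDef; first exact: (derivable_under_integral measurableT It intf derf G0 iG Gub).
rewrite -derive1E (differentiation_under_integral measurableT It intf derf G0 iG Gub).
transitivity (mean mu (fun x => -1 * (s x * Y x * tilt t x))).
  by apply: eq_Rintegral => x _; rewrite dfE mulN1r.
by rewrite meanZ ?mulN1r//; exact: hsY.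
Qed.

Lemma lapl_continuous Y (t : R) : tempered Y -> 0 < t -> {for t, continuous (lapl Y)}.
Proof.
move=> hY t0; apply: differentiable_continuous; apply/derivable1_diffP.
by have [] := lapl_is_derive hY t0.
Qed.

End laplace.

(** * Moments of the sum and of its inverse *)

Section improper_integral.
Context (R : realType).

Lemma cvg0_of_le_inv (F : R -> R) (C : R) :
  (forall x, 1 <= x -> `|F x| <= C / x) -> F x @[x --> +oo] --> 0.
Proof.
move=> hF; apply/cvgrPdist_le => e e0; near=> x.
have x1 : 1 <= x by near: x; apply: nbhs_pinfty_ge; exact: num_real.
have xC : `|C| / e <= x by near: x; apply: nbhs_pinfty_ge; exact: num_real.
have x0 : 0 < x by exact: lt_le_trans x1.
rewrite sub0r normrN (le_trans (hF _ x1))// ler_pdivrMr//.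
by rewrite (le_trans (ler_norm C))// mulrC -ler_pdivrMr.
Unshelve. all: by end_near. Qed.

Lemma integral_itv_bnd_infty_inv (F f : R -> R) (a C : R) :
  (forall x, a <= x -> is_derive x 1 F (f x)) ->
  (forall x, a <= x -> 0 <= f x) ->
  (forall x, a <= x -> {for x, continuous f}) ->
  (forall x, 1 <= x -> `|F x| <= C / x) ->
  (\int[lebesgue_measure]_(x in `[a, +oo[) (f x)%:E = (- F a)%:E)%E.
Proof.
move=> dF f0 cf hF.
rewrite (@ge0_continuous_FTC2y _ f F a 0)//.
- by rewrite sub0e EFinN.
- apply: continuous_in_subspaceT => x; rewrite inE /= in_itv/= andbT.
  exact: cf.
- exact: cvg0_of_le_inv hF.
- by move=> x ax; have [] := dF x (ltW ax).
- apply: cvg_at_right_filter; apply: differentiable_continuous.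
  by apply/derivable1_diffP; have [] := dF a (lexx a).
- move=> x; rewrite in_itv/= andbT => ax.
  by rewrite derive1E; have [_] := dF x (ltW ax).
Qed.

Lemma is_derive_negpow (q : nat) (x : R) : 0 < x ->
  is_derive x 1 (fun y : R => y ^- q) (- (q%:R * x ^- q.+1)).
Proof.
move=> x0.
have x0' : x ^+ q != 0 by rewrite expf_neq0// gt_eqF.
have := @is_deriveV R (fun y => y ^+ q) x (q%:R * x ^+ q.-1) 1 x0'.
move=> h; apply: is_derive_eq.
  apply: h; apply: DeriveDef; first exact: exprn_derivable.
  by rewrite exp_derive /GRing.scale /= mulr1.
case: q x0' {h} => [|q] x0' /=; first by rewrite !mul0r /GRing.scale/= mulr0 oppr0.
rewrite /GRing.scale /= mulNr; congr (- _); rewrite mulrCA; congr (_ * _).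
have x1 : x != 0 by rewrite gt_eqF.
have xq : x ^+ q != 0 by rewrite expf_neq0.
by rewrite !exprS; field; rewrite x1 xq.
Qed.

End improper_integral.

Section gamma_moments.
Context d (T : measurableType d) (R : realType) (mu : probability T R).
Variables (s : T -> R).
Hypotheses (ms : measurable_fun setT s) (s0 : forall x, 0 <= s x).
Hypothesis spos : {ae mu, forall x, 0 < s x}.

Local Notation tilt := (tilt s).
Local Notation tempered := (tempered mu s).
Local Notation lapl := (lapl mu s).

(** Where [s x = 0] the quotient is 0 by the convention on inverses; elsewhere the inverse is the
    exponential of [- ln (s x)]. *)
Lemma measurable_divs (Z : T -> R) : measurable_fun setT Z ->
  measurable_fun setT (fun x => Z x / s x).
Proof.
move=> mZ; apply: measurable_funM => //.
apply: (eq_measurable_fun (fun x => if 0 < s x then expR (- ln (s x)) else 0)).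
  move=> x _; case: ltP => [sx|sx]; first by rewrite expRN lnK.
  by have := s0 x; rewrite le_eqVlt ltNge sx orbF => /eqP <-; rewrite invr0.
apply: measurable_fun_ifT => //; first exact: measurable_fun_ltr.
apply: measurableT_comp => //; apply: measurableT_comp => //.
exact: measurableT_comp.
Qed.

(* Tonelli: [tilt t x / s x] is the integral of [tilt r x] over [r >= t]. *)
Lemma integral_div_tilt (Z : T -> R) (c : R) (q : nat) (t : R) : 0 < t ->
  measurable_fun setT Z -> (forall x, 0 <= Z x) -> 0 <= c ->
  (forall r, 0 < r -> (\int[mu]_x (Z x * tilt r x)%:E = (c * r ^- q.+2)%:E)%E) ->
  (\int[mu]_x (Z x / s x * tilt t x)%:E = (c / q.+1%:R * t ^- q.+1)%:E)%E.
Proof.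
move=> t0 mZ Z0 c0 hZ.
pose D : set (measurableTypeR R) := `[t, +oo[%classic.
have mD : measurable D by exact: measurable_itv.
pose f (z : T * measurableTypeR R) : \bar R :=
  (Z z.1 * tilt z.2 z.1 * \1_D z.2)%:E.
have mf : measurable_fun setT f.
  apply/measurable_EFinP; apply: measurable_funM.
    apply: measurable_funM; first exact: (measurableT_comp mZ measurable_fst).
    rewrite /tilt; apply: measurableT_comp => //; apply: measurableT_comp => //.
    apply: measurable_funM; last exact: (measurableT_comp ms measurable_fst).
    by apply: measurable_funB => //; exact: measurable_snd.
  apply: measurableT_comp; last exact: measurable_snd.
  by apply: measurable_indic.
have f0 z : (0 <= f z)%E by rewrite lee_fin !mulr_ge0// tilt_ge0.
transitivity (\int[mu]_x \int[@lebesgue_measure R]_r f (x, r))%E.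
  apply: ge0_ae_eq_integral => //.
  - apply/measurable_EFinP; apply: measurable_funM; last exact: measurable_tilt.
    exact: measurable_divs.
  - exact: measurable_fun_fubini_tonelli_F.
  - by move=> x _; rewrite lee_fin mulr_ge0 ?divr_ge0// tilt_ge0.
  - by move=> x _; exact: integral_ge0.
  apply: filterS spos => x sx _.
  transitivity (\int[@lebesgue_measure R]_(r in D) (Z x * tilt r x)%:E)%E; last first.
    rewrite integral_mkcond; apply: eq_integral => r _.
    by rewrite patchE /f /= indicE; case: ifP; rewrite ?mulr1 ?mulr0.
  have dF (r : R) : t <= r -> is_derive r 1 (fun r => - (Z x / s x * tilt r x))
      (Z x * tilt r x).
    move=> _; rewrite /tilt; apply: is_derive_eq; rewrite /GRing.scale /=.
    by field; rewrite gt_eqF.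
  have F0 (r : R) : t <= r -> 0 <= Z x * tilt r x.
    by move=> _; rewrite mulr_ge0 ?tilt_ge0.
  have cf (r : R) : t <= r -> {for r, continuous (fun r => Z x * tilt r x)}.
    move=> _; apply: differentiable_continuous; apply/derivable1_diffP.
    have : is_derive r (1 : R) (fun r => Z x * tilt r x) (- (Z x * s x * tilt r x)).
      by rewrite /tilt; apply: is_derive_eq; rewrite /GRing.scale /=; ring.
    by case.
  (* Only the limit at infinity is at stake: [1 + y <= expR y] with [y = r * s x] gives a decay in
     [1 / r]. *)
  have hF (r : R) : 1 <= r ->
      `|- (Z x / s x * tilt r x)| <= Z x / s x * expR (s x) / s x / r.
    move=> r1; rewrite normrN ger0_norm ?mulr_ge0 ?tilt_ge0 ?invr_ge0 ?s0//.
    have r0 : 0 < r by exact: lt_le_trans r1.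
    rewrite -!mulrA ler_wpM2l// ler_wpM2l ?invr_ge0 ?s0//.
    rewrite (_ : tilt r x = expR (s x) * expR (- (r * s x))); last first.
      by rewrite -expRD /tilt; congr expR; ring.
    rewrite ler_wpM2l ?expR_ge0// expRN -invfM lef_pV2 ?posrE ?expR_gt0 ?mulr_gt0//.
    by rewrite mulrC (le_trans _ (expR_ge1Dx _))// lerDr.
  by rewrite (integral_itv_bnd_infty_inv dF F0 cf hF) opprK.
rewrite (fubini_tonelli f)//=.
transitivity (\int[@lebesgue_measure R]_(r in D) (c * r ^- q.+2)%:E)%E.
  rewrite [RHS]integral_mkcond; apply: eq_integral => r _.
  rewrite patchE /f /= indicE; case: ifPn => [|_]; last first.
    by rewrite integral0_eq// => x _; rewrite mulr0.
  rewrite inE /D /= in_itv/= andbT => tr.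
  by under eq_integral do rewrite mulr1; rewrite hZ// (lt_le_trans t0).
have der r : t <= r -> is_derive r 1 (fun r : R => - (c / q.+1%:R * r ^- q.+1))
    (c * r ^- q.+2).
  move=> tr; have := is_derive_negpow q.+1 (lt_le_trans t0 tr) => h.
  apply: is_derive_eq; rewrite /GRing.scale /=.
  by rewrite mulrN opprK mulrA divfK.
have cge0 (r : R) : t <= r -> 0 <= c * r ^- q.+2.
  by move=> tr; rewrite mulr_ge0// invr_ge0 exprn_ge0// (le_trans (ltW t0)).
have ccont (r : R) : t <= r -> {for r, continuous (fun r : R => c * r ^- q.+2)}.
  move=> tr; apply: differentiable_continuous; apply/derivable1_diffP.
  have h := is_derive_negpow q.+2 (lt_le_trans t0 tr).
  by apply: derivableM => //; exact: ex_derive.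
have hF (r : R) : 1 <= r -> `|- (c / q.+1%:R * r ^- q.+1)| <= c / q.+1%:R / r.
  move=> r1; have r0 : 0 < r by exact: lt_le_trans r1.
  rewrite normrN ger0_norm ?mulr_ge0 ?divr_ge0 ?invr_ge0 ?exprn_ge0 ?(ltW r0)//.
  rewrite ler_wpM2l ?divr_ge0// lef_pV2 ?posrE ?exprn_gt0//.
  by rewrite exprS ler_peMr ?(ltW r0)// exprn_ege1.
by rewrite (integral_itv_bnd_infty_inv der cge0 ccont hF) opprK.
Qed.

Variable K : nat.
Hypothesis K2 : (2 <= K)%N.
Hypothesis lap : forall t, 0 < t ->
  (\int[mu]_x (tilt t x)%:E = (t ^- K)%:E)%E.

Lemma tempered_one : tempered (fun=> 1).
Proof.
move=> t t0; apply: (@rintegrable_ge0 _ _ _ _ _ (t ^- K)).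
- by apply: measurable_funM => //; exact: measurable_tilt.
- by move=> x; rewrite mul1r tilt_ge0.
- by under eq_integral do rewrite mul1r; exact: lap.
Qed.

Lemma lapl_one t : 0 < t -> lapl (fun=> 1) t = t ^- K.
Proof.
move=> t0; rewrite /mean /lapl /mean /Rintegral.
by under eq_integral do rewrite mul1r; rewrite lap.
Qed.

Lemma tempered_cst c : tempered (fun=> c).
Proof.
have := temperedZ c tempered_one; congr (tempered _).
by apply/funext => x; rewrite mulr1.
Qed.

(** Moments of [s] come from differentiating a Laplace transform known in closed form at all
    positive rates. *)
Lemma lapl_derive_eq Y (phi : R -> R) (dphi t : R) : tempered Y -> 0 < t ->
  (forall r, 0 < r -> lapl Y r = phi r) -> is_derive t 1 phi dphi ->
  lapl (fun x => s x * Y x) t = - dphi.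
Proof.
move=> hY t0 hphi dp.
have dl := lapl_is_derive ms s0 hY t0.
have : is_derive t 1 (lapl Y) dphi.
  apply: near_eq_is_derive dp; near=> r; apply/esym/hphi; near: r.
  exact: lt_nbhsr.
by move=> [_ h1]; have [_ h2] := dl; rewrite -h1 h2 opprK.
Unshelve. all: by end_near. Qed.

Lemma tempered_s : tempered s.
Proof.
have := tempered_mul ms s0 tempered_one; congr (tempered _).
by apply/funext => x; rewrite mulr1.
Qed.

Lemma lapl_s t : 0 < t -> lapl s t = K%:R * t ^- K.+1.
Proof.
move=> t0; have h := lapl_derive_eq tempered_one t0 lapl_one (is_derive_negpow K t0).
rewrite -[RHS]opprK -h; congr (lapl _ t).
by apply/funext => x; rewrite mulr1.
Qed.

Lemma tempered_s2 : tempered (fun x => s x ^+ 2).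
Proof. by have := tempered_mul ms s0 tempered_s. Qed.

Lemma lapl_s2 t : 0 < t -> lapl (fun x => s x ^+ 2) t = (K * K.+1)%:R * t ^- K.+2.
Proof.
move=> t0.
have dK : is_derive t 1 (fun r : R => K%:R * r ^- K.+1) (K%:R * - (K.+1%:R * t ^- K.+2)).
  have h := is_derive_negpow K.+1 t0.
  by apply: is_derive_eq; rewrite /GRing.scale /=.
have h := lapl_derive_eq tempered_s t0 lapl_s dK.
rewrite natrM -mulrA -[RHS]opprK -mulrN -h; congr (lapl _ t).
Qed.

(** The mean of [1 / s] is the integral of [r ^- K] over [r >= t], finite since [K >= 2].
    Integrating once more, for [1 / s / s], takes [K >= 3]. *)
Lemma lapl_invE t : 0 < t ->
  (\int[mu]_x (1 / s x * tilt t x)%:E = (1 / K.-1%:R * t ^- K.-1)%:E)%E.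
Proof.
case: K K2 lap => [|[|q]]// _ lap' t0.
apply: (integral_div_tilt t0) => // r r0.
by under eq_integral do rewrite mul1r; rewrite lap'// mul1r.
Qed.

Lemma tempered_inv : tempered (fun x => 1 / s x).
Proof.
move=> t t0; apply: (@rintegrable_ge0 _ _ _ _ _ (1 / K.-1%:R * t ^- K.-1)).
- by apply: measurable_funM; [exact: measurable_divs|exact: measurable_tilt].
- by move=> x; rewrite mulr_ge0 ?divr_ge0// tilt_ge0.
- exact: lapl_invE.
Qed.

Lemma lapl_inv t : 0 < t -> lapl (fun x => 1 / s x) t = 1 / K.-1%:R * t ^- K.-1.
Proof. by move=> t0; rewrite /lapl /mean /Rintegral lapl_invE. Qed.

Hypothesis K3 : (3 <= K)%N.

Lemma lapl_inv2E t : 0 < t ->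
  (\int[mu]_x (1 / s x / s x * tilt t x)%:E =
   (1 / K.-1%:R / K.-2%:R * t ^- K.-2)%:E)%E.
Proof.
move=> t0; have := lapl_invE; case: K K3 => [|[|[|q]]]// _ lap'.
apply: (integral_div_tilt t0) => //.
- exact: measurable_divs.
- by move=> x; exact: divr_ge0.
Qed.

Lemma tempered_inv2 : tempered (fun x => 1 / s x / s x).
Proof.
move=> t t0; apply: (@rintegrable_ge0 _ _ _ _ _ (1 / K.-1%:R / K.-2%:R * t ^- K.-2)).
- apply: measurable_funM; last exact: measurable_tilt.
  by do 2 apply: measurable_divs.
- by move=> x; rewrite mulr_ge0 ?divr_ge0// tilt_ge0.
- exact: lapl_inv2E.
Qed.

Lemma lapl_inv2 t : 0 < t ->
  lapl (fun x => 1 / s x / s x) t = 1 / K.-1%:R / K.-2%:R * t ^- K.-2.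
Proof. by move=> t0; rewrite /lapl /mean /Rintegral lapl_inv2E. Qed.

End gamma_moments.

(** * Lower bounds for the risk *)

Section pointwise_bounds.
Context (R : realType).
Implicit Types (y : R) (n K : nat).

(** Follows from [1 / (1 - y) <= 1 + y + 2 * y ^+ 2], valid for [y] between 0 and [1 / 2]. *)
Lemma expRN_le_onem y : 0 <= y -> y <= 1 / 2 -> expR (- (y + 2 * y ^+ 2)) <= 1 - y.
Proof.
move=> y0 y2; have y1 : 0 < 1 - y by lra.
rewrite expRN -[leRHS]invrK lef_pV2 ?posrE ?expR_gt0 ?invr_gt0//.
rewrite (le_trans _ (expR_ge1Dx _))// -[leLHS]mul1r ler_pdivrMr//.
nra.
Qed.

(** Induction over the number [j] of factors. The error [j * K] instead of [j * j] keeps the step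
    simple: the factor [n - j] with [j <= K] costs at most one more [K / n]. *)
Lemma ffact_ge n K : (0 < n)%N -> (K <= n)%N ->
  (1 - (K * K)%:R / n%:R) * n%:R ^+ K <= (n ^_ K)%:R :> R.
Proof.
move=> n0 Kn; have n0' : 0 < n%:R :> R by rewrite ltr0n.
suff h j : (j <= K)%N -> (1 - (j * K)%:R / n%:R) * n%:R ^+ j <= (n ^_ j)%:R :> R.
  exact: h.
elim: j => [|j IH] jK; first by rewrite mul0n mul0r subr0 expr0 mulr1 ffactn0.
have jn : (j <= n)%N by rewrite (leq_trans _ Kn)// ltnW.
rewrite ffactnSr [leRHS]natrM natrB//.
have [h|h] := leP 0 (1 - (j * K)%:R / n%:R : R); last first.
  apply: (@le_trans _ _ 0); last by rewrite mulr_ge0// subr_ge0 ler_nat.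
  rewrite mulr_le0_ge0 ?exprn_ge0// (le_trans _ (ltW h))// lerB//.
  by rewrite ler_pM2r ?invr_gt0// ler_nat leq_mul2r leqnSn orbT.
apply: le_trans (ler_wpM2r _ (IH (ltnW jK))); last by rewrite subr_ge0 ler_nat.
have jK' : j%:R <= K%:R :> R by rewrite ler_nat ltnW.
have j0 : 0 <= j%:R * K%:R / n%:R * j%:R :> R by rewrite !mulr_ge0// invr_ge0 ltW.
have P0 : 0 <= n%:R ^+ j :> R by rewrite exprn_ge0.
rewrite exprS !natrM -natr1.
rewrite (_ : _ * (n%:R * _) = n%:R ^+ j * (n%:R - (j%:R + 1) * K%:R)); last first.
  by field; rewrite gt_eqF.
rewrite [leRHS]mulrAC [leRHS]mulrC ler_wpM2l//.
rewrite (_ : _ * (n%:R - j%:R) =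
    n%:R - j%:R - j%:R * K%:R + j%:R * K%:R / n%:R * j%:R); last first.
  by field; rewrite gt_eqF.
lra.
Qed.

Lemma ffact_le n K : (n ^_ K)%:R <= n%:R ^+ K :> R.
Proof.
rewrite -natrX ler_nat; elim: K => [|K IH]; first by rewrite ffactn0 expn0.
by rewrite ffactnSr expnSr leq_mul// leq_subr.
Qed.

(* The density of the k-th minima relative to [tilt 1], as a function of their sum. *)
Definition min_weight n K y : R :=
  (n ^_ K)%:R * (1 - y) ^+ (n - K) * expR y.

Lemma min_weight_ge0 n K y : y <= 1 -> 0 <= min_weight n K y.
Proof.
by move=> y1; rewrite /min_weight !mulr_ge0 ?expR_ge0// exprn_ge0// subr_ge0.
Qed.

Lemma min_weight_le n K y : 0 <= y -> y <= 1 -> (K <= n)%N ->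
  min_weight n K y <= n%:R ^+ K * expR (- ((n%:R - 1) * y)) * expR (K%:R * y).
Proof.
move=> y0 y1 Kn; rewrite /min_weight -!mulrA ler_pM ?exprn_ge0 ?subr_ge0//.
- by rewrite mulr_ge0 ?expR_ge0// exprn_ge0// subr_ge0.
- exact: ffact_le.
apply: (@le_trans _ _ (expR (- y) ^+ (n - K) * expR y)).
  rewrite ler_wpM2r ?expR_ge0// lerXn2r ?nnegrE ?subr_ge0 ?expR_ge0//.
  exact: expR_ge1Dx.
rewrite -expRM_natl -!expRD ler_expR natrB//.
rewrite le_eqVlt; apply/orP; left; apply/eqP; ring.
Qed.

(** Each of the [n - K] factors [1 - y] is at least [expR (- (y + 2 * y ^+ 2))]. The linear terms
    give the Gamma weight at rate [n], up to a favourable surplus, and the quadratic ones give the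
    loss. *)
Lemma min_weight_ge n K y : 0 <= y -> y <= 1 / 2 -> (K <= n)%N -> (0 < n)%N ->
  0 <= 1 - (K * K)%:R / n%:R :> R ->
  (1 - (K * K)%:R / n%:R) * expR (- (2 * n%:R * y ^+ 2)) *
    (n%:R ^+ K * expR (- ((n%:R - 1) * y))) <= min_weight n K y.
Proof.
move=> y0 y2 Kn n0 c0; rewrite /min_weight.
have Kn' : K%:R <= n%:R :> R by rewrite ler_nat.
rewrite (_ : (1 - _) * _ * _ = ((1 - (K * K)%:R / n%:R) * n%:R ^+ K) *
  (expR (- (2 * n%:R * y ^+ 2)) * expR (- ((n%:R - 1) * y)))); last by ring.
rewrite -[leRHS]mulrA ler_pM ?mulr_ge0 ?exprn_ge0 ?expR_ge0//.
  exact: ffact_ge.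
apply: (@le_trans _ _ (expR (- (y + 2 * y ^+ 2)) ^+ (n - K) * expR y)); last first.
  rewrite ler_wpM2r ?expR_ge0// lerXn2r ?nnegrE ?subr_ge0 ?expR_ge0//; first lra.
  exact: expRN_le_onem.
rewrite -expRM_natl -!expRD ler_expR natrB//.
have h1 : 0 <= K%:R * y by rewrite mulr_ge0.
have h2 : 0 <= K%:R * y ^+ 2 by rewrite mulr_ge0// exprn_ge0.
rewrite (_ : (n%:R - K%:R) * _ + y = - (2 * n%:R * y ^+ 2) + - ((n%:R - 1) * y) +
  (K%:R * y + 2 * (K%:R * y ^+ 2))); last by ring.
by rewrite lerDl addr_ge0// mulr_ge0.
Qed.

(* If the weight [p] is at least [g / B], completing the square gives the
   pointwise form of the Cauchy-Schwarz inequality. *)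
Lemma quadratic_lower (A h t g B p : R) : 0 <= g -> 0 < B -> g <= p * B ->
  2 * t * A * h * g - t ^+ 2 * h ^+ 2 * g * B <= A ^+ 2 * p.
Proof.
move=> g0 B0 gp.
apply: (@le_trans _ _ (A ^+ 2 * (g / B))); last first.
  by rewrite ler_wpM2l ?sqr_ge0// ler_pdivrMr.
rewrite -subr_ge0 (_ : _ - _ = g / B * (A - t * h * B) ^+ 2); last first.
  by field; rewrite gt_eqF.
by rewrite mulr_ge0 ?sqr_ge0// divr_ge0// ltW.
Qed.

(** An application of [quadratic_lower] with [g] the density of the model at rate [n]. The
    hypothesis on [h] keeps the cost of replacing the weight by [g] integrable: a factor
    [expR (3 / 4 * n%:R * y)] still leaves the rate [n / 4]. *)
Lemma min_weight_score (A h t H y g : R) n K : 0 <= y -> y <= 1 / 4 ->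
  (0 < n)%N -> (2 * (K * K) <= n)%N -> (K <= n)%N ->
  h ^+ 2 * y ^+ 2 * expR (n%:R * y / 2) <= H * expR (3 / 4 * n%:R * y) ->
  g = n%:R ^+ K * expR (- ((n%:R - 1) * y)) ->
  2 * t * A * h * g - t ^+ 2 * (1 + 2 * (K * K)%:R / n%:R) *
    (h ^+ 2 * g + 2 * n%:R * H * expR (3 / 4 * n%:R * y) * g)
  <= A ^+ 2 * min_weight n K y.
Proof.
move=> y0 y4 n0 Kn2 Kn hH gE.
have n0' : 0 < n%:R :> R by rewrite ltr0n.
have g0 : 0 <= g by rewrite gE mulr_ge0 ?expR_ge0// exprn_ge0.
set k2 : R := (K * K)%:R / n%:R.
have k20 : 0 <= k2 by rewrite divr_ge0// ltW.
have k21 : k2 <= 1 / 2.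
  have : (2 * (K * K))%:R <= n%:R :> R by rewrite ler_nat.
  by rewrite /k2 ler_pdivrMr// natrM; lra.
pose z := 2 * n%:R * y ^+ 2.
have z0 : 0 <= z by rewrite !mulr_ge0 ?sqr_ge0// ltW.
have zy : z <= n%:R * y / 2.
  rewrite /z expr2 !mulrA [2 * n%:R]mulrC -!mulrA ler_wpM2l ?(ltW n0')//; nra.
(* An upper bound for [g] over the weight: [1 / (1 - k2) <= 1 + 2 * k2] for [k2 <= 1 / 2], and
   [expR z <= 1 + z * expR z], where [z <= n%:R * y / 2] since [y <= 1 / 4]. *)
pose B := (1 + 2 * k2) * (1 + z * expR (n%:R * y / 2)).
have B0 : 0 < B.
  rewrite mulr_gt0// ?ltr_wpDr// ?mulr_ge0 ?expR_ge0//.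
have gp : g <= min_weight n K y * B.
  have c0 : 0 <= 1 - k2 by lra.
  have h1 : y <= 1 / 2 by lra.
  apply: le_trans (ler_wpM2r (ltW B0) (min_weight_ge y0 h1 Kn n0 c0)).
  rewrite -gE -/k2 -/z mulrAC -[leLHS]mul1r ler_wpM2r//.
  rewrite /B mulrACA -[leLHS]mulr1 ler_pM//.
    by nra.
  rewrite mulrC expRN ler_pdivlMr ?expR_gt0// mul1r.
  have e1 : expR z <= 1 + z * expR z.
    have ez : (1 - z) * expR z <= 1.
      rewrite -[leRHS](mulVf (lt0r_neq0 (expR_gt0 z))) ler_wpM2r ?expR_ge0//.
      by rewrite -expRN; exact: expR_ge1Dx.
    lra.
  rewrite (le_trans e1)// lerD2l ler_wpM2l// ler_expR//.
apply: le_trans (quadratic_lower A h t g0 B0 gp).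
rewrite lerD2l lerN2 /B -/k2.
rewrite (_ : t ^+ 2 * h ^+ 2 * g * _ = t ^+ 2 * (1 + 2 * k2) *
  (h ^+ 2 * g + 2 * n%:R * (h ^+ 2 * y ^+ 2 * expR (n%:R * y / 2)) * g)); last first.
  by rewrite /z; ring.
have -> : 2 * (K * K)%:R / n%:R = 2 * k2 by rewrite /k2 mulrA.
have k2p : 0 <= 1 + 2 * k2 by lra.
have t2p : 0 <= t ^+ 2 * (1 + 2 * k2) by exact: mulr_ge0 (sqr_ge0 _) k2p.
rewrite ler_wpM2l//.
by rewrite lerD2l ler_wpM2r// -[leRHS]mulrA ler_wpM2l.
Qed.

End pointwise_bounds.

(** * The risk restricted to a small sum *)

Section core_risk.
Context d (T : measurableType d) (R : realType) (mu : probability T R).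
Variables (s : T -> R) (K : nat) (a : R).
Hypotheses (ms : measurable_fun setT s) (s0 : forall x, 0 <= s x).
Hypothesis lap : forall t, 0 < t ->
  (\int[mu]_x (tilt s t x)%:E = (t ^- K)%:E)%E.
Hypotheses (a0 : 0 < a) (a4 : a <= 1 / 4).

Local Notation tilt := (tilt s).
Local Notation tempered := (tempered mu s).
Local Notation lapl := (lapl mu s).

(** By [core_risk_minima], the part of the risk of the minima that comes from a sum below [a],
    written under the rate 1 Gamma law. *)
Definition core_risk (n : nat) (Y : T -> R) : \bar R :=
  (\int[mu]_x (if s x < a then (Y x - n%:R) ^+ 2 * min_weight n K (s x)
               else 0)%:E)%E.

Definition tail (Z : T -> R) (t : R) : R :=
  mean mu (fun x => if a <= s x then `|Z x| * tilt t x else 0).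

Lemma measurable_min_weight n : measurable_fun setT (fun x => min_weight n K (s x)).
Proof.
rewrite /min_weight; apply: measurable_funM; last exact: measurableT_comp.
by apply: measurable_funM => //; apply: measurable_funX; exact: measurable_funB.
Qed.

Lemma measurable_core n (Y : T -> R) : measurable_fun setT Y ->
  measurable_fun setT (fun x => if s x < a then
    (Y x - n%:R) ^+ 2 * min_weight n K (s x) else 0).
Proof.
move=> mY; apply: measurable_fun_ifT => //; first exact: measurable_fun_ltr.
apply: measurable_funM; last exact: measurable_min_weight.
by apply: measurable_funX; exact: measurable_funB.
Qed.

Lemma core_ge0 n (Y : T -> R) x : 0 <= (if s x < a then
    (Y x - n%:R) ^+ 2 * min_weight n K (s x) else 0).
Proof.
case: ifP => // sa; rewrite mulr_ge0 ?sqr_ge0// min_weight_ge0//.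
by rewrite (le_trans (ltW sa))// (le_trans a4)// ler_pdivrMr// mul1r ler1n.
Qed.

Lemma tail_rintegrable (Z : T -> R) (t : R) : tempered Z -> 0 < t ->
  rintegrable mu (fun x => if a <= s x then `|Z x| * tilt t x else 0).
Proof.
move=> hZ t0; apply: rintegrable_le (tempered_norm hZ t0).
  apply: measurable_fun_ifT => //; first exact: measurable_fun_ler.
  apply: measurable_funM; last exact: measurable_tilt.
  exact: measurableT_comp (tempered_measurable hZ).
move=> x; case: ifP => _; first by rewrite ger0_norm ?mulr_ge0 ?tilt_ge0.
by rewrite normr0 mulr_ge0 ?tilt_ge0.
Qed.

Lemma tail_le_tail (Y Z : T -> R) (c t : R) : tempered Y -> tempered Z -> 0 < t ->
  (forall x, a <= s x -> `|Y x| <= c * `|Z x|) -> tail Y t <= c * tail Z t.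
Proof.
move=> hY hZ t0 h; rewrite /tail -meanZ; last exact: tail_rintegrable.
apply: mean_le; [exact: tail_rintegrable|exact/rintegrableZ/tail_rintegrable|].
move=> x; case: ifP => sa; last by rewrite mulr0.
by rewrite mulrA ler_wpM2r ?tilt_ge0// h.
Qed.

Lemma tail_ge0 (Z : T -> R) (t : R) : 0 <= tail Z t.
Proof.
apply: mean_ge0 => x; case: ifP => // _.
by rewrite mulr_ge0// tilt_ge0.
Qed.

(** On [s >= a], passing from rate 2 to rate [t] gains a factor [expR (- ((t - 2) * a))], which
    beats every power of [t]. The constant comes from [t <= 3 * (t - 2)] and [expR_ge_pow]. *)
Lemma tail_rapid (Z : T -> R) (q : nat) : tempered Z ->
  exists2 C, 0 <= C & forall t : R, 3 <= t -> t ^+ q * tail Z t <= C.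
Proof.
move=> hZ; pose M := mean mu (fun x => `|Z x * tilt 2 x|).
have M0 : 0 <= M by apply: mean_ge0.
exists ((3 / a) ^+ q * q`!%:R * M).
  by rewrite !mulr_ge0// exprn_ge0// divr_ge0// ltW.
move=> t t3; have t0 : 0 < t by lra.
pose e : R := expR (- ((t - 2) * a)).
have tM : tail Z t <= e * M.
  have iM : rintegrable mu (fun x => `|Z x * tilt 2 x|).
    by apply: rintegrable_norm; exact: hZ.
  rewrite /M -meanZ//.
  apply: mean_le; [exact: tail_rintegrable|exact: rintegrableZ|] => x.
  case: ifP => sa; last by rewrite mulr_ge0// expR_ge0.
  rewrite normrM (ger0_norm (tilt_ge0 _ _ _)) mulrCA ler_wpM2l// -expRD ler_expR.
  have : 0 <= (t - 2) * (s x - a) by rewrite mulr_ge0//; lra.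
  by move=> h; rewrite -subr_ge0 (_ : _ - _ = (t - 2) * (s x - a))//; ring.
apply: le_trans (ler_wpM2l (exprn_ge0 _ (ltW t0)) tM) _.
rewrite mulrA ler_wpM2r// /e expRN ler_pdivrMr ?expR_gt0//.
rewrite -mulrA -ler_pdivrMl ?exprn_gt0 ?divr_gt0//.
have h0 : 0 <= (t - 2) * a by rewrite mulr_ge0 ?(ltW a0)//; lra.
apply: le_trans (expR_ge_pow q h0).
rewrite mulrC -exprVn -exprMn lerXn2r ?nnegrE//.
  by rewrite mulr_ge0 ?invr_ge0 ?divr_ge0// ltW.
rewrite invf_div mulrA ler_pdivrMr//.
by rewrite mulrAC ler_wpM2r ?(ltW a0)//; lra.
Qed.

Lemma mean_le_integral (r f : T -> R) : rintegrable mu r ->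
  measurable_fun setT f -> (forall x, 0 <= f x) -> (forall x, r x <= f x) ->
  ((mean mu r)%:E <= \int[mu]_x (f x)%:E)%E.
Proof.
move=> ir mf f0 rf; rewrite EFin_mean//.
have [foo|] := ltP (\int[mu]_x (f x)%:E)%E +oo%E; last first.
  by rewrite leye_eq => /eqP ->; exact: leey.
have jf : rintegrable mu f.
  apply/integrableP; split; first exact/measurable_EFinP.
  by under eq_integral do rewrite /= ger0_norm//.
by apply: le_integral => // x _; rewrite lee_fin.
Qed.

(** Integrated form of [min_weight_score]. The Laplace transforms run over all values of [s], hence
    the subtracted [tail]; the correction in [H] is a total mass at rate [n / 4], which produces
    [4 ^+ K]. *)
Lemma core_risk_ge (n : nat) (Y h : T -> R) (t H : R) :
  (0 < n)%N -> (2 * (K * K) <= n)%N -> (K <= n)%N ->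
  tempered Y -> tempered (fun x => (Y x - n%:R) * h x) ->
  tempered (fun x => h x ^+ 2) ->
  (forall x, h x ^+ 2 * s x ^+ 2 * expR (n%:R * s x / 2) <=
             H * expR (3 / 4 * n%:R * s x)) ->
  ((2 * t * (n%:R ^+ K * lapl (fun x => (Y x - n%:R) * h x) n%:R)
    - 2 * `|t| * (n%:R ^+ K * tail (fun x => (Y x - n%:R) * h x) n%:R)
    - t ^+ 2 * (1 + 2 * (K * K)%:R / n%:R) *
      (n%:R ^+ K * lapl (fun x => h x ^+ 2) n%:R + 2 * n%:R * H * 4 ^+ K))%:E
   <= core_risk n Y)%E.
Proof.
move=> n0 Kn2 Kn hY hAh hh hH.
have n0' : 0 < n%:R :> R by rewrite ltr0n.
pose Ah x := (Y x - n%:R) * h x.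
pose tl x := if a <= s x then `|Ah x| * tilt n%:R x else 0.
pose c : R := t ^+ 2 * (1 + 2 * (K * K)%:R / n%:R).
have c0 : 0 <= c.
  by rewrite /c mulr_ge0 ?sqr_ge0// addr_ge0// mulr_ge0// ?invr_ge0 ?mulr_ge0 ?ltW.
pose r x := 2 * t * n%:R ^+ K * (Ah x * tilt n%:R x)
  - 2 * `|t| * n%:R ^+ K * tl x
  - (c * n%:R ^+ K * (h x ^+ 2 * tilt n%:R x) +
     c * 2 * n%:R * H * n%:R ^+ K * (1 * tilt (n%:R / 4) x)).
have n40 : 0 < n%:R / 4 :> R by rewrite divr_gt0.
have i1 := hAh _ n0'.
have i2 : rintegrable mu tl by exact: tail_rintegrable.
have i3 := hh _ n0'.
have i4 := tempered_one ms lap n40.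
have j1 := rintegrableZ (2 * t * n%:R ^+ K) i1.
have j2 := rintegrableZ (2 * `|t| * n%:R ^+ K) i2.
have j3 := rintegrableZ (c * n%:R ^+ K) i3.
have j4 := rintegrableZ (c * 2 * n%:R * H * n%:R ^+ K) i4.
have ir : rintegrable mu r.
  by apply: rintegrableB; [exact: rintegrableB|exact: rintegrableD].
have -> : 2 * t * (n%:R ^+ K * lapl Ah n%:R)
    - 2 * `|t| * (n%:R ^+ K * tail Ah n%:R)
    - c * (n%:R ^+ K * lapl (fun x => h x ^+ 2) n%:R + 2 * n%:R * H * 4 ^+ K)
    = mean mu r.
  rewrite /r meanB; [|exact: rintegrableB|exact: rintegrableD].
  rewrite meanB// meanD// (meanZ _ i1) (meanZ _ i2) (meanZ _ i3) (meanZ _ i4).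
  rewrite -/(lapl Ah n%:R) -/(lapl (fun x => h x ^+ 2) n%:R).
  have -> : mean mu (fun x => 1 * tilt (n%:R / 4) x) = (n%:R / 4) ^- K.
    exact: (lapl_one lap n40).
  rewrite -/(tail Ah n%:R) expr_div_n invf_div.
  have : n%:R ^+ K != 0 :> R by rewrite expf_neq0// gt_eqF.
  by move=> nK; field.
apply: mean_le_integral => //.
- exact: measurable_core (tempered_measurable hY).
- exact: core_ge0.
move=> x; rewrite /r /tl /Ah.
have gE : tilt (n%:R / 4) x = expR (3 / 4 * n%:R * s x) * tilt n%:R x.
  by rewrite [RHS]mulrC tiltD; congr (tilt _ x); field.
(* For [s x >= a] the core integrand is 0, and the lower bound is nonpositive because [tl] offsets
   the linear term. *)
have [sa|sa] := ltP (s x) a; last first.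
  have H0 : 0 <= H * expR (3 / 4 * n%:R * s x).
    apply: le_trans (hH x).
    exact: mulr_ge0 (mulr_ge0 (sqr_ge0 _) (sqr_ge0 _)) (expR_ge0 _).
  have nK0 : 0 <= n%:R ^+ K :> R by rewrite exprn_ge0.
  rewrite subr_le0 (@le_trans _ _ 0)//.
    rewrite subr_le0 -!mulrA [X in _ <= X]mulrCA.
    rewrite [leLHS](_ : _ = 2 * (n%:R ^+ K * (t * ((Y x - n%:R) * h x) * tilt n%:R x))); last by ring.
    rewrite [leRHS](_ : _ = 2 * (n%:R ^+ K * (`|t| * `|(Y x - n%:R) * h x| * tilt n%:R x))); last by ring.
    rewrite ler_wpM2l// ler_wpM2l// ler_wpM2r ?tilt_ge0// -normrM.
    exact: ler_norm.
  rewrite gE addr_ge0//; first exact: mulr_ge0 (mulr_ge0 c0 nK0) (mulr_ge0 (sqr_ge0 _) (tilt_ge0 _ _ _)).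
  rewrite (_ : _ * _ = c * 2 * n%:R * n%:R ^+ K * tilt n%:R x *
    (H * expR (3 / 4 * n%:R * s x))); last by ring.
  apply: mulr_ge0 H0; apply: mulr_ge0 (tilt_ge0 _ _ _); apply: mulr_ge0 nK0.
  by apply: mulr_ge0 (ltW n0'); apply: mulr_ge0 c0 _.
have s4 : s x <= 1 / 4 by rewrite (le_trans (ltW sa)).
have := min_weight_score (Y x - n%:R) t (s0 x) s4 n0 Kn2 Kn (hH x) (erefl _).
apply: le_trans; rewrite le_eqVlt; apply/orP; left; apply/eqP.
by rewrite gE mulr0 subr0 /c /tilt; ring.
Qed.

End core_risk.

Section risk_asymptotics.
Context d (T : measurableType d) (R : realType) (mu : probability T R).
Variables (s : T -> R) (K : nat) (a : R).
Hypotheses (ms : measurable_fun setT s) (s0 : forall x, 0 <= s x).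
Hypothesis K2 : (2 <= K)%N.
Hypothesis lap : forall t, 0 < t ->
  (\int[mu]_x (tilt s t x)%:E = (t ^- K)%:E)%E.
Hypotheses (a0 : 0 < a) (a4 : a <= 1 / 4).

Local Notation tilt := (tilt s).
Local Notation tempered := (tempered mu s).
Local Notation lapl := (lapl mu s).
Local Notation tail := (tail mu s a).
Local Notation core_risk := (core_risk mu s K a).

Let K0 : 0 < K%:R :> R. Proof. by rewrite ltr0n (leq_trans _ K2). Qed.

(* The derivative of [t ^ K * lapl Y t]. *)
Definition mean_slope (Y : T -> R) (t : R) : R :=
  t ^+ K * (K%:R / t * lapl Y t - lapl (fun x => s x * Y x) t).

(** The score [K / t - s] has mean 0 at rate [t], so [c] drops out and the covariance with the score
    is the derivative of the mean. *)
Lemma score_moment (Y : T -> R) (t c : R) : tempered Y -> 0 < t ->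
  t ^+ K * lapl (fun x => (Y x - c) * (K%:R / t - s x)) t = mean_slope Y t.
Proof.
move=> hY t0; rewrite /mean_slope; congr (_ * _).
have hs := tempered_s ms s0 lap; have h1 := tempered_cst ms lap (c * (K%:R / t)).
have hsY := tempered_mul ms s0 hY.
transitivity (lapl (fun x => (K%:R / t * Y x - s x * Y x) -
                            (c * (K%:R / t) * 1 - c * s x)) t).
  by apply: eq_mean => x; ring.
have ho := tempered_one ms lap.
rewrite laplB//; [|exact: temperedB (temperedZ _ _) _|
                   exact: temperedB (temperedZ _ _) (temperedZ _ _)].
rewrite laplB//; last exact: temperedZ.
rewrite laplB//; [|exact: temperedZ|exact: temperedZ].
rewrite !laplZ// (lapl_one lap)// (lapl_s ms s0 lap)//.
have tK : t ^+ K != 0 by rewrite expf_neq0// gt_eqF.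
by rewrite exprS; field; rewrite tK gt_eqF.
Qed.

(** The Fisher information of the Gamma law of shape [K] at rate [t]. *)
Lemma score_variance (t : R) : 0 < t ->
  t ^+ K * lapl (fun x => (K%:R / t - s x) ^+ 2) t = K%:R / t ^+ 2.
Proof.
move=> t0.
have hs := tempered_s ms s0 lap; have hs2 := tempered_s2 ms s0 lap.
have h1 := tempered_one ms lap.
transitivity (t ^+ K * lapl (fun x => ((K%:R / t) ^+ 2 * 1 -
    2 * (K%:R / t) * s x) + s x ^+ 2) t).
  by congr (_ * _); apply: eq_mean => x; ring.
rewrite laplD//; last by apply: temperedB; apply: temperedZ.
rewrite laplB//; [|exact: temperedZ|exact: temperedZ].
rewrite !laplZ// (lapl_one lap)// (lapl_s ms s0 lap)// (lapl_s2 ms s0 lap)//.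
have tK : t ^+ K != 0 by rewrite expf_neq0// gt_eqF.
rewrite !exprS natrM -natr1; field; rewrite tK gt_eqF//.
Qed.

Lemma tempered_score t : tempered (fun x => (K%:R / t - s x) ^+ 2).
Proof.
have hs := tempered_s ms s0 lap; have hs2 := tempered_s2 ms s0 lap.
have h1 := tempered_one ms lap.
have h : tempered (fun x => ((K%:R / t) ^+ 2 * 1 - 2 * (K%:R / t) * s x) + s x ^+ 2).
  by apply: temperedD => //; apply: temperedB; apply: temperedZ.
by move: h; congr (tempered _); apply/funext => x; ring.
Qed.

Lemma score_growth : exists2 H : R, 0 <= H & forall t y : R, 0 < t -> 0 <= y ->
  (K%:R / t - y) ^+ 2 * y ^+ 2 * expR (t * y / 2) <=
  H / t ^+ 4 * expR (3 / 4 * t * y).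
Proof.
have [M M0 hM] : exists2 M : R, 0 <= M & forall x : R, 0 <= x ->
    (8 * x) ^+ 2 <= M * expR x.
  exists (8 ^+ 2 * (2`!)%:R) => [|x x0]; first by rewrite mulr_ge0// exprn_ge0.
  by rewrite exprMn -mulrA ler_wpM2l ?exprn_ge0//; exact: expR_ge_pow.
exists (2 * K%:R ^+ 2 * M + 2 * M ^+ 2) => [|t y t0 y0].
  by rewrite addr_ge0// !mulr_ge0// exprn_ge0.
(* The exponents [t * y / 2] and [3 / 4 * t * y] differ by two factors [e]. Each can absorb one
   [y ^+ 2], at the cost of [M / t ^+ 2]. *)
pose e := expR (t * y / 8).
have ty0 : 0 <= t * y / 8 by rewrite divr_ge0// mulr_ge0// ltW.
have e1 : 1 <= e by rewrite -expR0 ler_expR.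
have t20 : 0 < t ^+ 2 by rewrite exprn_gt0.
pose B := M / t ^+ 2 * e.
have y2 : y ^+ 2 <= B.
  rewrite /B mulrAC ler_pdivlMr//; apply: le_trans (hM _ ty0).
  by rewrite le_eqVlt; apply/orP; left; apply/eqP; field.
have h1 : (K%:R / t - y) ^+ 2 <= 2 * K%:R ^+ 2 / t ^+ 2 + 2 * y ^+ 2.
  rewrite -subr_ge0 (_ : _ - _ = (K%:R / t + y) ^+ 2) ?sqr_ge0//.
  by field; rewrite gt_eqF.
have B0 : 0 <= B by rewrite mulr_ge0 ?expR_ge0// divr_ge0// ltW.
have h2 : (K%:R / t - y) ^+ 2 * y ^+ 2 <=
    (2 * K%:R ^+ 2 / t ^+ 2 + 2 * B) * B.
  apply: ler_pM => //; [exact: sqr_ge0|exact: sqr_ge0|].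
  by apply: le_trans h1 _; rewrite lerD2l ler_wpM2l.
rewrite (_ : 3 / 4 * t * y = t * y / 2 + (t * y / 8 + t * y / 8)); last by field.
rewrite expRD mulrA [leRHS]mulrAC ler_wpM2r ?expR_ge0//.
rewrite (le_trans h2)// expRD -/e /B.
rewrite [leLHS](_ : _ = (2 * K%:R ^+ 2 * M * e + 2 * M ^+ 2 * e ^+ 2) / t ^+ 4); last first.
  by field; rewrite gt_eqF.
rewrite [leRHS]mulrAC ler_wpM2r ?invr_ge0 ?exprn_ge0 ?(ltW t0)//.
rewrite [leRHS]mulrDl -[e * e]expr2 lerD// ler_wpM2l ?mulr_ge0 ?exprn_ge0//.
by rewrite ler_eXnr.
Qed.

(** With [f] the slope, [2 * t * f - t ^+ 2 * K / n ^+ 2] is largest at [t = n ^+ 2 * f / K], with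
    value [n ^+ 2 * f ^+ 2 / K]. The errors are then either relative to that value, of order
    [1 / n], or bounded. *)
Lemma core_risk_cramer_rao (Y : T -> R) : tempered Y ->
  exists c C : R, exists N : nat, forall n, (N <= n)%N ->
    ((n%:R ^+ 2 / K%:R * mean_slope Y n%:R ^+ 2 * (1 - c / n%:R) - C)%:E
     <= core_risk n Y)%E.
Proof.
move=> hY.
(* Times [n], it bounds [(Y - n) * (K / n - s)] for every [n >= 1]. That factor and the wish for a
   remainder of order [1 / n ^+ 2] account for the exponent [K.+3] below. *)
pose Z x := (`|Y x| + 1) * (K%:R + s x).
have h1 := tempered_one ms lap.
have hY1 : tempered (fun x => `|Y x| + 1) by exact: temperedD (tempered_norm hY) h1.
have hZ : tempered Z.
  have := temperedD (temperedZ K%:R hY1) (tempered_mul ms s0 hY1).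
  by congr (tempered _); apply/funext => x; rewrite /Z; ring.
have [C1 C10 hC1] := tail_rapid ms a0 K.+3 hZ.
have [H H0 hH0] := score_growth.
pose D : R := 2 * H * 4 ^+ K / K%:R.
have D0 : 0 <= D.
  by rewrite divr_ge0 ?(ltW K0)// !mulr_ge0 ?exprn_ge0.
pose k2 : R := 2 * (K * K)%:R.
have k20 : 0 <= k2 by rewrite mulr_ge0.
pose c0 : R := k2 + D + k2 * D.
(* Here [c0] collects the relative errors [k2 / n] and [D / n]. The tail term is linear in [f]: by
   [q2] below it splits into [f ^+ 2 / n], which is the added 1, and a term in [ep ^+ 2], which
   gives the second constant. *)
exists (c0 + 1), (C1 ^+ 2 / K%:R), (maxn 3 (maxn K (2 * (K * K)))) => n.
rewrite !geq_max => /and3P[n3 Kn Kn2].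
have n0 : (0 < n)%N by exact: leq_trans n3.
have n0' : 0 < n%:R :> R by rewrite ltr0n.
have n1 : 1 <= n%:R :> R by rewrite ler1n.
pose h x := K%:R / n%:R - s x.
pose f := mean_slope Y n%:R.
have hAh : tempered (fun x => (Y x - n%:R) * h x).
  have hYn : tempered (fun x => Y x - n%:R).
    by apply: temperedB => //; exact: (tempered_cst ms lap).
  have := temperedB (temperedZ (K%:R / n%:R) hYn) (tempered_mul ms s0 hYn).
  by congr (tempered _); apply/funext => x; rewrite /h; ring.
have hH x : h x ^+ 2 * s x ^+ 2 * expR (n%:R * s x / 2) <=
    H / n%:R ^+ 4 * expR (3 / 4 * n%:R * s x).
  exact: hH0.
have := core_risk_ge ms s0 lap a4 (n%:R ^+ 2 / K%:R * f) n0 Kn2 Kn hY hAh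
  (tempered_score _) hH.
rewrite score_moment// score_variance// -/f; apply: le_trans; rewrite lee_fin.
set ep := n%:R ^+ K * tail _ _.
have ep0 : 0 <= ep by rewrite mulr_ge0 ?tail_ge0// exprn_ge0.
have epC : ep <= C1 / n%:R ^+ 2.
  rewrite ler_pdivlMr ?exprn_gt0// (le_trans _ (hC1 n%:R _)) ?ler_nat//.
  have tl : tail (fun x => (Y x - n%:R) * h x) n%:R <= n%:R * tail Z n%:R.
    apply: (tail_le_tail ms) => // x _; rewrite normrM /Z normrM.
    rewrite (ger0_norm (addr_ge0 (normr_ge0 _) ler01)).
    rewrite (ger0_norm (addr_ge0 (ltW K0) (s0 x))) mulrA ler_pM//.
      rewrite (le_trans (ler_normB _ _))// (ger0_norm (ltW n0')).
      by rewrite mulrDr mulr1 lerD2r ler_peMl.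
    rewrite (le_trans (ler_normB _ _))// (ger0_norm (s0 x)) lerD2r.
    rewrite ger0_norm ?divr_ge0//.
    by rewrite ler_pdivrMr// ler_peMr// ltW.
  rewrite /ep [X in _ <= X](_ : _ = n%:R ^+ K * (n%:R * tail Z n%:R) * n%:R ^+ 2); last first.
    by rewrite !exprS; ring.
  by rewrite ler_wpM2r ?exprn_ge0// ler_wpM2l ?exprn_ge0.
have nK0 : 0 <= n%:R ^+ 2 / K%:R :> R by rewrite divr_ge0// exprn_ge0.
have -> : `|n%:R ^+ 2 / K%:R * f| = n%:R ^+ 2 / K%:R * `|f|.
  by rewrite normrM ger0_norm.
rewrite [leRHS](_ : _ = n%:R ^+ 2 / K%:R * (2 * f ^+ 2 - 2 * `|f| * ep -
  f ^+ 2 * ((1 + k2 / n%:R) * (1 + D / n%:R)))); last first.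
  by rewrite /D /k2; field; rewrite !gt_eqF.
rewrite [X in _ - X](_ : _ = n%:R ^+ 2 / K%:R * (C1 ^+ 2 / n%:R ^+ 2)); last first.
  by field; rewrite !gt_eqF.
rewrite -mulrA -mulrBr ler_wpM2l//.
have q1 : (1 + k2 / n%:R) * (1 + D / n%:R) <= 1 + c0 / n%:R.
  rewrite /c0 (_ : _ * _ = 1 + (k2 + D + k2 * D / n%:R) / n%:R); last first.
    by field; rewrite gt_eqF.
  rewrite lerD2l ler_pM2r ?invr_gt0// lerD2l ler_pdivrMr// ler_peMr// mulr_ge0//.
have q2 : 2 * `|f| * ep <= f ^+ 2 / n%:R + n%:R * ep ^+ 2.
  rewrite -subr_ge0 -(real_normK (num_real f)).
  rewrite (_ : _ - _ = (`|f| - n%:R * ep) ^+ 2 / n%:R); last first.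
    by field; rewrite gt_eqF.
  by rewrite divr_ge0 ?sqr_ge0// ltW.
have q3 : n%:R * ep ^+ 2 <= C1 ^+ 2 / n%:R ^+ 2.
  have e2 : ep ^+ 2 <= (C1 / n%:R ^+ 2) ^+ 2.
    by rewrite lerXn2r ?nnegrE// divr_ge0// exprn_ge0.
  apply: le_trans (ler_wpM2l (ltW n0') e2) _.
  rewrite (_ : n%:R * _ = C1 ^+ 2 / n%:R ^+ 2 / n%:R); last first.
    by field; rewrite gt_eqF.
  by rewrite ler_pdivrMr// ler_peMr// divr_ge0 ?sqr_ge0 ?exprn_ge0.
have q4 : f ^+ 2 * ((1 + k2 / n%:R) * (1 + D / n%:R)) <= f ^+ 2 * (1 + c0 / n%:R).
  by rewrite ler_wpM2l ?sqr_ge0.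
have -> : f ^+ 2 * (1 - (c0 + 1) / n%:R) =
    2 * f ^+ 2 - f ^+ 2 / n%:R - f ^+ 2 * (1 + c0 / n%:R).
  by field; rewrite gt_eqF.
lra.
Qed.

End risk_asymptotics.

(** * Unbiased estimators *)

Section unbiased.
Context d (T : measurableType d) (R : realType) (mu : probability T R).
Variables (s : T -> R) (K : nat) (a : R).
Hypotheses (ms : measurable_fun setT s) (s0 : forall x, 0 <= s x).
Hypothesis spos : {ae mu, forall x, 0 < s x}.
Hypothesis K2 : (2 <= K)%N.
Hypothesis lap : forall t, 0 < t ->
  (\int[mu]_x (tilt s t x)%:E = (t ^- K)%:E)%E.
Hypotheses (a0 : 0 < a) (a4 : a <= 1 / 4).

Local Notation tilt := (tilt s).
Local Notation tempered := (tempered mu s).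
Local Notation lapl := (lapl mu s).
Local Notation tail := (tail mu s a).
Local Notation core_risk := (core_risk mu s K a).

Lemma tempered_dominated (Z W : T -> R) : measurable_fun setT Z -> tempered W ->
  (forall x, `|Z x| <= W x) -> tempered Z.
Proof.
move=> mZ hW ZW t t0; apply: rintegrable_le (hW _ t0).
  by apply: measurable_funM => //; exact: measurable_tilt.
by move=> x; rewrite normrM (ger0_norm (tilt_ge0 _ _ _)) ler_wpM2r// tilt_ge0.
Qed.

(** Dominated convergence: as [s > 0] almost everywhere, the tilts decrease to 0. *)
Lemma lapl_cvg0 (Z : T -> R) : tempered Z -> lapl Z n.+1%:R @[n --> \oo] --> 0.
Proof.
move=> hZ.
pose f_ (n : nat) (x : T) : \bar R := (Z x * tilt n.+1%:R x)%:E.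
have i1 := rintegrable_norm (hZ _ ltr01).
have mf n : measurable_fun setT (f_ n) by apply: measurable_int (hZ _ (ltr0Sn R n)).
have f0 : {ae mu, forall x, setT x -> f_ ^~ x @ \oo --> cst 0%E x}.
  apply: filterS spos => x sx _; apply: cvg_EFin; first by near=> n.
  rewrite -(mulr0 (Z x)); apply: cvgMr.
  have e1 : `|expR (- s x)| < 1 by rewrite ger0_norm ?expR_ge0// expR_lt1 oppr_lt0.
  apply: cvg_trans (cvg_expr e1); apply: near_eq_cvg; near=> n.
  by rewrite /tilt -natr1 addrK -expRM_natl; congr expR; ring.
have fg : {ae mu, forall x n, setT x -> (`|f_ n x| <= (`|Z x * tilt 1 x|)%:E)%E}.
  apply: aeW => x n _; rewrite lee_fin !normrM ler_wpM2l//.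
  by rewrite !(ger0_norm (tilt_ge0 _ _ _)) tilt_le// ler1n.
have [_ _ h] := dominated_convergence measurableT mf (measurable_cst _) f0 i1 fg.
rewrite integral0 in h; exact: (fine_cvg h).
Unshelve. all: by end_near. Qed.

Lemma lapl_ae_eq (Y Z : T -> R) (t : R) : tempered Y -> tempered Z -> 0 < t ->
  (forall x, 0 < s x -> Y x = Z x) -> lapl Y t = lapl Z t.
Proof.
move=> hY hZ t0 YZ; congr fine.
have mY := measurable_int _ (hY _ t0); have mZ := measurable_int _ (hZ _ t0).
by apply: ae_eq_integral => //; apply: filterS spos => x sx _; rewrite YZ.
Qed.

(** For one fixed [n], the weight is bounded below on [s < a] by a positive constant and every tilt
    is at most [expR a] there, so a finite risk makes [Y ^+ 2] integrable near [s = 0] at all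
    rates. *)
Lemma core_risk_tempered_square (n : nat) (Y : T -> R) : (K <= n)%N -> tempered Y ->
  (core_risk n Y < +oo)%E -> tempered (fun x => if s x < a then Y x ^+ 2 else 0).
Proof.
move=> Kn hY fin t t0; have mY := tempered_measurable hY.
pose core x := if s x < a then (Y x - n%:R) ^+ 2 * min_weight n K (s x) else 0.
have ic : rintegrable mu core.
  apply/integrableP; split; first by apply/measurable_EFinP; exact: measurable_core.
  by under eq_integral do rewrite /= ger0_norm ?core_ge0//.
pose c : R := (n ^_ K)%:R * (3 / 4) ^+ (n - K).
have c0 : 0 < c by rewrite mulr_gt0 ?exprn_gt0 ?divr_gt0// ltr0n ffact_gt0.
pose g x := expR a * 2 * c^-1 * core x + 2 * n%:R ^+ 2 * (1 * tilt t x).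
apply: (rintegrable_le (g := g)).
- apply: measurable_funM; last exact: measurable_tilt.
  apply: measurable_fun_ifT => //; first exact: measurable_fun_ltr.
  exact: measurable_funX.
- move=> x; rewrite /g /core; case: ltP => [sa|sa]; last first.
    rewrite mul0r normr0 mulr0 add0r mul1r.
    exact: mulr_ge0 (mulr_ge0 (ler0n _ _) (sqr_ge0 _)) (tilt_ge0 _ _ _).
  rewrite ger0_norm; last exact: mulr_ge0 (sqr_ge0 _) (tilt_ge0 _ _ _).
  have sa4 : s x <= 1 / 4 by apply: le_trans a4; exact: ltW.
  have cw : c <= min_weight n K (s x).
    rewrite /min_weight -[leLHS]mulr1 ler_pM ?(ltW c0)//.
      rewrite /c ler_wpM2l// lerXn2r ?nnegrE ?divr_ge0//; lra.
    by rewrite -expR0 ler_expR.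
  have ta : tilt t x <= expR a.
    rewrite ler_expR; have : 0 <= t * s x by rewrite mulr_ge0// ltW.
    by rewrite mulrBl mul1r; lra.
  have h1 : (Y x - n%:R) ^+ 2 * tilt t x <=
      expR a * c^-1 * ((Y x - n%:R) ^+ 2 * min_weight n K (s x)).
    rewrite (_ : expR a * _ * _ = (Y x - n%:R) ^+ 2 *
      (expR a * (c^-1 * min_weight n K (s x)))); last by ring.
    rewrite ler_wpM2l ?sqr_ge0// (le_trans ta)// ler_peMr ?expR_ge0//.
    by rewrite mulrC ler_pdivlMr// mul1r.
  have h2 : Y x ^+ 2 <= 2 * (Y x - n%:R) ^+ 2 + 2 * n%:R ^+ 2.
    by rewrite -subr_ge0 (_ : _ - _ = (Y x - 2 * n%:R) ^+ 2) ?sqr_ge0//; ring.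
  apply: le_trans (ler_wpM2r (tilt_ge0 _ _ _) h2) _.
  rewrite mulrDl mul1r lerD2r -(mulrA 2).
  by rewrite (_ : expR a * 2 * _ * _ = 2 * (expR a * c^-1 * ((Y x - n%:R) ^+ 2 *
    min_weight n K (s x)))) ?ler_wpM2l//; ring.
- by apply: rintegrableD; apply: rintegrableZ => //; exact: (tempered_one ms lap).
Qed.

Section two_variables.
Variable Y : T -> R.
Hypothesis hY : tempered Y.
Hypothesis hub : forall t, 0 < t -> lapl Y t = t ^- K.-1.

(* AM-GM: [2 |Y| <= Y ^ 2 / t + t]. If [Y] were square integrable near [s = 0], taking
   the means against [t * tilt t] would give [2 <= o(1) + 1]. *)
Lemma core_risk_infinite (n : nat) : K = 2 -> (K <= n)%N -> core_risk n Y = +oo%E.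
Proof.
move=> KE Kn; apply/eqP; rewrite -leye_eq leNgt; apply/negP => fin.
have hZ := core_risk_tempered_square Kn hY fin; set Z := (fun x => _) in hZ.
have h1 := tempered_one ms lap.
have [C C0 hC] := tail_rapid ms a0 2 hY.
have : \forall N \near \oo, lapl Z N.+1%:R < 1 / 2.
  have /cvgrPdist_lt := lapl_cvg0 hZ => /(_ (1 / 2)).
  rewrite divr_gt0// => /(_ isT); apply: filterS => N.
  by rewrite sub0r normrN; exact: le_lt_trans (ler_norm _).
move=> near1.
have : \forall N \near \oo, 4 * C + 3 <= N%:R :> R.
  exact: nbhs_infty_ger.
move=> near2; near \oo => N.
have N1 : lapl Z N.+1%:R < 1 / 2 by near: N.
have N2 : 4 * C + 3 <= N%:R by near: N.
pose t : R := N.+1%:R.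
have tC : 4 * C + 3 <= t by rewrite /t -natr1; lra.
have t0 : 0 < t by lra.
have tailC : t * tail Y t <= 1 / 4.
  have := hC t; rewrite expr2 -mulrA => /(_ _) h.
  have : t * (t * tail Y t) <= C by apply: h; lra.
  by rewrite -ler_pdivlMl// => /le_trans; apply; rewrite mulrC ler_pdivrMr//; lra.
have it : rintegrable mu (fun x => if a <= s x then `|Y x| * tilt t x else 0).
  exact: tail_rintegrable.
have hle : lapl Y t <= mean mu (fun x => (1 / (2 * t) * (Z x * tilt t x) +
    t / 2 * (1 * tilt t x)) + (if a <= s x then `|Y x| * tilt t x else 0)).
  apply: mean_le; [exact: hY| |].
    apply: rintegrableD => //; apply: rintegrableD; apply: rintegrableZ.
      exact: hZ.
    exact: h1.
  move=> x; have tx := tilt_ge0 s t x; rewrite /Z; case: ltP => sa; last first.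
    rewrite mul0r mulr0 add0r mul1r (le_trans (ler_wpM2r tx (ler_norm _)))//.
    by rewrite lerDr mulr_ge0// divr_ge0// ltW.
  rewrite addr0 mul1r [leRHS](_ : _ = (1 / (2 * t) * Y x ^+ 2 + t / 2) * tilt t x); last by ring.
  rewrite ler_wpM2r// -subr_ge0.
  rewrite (_ : _ - _ = (Y x - t) ^+ 2 / (2 * t)); last by field; rewrite gt_eqF.
  by rewrite divr_ge0 ?sqr_ge0// mulr_ge0// ltW.
have iZ := hZ _ t0; have i1 := h1 _ t0.
move: hle; rewrite meanD//; last by apply: rintegrableD; exact: rintegrableZ.
rewrite meanD; [|exact: rintegrableZ|exact: rintegrableZ].
rewrite (meanZ _ iZ) (meanZ _ i1) -/(lapl Z t) -/(lapl (fun=> 1) t) (lapl_one lap)//.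
rewrite hub// KE expr1 -/(tail Y t) => hle.
(* As [K = 2], this reads [1 <= lapl Z t / 2 + 1 / 2 + t * tail Y t], whose right side is less than
   [1 / 4 + 1 / 2 + 1 / 4]. *)
have := ler_wpM2l (ltW t0) hle.
rewrite mulrDr (_ : t * t^-1 = 1) ?divff ?gt_eqF//.
rewrite (_ : t * (_ + _) = lapl Z t / 2 + 1 / 2); last first.
  by field; rewrite gt_eqF.
by move: N1; rewrite -/t; lra.
Unshelve. all: by end_near. Qed.

(* [lapl (Y / s)] is determined by its derivative [- lapl Y] and its limit 0. *)
Lemma lapl_div (t : R) : (3 <= K)%N -> tempered (fun x => Y x / s x) -> 0 < t ->
  lapl (fun x => Y x / s x) t = 1 / K.-2%:R * t ^- K.-2.
Proof.
clear a0 a4; move=> K3 hZ t0; pose Z x := Y x / s x.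
pose phi (r : R) := lapl Z r - 1 / K.-2%:R * r ^- K.-2.
have K20 : K.-2%:R != 0 :> R by rewrite pnatr_eq0; lia.
have KE : K.-2.+1 = K.-1 by lia.
have dphi (r : R) : 0 < r -> is_derive r 1 phi 0.
  move=> r0; have dZ := lapl_is_derive ms s0 hZ r0.
  have sZ : lapl (fun x => s x * (Y x / s x)) r = r ^- K.-1.
    rewrite -hub//; apply: lapl_ae_eq => //; first exact: tempered_mul.
    by move=> x sx; field; rewrite gt_eqF.
  have dp := is_derive_negpow K.-2 r0.
  rewrite /phi; apply: is_derive_eq.
  by rewrite /GRing.scale/= sZ KE; field; rewrite K20 expf_neq0 // gt_eqF.
have incr (x y : R) : 0 < x -> x < y -> phi x = phi y.
  move=> x0 xy; have [||c _] := @MVT _ phi (cst 0) x y xy.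
  - move=> z; rewrite in_itv/= => /andP[xz _]; apply: dphi; exact: lt_trans xz.
  - apply: continuous_in_subspaceT => z; rewrite inE /= in_itv/= => /andP[xz _].
    apply: differentiable_continuous; apply/derivable1_diffP.
    by have [] := dphi z (lt_le_trans x0 xz).
  - by rewrite /= mul0r => /eqP; rewrite subr_eq0 => /eqP.
have constant (r : R) : 0 < r -> phi r = phi t.
  by move=> r0; have [rt|tr|->//] := ltgtP r t; [|apply/esym]; exact: incr.
have cphi : phi n.+1%:R @[n --> \oo] --> (0 - 1 / K.-2%:R * 0 : R).
  apply: cvgB; first exact: lapl_cvg0.
  apply: cvgMr; apply/cvgrPdist_le => e e0; near=> n.
  rewrite sub0r normrN ger0_norm ?invr_ge0 ?exprn_ge0//.
  have en : e^-1 <= n.+1%:R.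
    rewrite -natr1 (@le_trans _ _ n%:R) ?lerDl//.
    by near: n; exact: nbhs_infty_ger.
  rewrite -[leRHS]invrK lef_pV2 ?posrE ?exprn_gt0 ?invr_gt0//.
  rewrite (le_trans en)// -(_ : K.-2.-1.+1 = K.-2); last by lia.
  by rewrite exprS ler_peMr// exprn_ege1// ler1n.
have phiE : (fun n => phi n.+1%:R) = cst (phi t).
  by apply/funext => n; apply: constant; rewrite ltr0n.
move: cphi; rewrite phiE mulr0 subr0 => /(cvg_unique (@norm_hausdorff _ _)).
move=> /(_ _ (cvg_cst _)) /esym/eqP.
by rewrite subr_eq0 => /eqP.
Unshelve. all: by end_near. Qed.

End two_variables.

End unbiased.

Section unbiased_risk.
Context d (T : measurableType d) (R : realType) (mu : probability T R).
Variables (s : T -> R) (K : nat) (a : R).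
Hypotheses (ms : measurable_fun setT s) (s0 : forall x, 0 <= s x).
Hypothesis spos : {ae mu, forall x, 0 < s x}.
Hypothesis K3 : (3 <= K)%N.
Hypothesis lap : forall t, 0 < t ->
  (\int[mu]_x (tilt s t x)%:E = (t ^- K)%:E)%E.
Hypotheses (a0 : 0 < a) (a4 : a <= 1 / 4).

Local Notation tilt := (tilt s).
Local Notation tempered := (tempered mu s).
Local Notation lapl := (lapl mu s).
Local Notation tail := (tail mu s a).
Local Notation core_risk := (core_risk mu s K a).

Let K2 : (2 <= K)%N. Proof. exact: ltnW. Qed.
Let k1 : K.-1%:R = K.-2%:R + 1 :> R. Proof. by rewrite natr1; congr _%:R; lia. Qed.
Let k2 : 0 < K.-2%:R :> R. Proof. by rewrite ltr0n; lia. Qed.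
Let tK1 (t : R) : t ^+ K = t * t ^+ K.-1. Proof. by rewrite -exprS; congr (_ ^+ _); lia. Qed.
Let tK2 (t : R) : t ^+ K.-1 = t * t ^+ K.-2. Proof. by rewrite -exprS; congr (_ ^+ _); lia. Qed.

Section lower_bound.
Variable Y : T -> R.
Hypothesis hY : tempered Y.
Hypothesis hub : forall t, 0 < t -> lapl Y t = t ^- K.-1.

(** On [s < a], the quotient is bounded by [Y ^+ 2 + 1 / s ^+ 2], where the first term is integrable
    because the risk is finite and the second because [K >= 3]. On [s >= a] it is at most [a^-1]
    times the absolute value of [Y]. *)
Lemma tempered_div (n : nat) : (K <= n)%N -> (core_risk n Y < +oo)%E ->
  tempered (fun x => Y x / s x).
Proof.
move=> Kn fin; have mY := tempered_measurable hY.
have hZ := core_risk_tempered_square ms s0 lap a4 Kn hY fin.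
have hW := temperedD (temperedD hZ (tempered_inv2 ms s0 spos K2 lap K3))
  (temperedZ a^-1 (tempered_norm hY)).
apply: (tempered_dominated ms _ hW) => [|x]; first exact: measurable_divs.
have a' := a0.
rewrite normrM normfV (ger0_norm (s0 x)); case: ltP => sa.
  rewrite (@le_trans _ _ (Y x ^+ 2 + 1 / s x / s x))//; last first.
    by rewrite lerDl mulr_ge0// invr_ge0 ltW.
  rewrite -(real_normK (num_real (Y x))) mul1r.
  have := sqr_ge0 (`|Y x| - (s x)^-1 / 2); have := sqr_ge0 (s x)^-1; nra.
rewrite (@le_trans _ _ (a^-1 * `|Y x|))//; last first.
  by rewrite lerDr add0r !mulr_ge0// invr_ge0.
by rewrite mulrC ler_wpM2r// lef_pV2 ?posrE// (lt_le_trans a').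
Qed.

(** Takes for [h] the error of [(K - 1) / s] in [core_risk_ge]. Unbiasedness makes the mean of
    [(Y - n) * h] at rate [n] equal to that of [h ^+ 2], namely [n ^+ 2 / (K - 2)], so the scale 1
    is optimal. *)
Lemma core_risk_unbiased_ge : exists C : R, exists N : nat, forall n, (N <= n)%N ->
  ((n%:R ^+ 2 / K.-2%:R - C * n%:R)%:E <= core_risk n Y)%E.
Proof.
have h1 := tempered_one ms lap.
have hI := tempered_inv ms s0 spos K2 lap.
have hI2 := tempered_inv2 ms s0 spos K2 lap K3.
have hY1 : tempered (fun x => `|Y x| + 1) by exact: temperedD (tempered_norm hY) h1.
have [C1 C10 hC1] := tail_rapid ms a0 K.+2 hY1.
(* In absolute value [h * s] is at most [K + n * s], and [(n * s) ^+ 2 <= 32 * expR (n * s / 4)];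
   hence [2 * K ^+ 2 + 2 * 32]. *)
pose H : R := 2 * K%:R ^+ 2 + 64.
have H0 : 0 <= H by rewrite addr_ge0// mulr_ge0// exprn_ge0.
pose kk : R := (K * K)%:R.
(* The three terms stem from the relative error [2 * kk / n] on the variance, from the correction in
   [H], whose prefactor [1 + 2 * kk / n] is at most 2, and from the tail. *)
exists (2 * kk / K.-2%:R + 4 * H * 4 ^+ K + 2 * ((K%:R / a + 1) * C1)).
exists (maxn 3 (maxn K (2 * (K * K)))) => n.
rewrite !geq_max => /and3P[n3 Kn Kn2].
(* An infinite risk satisfies any lower bound; a finite one makes [Y / s] tempered, as the moments
   below require. *)
have [fin|] := ltP (core_risk n Y) +oo%E; last first.
  by rewrite leye_eq => /eqP ->; exact: leey.
have hYs := tempered_div Kn fin.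
have n0 : (0 < n)%N by exact: leq_trans n3.
have n0' : 0 < n%:R :> R by rewrite ltr0n.
have n1 : 1 <= n%:R :> R by rewrite ler1n.
pose h x := K.-1%:R * (1 / s x) - n%:R.
have hAhE : (fun x => (Y x - n%:R) * h x) = (fun x =>
    (K.-1%:R * (Y x / s x) - n%:R * K.-1%:R * (1 / s x)) -
    (n%:R * Y x - n%:R ^+ 2 * 1)).
  by apply/funext => x; rewrite /h; ring.
have hhE : (fun x => h x ^+ 2) = (fun x =>
    (K.-1%:R ^+ 2 * (1 / s x / s x) - 2 * n%:R * K.-1%:R * (1 / s x)) +
    n%:R ^+ 2 * 1).
  by apply/funext => x; rewrite /h; ring.
have hAh : tempered (fun x => (Y x - n%:R) * h x).
  by rewrite hAhE; apply: temperedB; apply: temperedB; apply: temperedZ.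
have hh : tempered (fun x => h x ^+ 2).
  by rewrite hhE; apply: temperedD; [apply: temperedB|]; apply: temperedZ.
have hH x : h x ^+ 2 * s x ^+ 2 * expR (n%:R * s x / 2) <=
    H * expR (3 / 4 * n%:R * s x).
  have q0 : 0 <= n%:R * s x / 4 by rewrite divr_ge0// mulr_ge0.
  rewrite (_ : 3 / 4 * n%:R * s x = n%:R * s x / 4 + n%:R * s x / 2); last by field.
  rewrite expRD [leRHS]mulrA ler_wpM2r ?expR_ge0//.
  have e1 : 1 <= expR (n%:R * s x / 4) by rewrite (le_trans _ (expR_ge1Dx _))// lerDl.
  have e2 : (n%:R * s x) ^+ 2 <= 32 * expR (n%:R * s x / 4).
    have := expR_ge_pow 2 q0; rewrite (_ : 2`! = 2)%N// => q2.
    rewrite (_ : (n%:R * s x) ^+ 2 = 16 * (n%:R * s x / 4) ^+ 2); last by field.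
    by lra.
  have e3 : h x ^+ 2 * s x ^+ 2 <= 2 * K%:R ^+ 2 + 2 * (n%:R * s x) ^+ 2.
    rewrite -exprMn /h mulrBl; set v := _ * (1 / s x) * s x.
    have v0 : 0 <= v by rewrite /v div1r !mulr_ge0 ?invr_ge0.
    have vK : v <= K%:R.
      rewrite /v -mulrA mul1r; have [->|sx] := eqVneq (s x) 0.
        by rewrite mulr0 mulr0.
      by rewrite mulVf// mulr1 ler_nat leq_pred.
    have v2 : v ^+ 2 <= K%:R ^+ 2 by rewrite lerXn2r ?nnegrE.
    have := sqr_ge0 (v + n%:R * s x); nra.
  have e4 : 2 * K%:R ^+ 2 <= 2 * K%:R ^+ 2 * expR (n%:R * s x / 4).
    by rewrite ler_peMr// mulr_ge0// exprn_ge0.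
  by rewrite (le_trans e3)// /H [leRHS]mulrDl lerD//; lra.
have := core_risk_ge ms s0 lap a4 1 n0 Kn2 Kn hY hAh hh hH.
have nK : n%:R ^+ K.-2 != 0 :> R by rewrite expf_neq0// gt_eqF.
have Is : n%:R ^+ K * lapl (fun x => (Y x - n%:R) * h x) n%:R = n%:R ^+ 2 / K.-2%:R.
  rewrite hAhE laplB//; [|by apply: temperedB; apply: temperedZ..].
  rewrite laplB//; [|by apply: temperedZ..].
  rewrite laplB//; [|by apply: temperedZ..].
  rewrite (laplZ _ hYs n0') (laplZ _ hI n0') (laplZ _ hY n0') (laplZ _ h1 n0').
  rewrite (lapl_inv ms s0 spos K2 lap)// (lapl_one lap)// hub//.
  rewrite (lapl_div ms s0 spos K2 hY hub K3 hYs)//.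
  by rewrite tK1 tK2 k1; field; rewrite nK !gt_eqF// ltr_wpDl.
have Vs : n%:R ^+ K * lapl (fun x => h x ^+ 2) n%:R = n%:R ^+ 2 / K.-2%:R.
  rewrite hhE laplD//; [|by apply: temperedB; apply: temperedZ|exact: temperedZ].
  rewrite laplB//; [|by apply: temperedZ..].
  rewrite (laplZ _ hI2 n0') (laplZ _ hI n0') (laplZ _ h1 n0').
  rewrite (lapl_inv ms s0 spos K2 lap)// (lapl_one lap)//.
  rewrite (lapl_inv2 ms s0 spos K2 lap K3)//.
  by rewrite tK1 tK2 k1; field; rewrite nK !gt_eqF// ltr_wpDl.
rewrite Is Vs; apply: le_trans; rewrite lee_fin.
have tl : n%:R ^+ K * tail (fun x => (Y x - n%:R) * h x) n%:R <= (K%:R / a + 1) * C1.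
  have Ka0 : 0 <= K%:R / a + 1 by rewrite addr_ge0// divr_ge0// ltW.
  apply: (@le_trans _ _ (n%:R ^+ K * (n%:R ^+ 2 * (K%:R / a + 1) *
      tail (fun x => `|Y x| + 1) n%:R))).
    rewrite ler_wpM2l ?exprn_ge0//; apply: (tail_le_tail ms) => // x sa.
    have sx : 0 < s x by exact: lt_le_trans sa.
    rewrite normrM (ger0_norm (addr_ge0 (normr_ge0 _) ler01)).
    rewrite (_ : n%:R ^+ 2 * _ * _ = (n%:R * (`|Y x| + 1)) * (n%:R * (K%:R / a + 1))); last by ring.
    rewrite ler_pM//.
      rewrite (le_trans (ler_normB _ _))// (ger0_norm (ltW n0')).
      by rewrite mulrDr mulr1 lerD2r ler_peMl.
    rewrite /h (le_trans (ler_normB _ _))// (ger0_norm (ltW n0')) mulrDr mulr1 lerD2r.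
    rewrite div1r ger0_norm ?mulr_ge0 ?invr_ge0// (@le_trans _ _ (K%:R / a))//.
      rewrite ler_pM ?invr_ge0// ?ler_nat ?leq_pred//.
      by rewrite lef_pV2 ?posrE// (lt_le_trans a0).
    by rewrite ler_peMl// divr_ge0// ltW.
  rewrite [leLHS](_ : _ = (K%:R / a + 1) * (n%:R ^+ K.+2 * tail (fun x => `|Y x| + 1) n%:R)); last first.
    by rewrite !exprS; ring.
  by rewrite ler_wpM2l// hC1// ler_nat.
have kn : 2 * kk <= n%:R by rewrite -natrM ler_nat.
have kk0 : 0 <= kk by exact: ler0n.
have HK : 0 <= H * 4 ^+ K by rewrite mulr_ge0// exprn_ge0.
rewrite normr1 expr1n mul1r !mulr1.
set X := n%:R ^+ K * tail _ _ in tl *.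
have cx : 0 <= (K%:R / a + 1) * C1.
  by apply: le_trans tl; rewrite mulr_ge0 ?tail_ge0// exprn_ge0.
rewrite [leRHS](_ : _ = n%:R ^+ 2 / K.-2%:R - 2 * X - 2 * kk / K.-2%:R * n%:R
   - (1 + 2 * kk / n%:R) * (2 * n%:R * (H * 4 ^+ K))); last first.
  by field; rewrite !gt_eqF.
have z1 : (1 + 2 * kk / n%:R) * (2 * n%:R * (H * 4 ^+ K)) <= 2 * (2 * n%:R * (H * 4 ^+ K)).
  rewrite ler_wpM2r// ?mulr_ge0//.
  by rewrite -lerBrDl ler_pdivrMr//; lra.
have z2 : 2 * X <= 2 * ((K%:R / a + 1) * C1) * n%:R.
  by rewrite -mulrA ler_wpM2l// (le_trans tl)// ler_peMr.
rewrite (mulrDl _ _ n%:R) (mulrDl _ _ n%:R).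
have -> : 4 * H * 4 ^+ K * n%:R = 2 * (2 * n%:R * (H * 4 ^+ K)) by ring.
lra.
Qed.

End lower_bound.
End unbiased_risk.

(** * The risk of the inverse sum *)

Section inverse_sum_risk.
Context d (T : measurableType d) (R : realType) (mu : probability T R).
Variables (s : T -> R) (K : nat) (a : R).
Hypotheses (ms : measurable_fun setT s) (s0 : forall x, 0 <= s x).
Hypothesis spos : {ae mu, forall x, 0 < s x}.
Hypothesis K3 : (3 <= K)%N.
Hypothesis lap : forall t, 0 < t ->
  (\int[mu]_x (tilt s t x)%:E = (t ^- K)%:E)%E.
Hypotheses (a0 : 0 < a) (a4 : a <= 1 / 4).

Local Notation tilt := (tilt s).
Local Notation tempered := (tempered mu s).
Local Notation lapl := (lapl mu s).
Local Notation tail := (tail mu s a).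
Local Notation core_risk := (core_risk mu s K a).

Let K2 : (2 <= K)%N. Proof. exact: ltnW. Qed.
Let k0 : 0 < K%:R :> R. Proof. by rewrite ltr0n (leq_trans _ K2). Qed.
Let k1 : K.-1%:R = K.-2%:R + 1 :> R. Proof. by rewrite natr1; congr _%:R; lia. Qed.
Let k2 : 0 < K.-2%:R :> R. Proof. by rewrite ltr0n; lia. Qed.
Let tK1 (t : R) : t ^+ K = t * t ^+ K.-1. Proof. by rewrite -exprS; congr (_ ^+ _); lia. Qed.
Let tK2 (t : R) : t ^+ K.-1 = t * t ^+ K.-2. Proof. by rewrite -exprS; congr (_ ^+ _); lia. Qed.

(* The squared error of [n + 1] is 1, so this bounds the mass of [s < a] under the law
   of the minima. *)
Lemma core_mass_ge : exists C : R, exists N : nat, forall n, (N <= n)%N ->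
  ((1 - C / n%:R)%:E <= core_risk n (fun=> (n%:R + 1)%R))%E.
Proof.
have h1 := tempered_one ms lap.
have [C1 C10 hC1] := tail_rapid ms a0 K.+1 h1.
(* In [core_risk_ge] take [h = 1] and [t = 1]. Then [A / n] is the relative error on the weight, and
   [B / n] is the correction [2 * n * H * 4 ^+ K] with [H = 32 / n ^+ 2]. *)
pose A : R := 2 * (K * K)%:R; pose B : R := 64 * 4 ^+ K.
have A0 : 0 <= A by rewrite mulr_ge0.
have B0 : 0 <= B by rewrite mulr_ge0// exprn_ge0.
exists (A + B + A * B + 2 * C1), (maxn 3 (maxn K (2 * (K * K)))) => n.
rewrite !geq_max => /and3P[n3 Kn Kn2].
have n0 : (0 < n)%N by exact: leq_trans n3.
have n0' : 0 < n%:R :> R by rewrite ltr0n.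
have n1 : 1 <= n%:R :> R by rewrite ler1n.
have hE (c : R) : (fun x : T => (n%:R + 1 - n%:R) * c) = (fun=> c).
  by apply/funext => x; ring.
have h11 : tempered (fun=> 1 ^+ 2) by rewrite expr1n.
have hAh : tempered (fun=> (n%:R + 1 - n%:R) * 1) by rewrite hE.
have hH x : 1 ^+ 2 * s x ^+ 2 * expR (n%:R * s x / 2) <=
    32 / n%:R ^+ 2 * expR (3 / 4 * n%:R * s x).
  have q0 : 0 <= n%:R * s x / 4 by rewrite divr_ge0// mulr_ge0.
  rewrite (_ : 3 / 4 * n%:R * s x = n%:R * s x / 4 + n%:R * s x / 2); last by field.
  rewrite expRD [leRHS]mulrA ler_wpM2r ?expR_ge0// expr1n mul1r.
  rewrite mulrAC ler_pdivlMr ?exprn_gt0//.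
  have := expR_ge_pow 2 q0; rewrite (_ : 2`! = 2)%N// => q2.
  by rewrite (_ : s x ^+ 2 * _ = 16 * (n%:R * s x / 4) ^+ 2); [lra|field].
have := core_risk_ge ms s0 lap a4 1 n0 Kn2 Kn (tempered_cst ms lap _) hAh h11 hH.
apply: le_trans; rewrite lee_fin hE !expr1n !(lapl_one lap)// normr1 !mulr1 mul1r.
have nK : n%:R ^+ K != 0 :> R by rewrite expf_neq0// gt_eqF.
rewrite divff//; set X := n%:R ^+ K * tail _ _.
have tl : X <= C1 / n%:R.
  rewrite ler_pdivlMr// (le_trans _ (hC1 n%:R _)) ?ler_nat// /X exprS.
  by rewrite mulrC mulrA.
rewrite [X in _ <= _ - X](_ : _ = (1 + A / n%:R) * (1 + B / n%:R)); last first.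
  by rewrite /A /B; field; rewrite gt_eqF.
have z : (1 + A / n%:R) * (1 + B / n%:R) <= 1 + (A + B + A * B) / n%:R.
  rewrite (_ : _ * _ = 1 + (A + B + A * B / n%:R) / n%:R); last first.
    by field; rewrite gt_eqF.
  rewrite lerD2l ler_pM2r ?invr_gt0// lerD2l ler_pdivrMr// ler_peMr// mulr_ge0//.
rewrite mulrDl -mulrA in z *; lra.
Qed.

(** By convexity, the power lies below its chord between 0 and 1. *)
Lemma exprDn_le_linear (x : R) (q : nat) : 0 <= x -> x <= 1 ->
  (1 + x) ^+ q <= 1 + x * (2 ^+ q - 1).
Proof.
move=> x0 x1; elim: q => [|q IH]; first by rewrite !expr0 subrr mulr0 addr0.
have c0 : 0 <= 2 ^+ q - 1 :> R by rewrite subr_ge0 exprn_ege1// ler1n.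
rewrite exprS [2 ^+ q.+1]exprS; set c := 2 ^+ q - 1 in c0 IH *.
have -> : 2 * 2 ^+ q - 1 = 2 * c + 1 :> R by rewrite /c; ring.
apply: (@le_trans _ _ ((1 + x) * (1 + x * c))).
  by rewrite ler_wpM2l// addr_ge0.
have : 0 <= x * c * (1 - x) by rewrite !mulr_ge0// subr_ge0.
by lra.
Qed.

(** By [min_weight_le], the weight is at most [n ^+ K] times the tilt at rate [r = n - K]. At that
    rate [(K - 1) / s] has variance [r ^+ 2 / (K - 2)] and its mean [r] misses [n] by [K], while the
    factor [(n / r) ^+ K] is [1 + O(1 / n)]. *)
Lemma core_risk_inverse_le : exists C : R, exists N : nat, forall n, (N <= n)%N ->
  (core_risk n (fun x => (K.-1%:R / s x)%R) <= (n%:R ^+ 2 / K.-2%:R + C * n%:R)%:E)%E.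
Proof.
have h1 := tempered_one ms lap.
have hI := tempered_inv ms s0 spos K2 lap.
have hI2 := tempered_inv2 ms s0 spos K2 lap K3.
pose A : R := 2 * K%:R * 2 ^+ K.
have A0 : 0 <= A by rewrite !mulr_ge0// exprn_ge0.
exists (K%:R ^+ 2 + A / K.-2%:R + A * K%:R ^+ 2), (2 * K)%N => n Kn.
have n0 : (0 < n)%N by apply: leq_trans Kn; rewrite muln_gt0//; lia.
have n0' : 0 < n%:R :> R by rewrite ltr0n.
have n1 : 1 <= n%:R :> R by rewrite ler1n.
have Kn' : 2 * K%:R <= n%:R :> R by rewrite -natrM ler_nat.
pose r : R := n%:R - K%:R.
have r0 : 0 < r by have := k0; rewrite /r; lra.
pose h x := K.-1%:R * (1 / s x) - n%:R.
have hhE : (fun x => h x ^+ 2) = (fun x =>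
    (K.-1%:R ^+ 2 * (1 / s x / s x) - 2 * n%:R * K.-1%:R * (1 / s x)) +
    n%:R ^+ 2 * 1).
  by apply/funext => x; rewrite /h; ring.
have hh : tempered (fun x => h x ^+ 2).
  by rewrite hhE; apply: temperedD; [apply: temperedB|]; apply: temperedZ.
have rK : r ^+ K.-2 != 0 by rewrite expf_neq0// gt_eqF.
have Vs : n%:R ^+ K * lapl (fun x => h x ^+ 2) r =
    (n%:R / r) ^+ K * (r ^+ 2 / K.-2%:R + K%:R ^+ 2).
  rewrite hhE laplD//; [|by apply: temperedB; apply: temperedZ|exact: temperedZ].
  rewrite laplB//; [|by apply: temperedZ..].
  rewrite (laplZ _ hI2 r0) (laplZ _ hI r0) (laplZ _ h1 r0).
  rewrite (lapl_inv ms s0 spos K2 lap)// (lapl_one lap)//.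
  rewrite (lapl_inv2 ms s0 spos K2 lap K3)// expr_div_n.
  have -> : K%:R = n%:R - r by rewrite /r; ring.
  by rewrite (tK1 r) (tK2 r) k1; field; rewrite rK !gt_eqF// ltr_wpDl.
apply: (@le_trans _ _ (n%:R ^+ K * lapl (fun x => h x ^+ 2) r)%:E).
  rewrite /lapl -meanZ; last exact: hh.
  rewrite EFin_mean; last exact/rintegrableZ/hh.
  apply: ge0_le_integral => //.
  - move=> x _; rewrite lee_fin.
    exact: (core_ge0 s K a4 n (fun x => K.-1%:R / s x) x).
  - apply/measurable_EFinP.
    have mI : measurable_fun setT (fun x => K.-1%:R / s x) by exact: measurable_divs.
    exact: (measurable_core K a ms n mI).
  - apply/measurable_EFinP/rintegrable_measurable; exact/rintegrableZ/hh.
  - move=> x _; rewrite lee_fin.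
    have g0 : 0 <= n%:R ^+ K * (h x ^+ 2 * tilt r x).
      exact: mulr_ge0 (exprn_ge0 _ (ltW n0')) (mulr_ge0 (sqr_ge0 _) (tilt_ge0 _ _ _)).
    case: ltP => // sa; rewrite [leRHS]mulrCA.
    have -> : K.-1%:R / s x - n%:R = h x by rewrite /h div1r.
    rewrite ler_wpM2l ?sqr_ge0//.
    have := @min_weight_le R n K (s x) (s0 x) _ _; rewrite -mulrA -expRD.
    rewrite (_ : - ((n%:R - 1) * s x) + K%:R * s x = - ((r - 1) * s x)); last first.
      by rewrite /r; ring.
    by apply; [have := a4; lra|lia].
rewrite Vs lee_fin.
have nr : n%:R / r = 1 + K%:R / r by rewrite /r; field; rewrite gt_eqF.
have x0 : 0 <= K%:R / r by rewrite divr_ge0// ltW.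
have xn : K%:R / r <= 2 * K%:R / n%:R.
  rewrite ler_pdivrMr// mulrAC ler_pdivlMr//.
  rewrite (_ : 2 * K%:R * r = K%:R * (2 * r)); last by ring.
  by rewrite ler_wpM2l// /r; lra.
have x1 : K%:R / r <= 1 by rewrite ler_pdivrMr// mul1r /r; lra.
have nrK : (n%:R / r) ^+ K <= 1 + A / n%:R.
  rewrite nr (le_trans (exprDn_le_linear K x0 x1))// lerD2l.
  rewrite /A [leRHS]mulrAC; apply: ler_pM => //.
    by rewrite subr_ge0 exprn_ege1// ler1n.
  by rewrite lerBlDr lerDl.
have rn2 : r ^+ 2 <= n%:R ^+ 2 by rewrite lerXn2r ?nnegrE ?(ltW r0)// /r lerBlDr lerDl.
have Q0 : 0 <= n%:R ^+ 2 / K.-2%:R + K%:R ^+ 2 :> R.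
  by rewrite addr_ge0 ?exprn_ge0// divr_ge0// exprn_ge0.
apply: (@le_trans _ _ ((1 + A / n%:R) * (n%:R ^+ 2 / K.-2%:R + K%:R ^+ 2))).
  apply: ler_pM => //.
  - by rewrite exprn_ge0// divr_ge0// ltW.
  - by rewrite addr_ge0 ?exprn_ge0// divr_ge0// exprn_ge0// ltW.
  - by rewrite lerD2r ler_pM2r ?invr_gt0.
rewrite [leLHS](_ : _ = n%:R ^+ 2 / K.-2%:R + A / K.-2%:R * n%:R +
  (K%:R ^+ 2 + A * K%:R ^+ 2 / n%:R)); last by field; rewrite !gt_eqF.
have y1 : K%:R ^+ 2 <= K%:R ^+ 2 * n%:R :> R by rewrite ler_peMr// exprn_ge0.
have y2 : A * K%:R ^+ 2 / n%:R <= A * K%:R ^+ 2 * n%:R.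
  have q : 0 <= A * K%:R ^+ 2 by rewrite mulr_ge0// exprn_ge0.
  by rewrite ler_wpM2l// (le_trans _ n1)// invf_le1.
by rewrite (mulrDl _ _ n%:R) (mulrDl _ _ n%:R); lra.
Qed.

End inverse_sum_risk.

(** * From the Gamma model to the minima *)

Section gamma_model.
Context (R : realType) (k m : nat).
Hypotheses (hk : (2 <= k)%N) (hm : (1 <= m)%N).
Context d (T : measurableType d) (Q : R -> probability T R).
Variable G : forall theta : R, 'I_m -> {RV (Q theta) >-> R}.
Hypothesis hG : forall theta : R, 0 < theta -> gamma_sample k theta (G theta).

Let mu := Q 1.

Definition gamma_sum (w : T) : R := \sum_(i < m) `|G 1 i w|.

Local Notation tempered := (tempered mu gamma_sum).
Local Notation lapl := (lapl mu gamma_sum).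

Lemma measurable_gamma_sum : measurable_fun setT gamma_sum.
Proof. by apply: measurable_sum => i; exact: measurableT_comp. Qed.

Lemma gamma_sum_ge0 w : 0 <= gamma_sum w.
Proof. exact: sumr_ge0. Qed.

Lemma gamma_ae_pos : {ae mu, forall w, forall i, 0 < G 1 i w}.
Proof.
apply: filter_forall => i.
have mE : measurable [set w | ~ 0 < G 1 i w].
  have mG : measurable_fun setT (G 1 i) by exact: measurable_funP.
  have := mG measurableT `]-oo, 0]%classic.
  rewrite setTI => /(_ (measurable_itv _)); congr measurable.
  by apply/seteqP; split => w; rewrite /= in_itv/= leNgt => /negP.
exists [set w | ~ 0 < G 1 i w]; split => //.
have [_ /(_ i `]-oo, 0]%classic (measurable_itv _))] := hG ltr01.
rewrite /distribution /pushforward /= => h.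
transitivity (Q 1 (G 1 i @^-1` `]-oo, 0]%classic)).
  by congr (Q 1 _); apply/seteqP; split => w; rewrite /= in_itv/= leNgt => /negP.
rewrite h; apply: integral0_eq => t; rewrite /= in_itv/= => t0.
rewrite /gamma_pdf; case: ifPn => // t0'.
have -> : t = 0 by apply/eqP; rewrite eq_le t0.
by rewrite expr0n (_ : k.-1 == 0%N = false) ?mul0r//; apply/eqP; lia.
Qed.

Lemma gamma_sum_ae_pos : {ae mu, forall w, 0 < gamma_sum w}.
Proof.
apply: filterS gamma_ae_pos => w w0.
rewrite /gamma_sum (bigD1 (Ordinal hm))//= ltr_pwDl ?normr_gt0 ?gt_eqF//.
exact: sumr_ge0.
Qed.

(** The total mass at rate [t] is 1, and [gamma_change_of_rate] expresses it at rate 1. *)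
Lemma gamma_sum_laplace t : 0 < t ->
  (\int[mu]_w (tilt gamma_sum t w)%:E = (t ^- (k * m))%:E)%E.
Proof.
move=> t0; have tK : 0 < t ^+ (k * m) by rewrite exprn_gt0.
have := gamma_change_of_rate t0 (hG t0) (hG ltr01) (F := cst 1%E) (measurable_cst _).
move=> /(_ (fun _ => lee01)).
rewrite integral_cst//= probability_setT mul1e.
under [X in _ = X -> _]eq_integral do rewrite mul1e EFinM.
rewrite ge0_integralZl//; first last.
- by rewrite lee_fin ltW.
- apply/measurable_EFinP; apply: measurable_tilt; exact: measurable_gamma_sum.
move=> h; rewrite -[LHS]mul1e -(mulVf (lt0r_neq0 tK)) EFinM -muleA.
by rewrite -h mule1.
Qed.

Section estimator.
Variable f : fspace 'I_m R -> R.
Hypothesis mf : measurable_fun setT f.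

Let Y w := f (rvec (G 1) w).

Lemma measurable_estimator : measurable_fun setT Y.
Proof. exact: measurableT_comp mf (measurable_rvec _). Qed.

Lemma tempered_estimator :
  (forall theta, 0 < theta -> rintegrable (Q theta) (fun w => f (rvec (G theta) w))) ->
  tempered Y.
Proof.
move=> hf t t0; have tK : 0 < t ^+ (k * m) by rewrite exprn_gt0.
have mY : measurable_fun setT (fun w => Y w * tilt gamma_sum t w).
  apply: measurable_funM; first exact: measurable_estimator.
  by apply: measurable_tilt; exact: measurable_gamma_sum.
apply/integrableP; split; first exact/measurable_EFinP.
have /integrableP[_] := hf _ t0.
have mn : measurable_fun setT (fun u => (`|f u|)%:E : \bar R).
  by apply/measurable_EFinP; exact: measurableT_comp.
rewrite (gamma_change_of_rate t0 (hG t0) (hG ltr01) mn)//.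
under eq_integral do rewrite -EFinM mulrCA EFinM.
rewrite ge0_integralZl//; first last.
- by rewrite lee_fin ltW.
- apply/measurable_EFinP; apply: measurable_funM.
    by apply: measurableT_comp => //; exact: measurable_estimator.
  by apply: measurable_tilt; exact: measurable_gamma_sum.
under [X in _ -> (X < _)%E]eq_integral do rewrite /= normrM (ger0_norm (tilt_ge0 _ _ _)).
rewrite -[X in (_ < X)%E -> _](gt0_mulye (x := (t ^+ (k * m))%:E)) ?lte_fin//.
by rewrite muleC lte_pmul2r// ?lte_fin.
Qed.

End estimator.

Lemma mean_gamma_ge0 (f : fspace 'I_m R -> R) theta :
  measurable_fun setT f -> (forall u, 0 <= f u) -> 0 < theta ->
  tempered (fun w => f (rvec (G 1) w)) ->
  mean (Q theta) (fun w => f (rvec (G theta) w)) =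
  theta ^+ (k * m) * lapl (fun w => f (rvec (G 1) w)) theta.
Proof.
move=> mf f0 t0 hY; rewrite -meanZ; last exact: hY.
congr fine; have mn : measurable_fun setT (fun u => (f u)%:E : \bar R).
  exact/measurable_EFinP.
rewrite (gamma_change_of_rate t0 (hG t0) (hG ltr01) mn)//.
by apply: eq_integral => w _; rewrite -EFinM mulrCA.
Qed.

Lemma mean_gamma (f : fspace 'I_m R -> R) theta : measurable_fun setT f ->
  (forall theta, 0 < theta -> rintegrable (Q theta) (fun w => f (rvec (G theta) w))) ->
  0 < theta ->
  mean (Q theta) (fun w => f (rvec (G theta) w)) =
  theta ^+ (k * m) * lapl (fun w => f (rvec (G 1) w)) theta.
Proof.
move=> mf hf t0; have hY := tempered_estimator mf hf.
(* The change of rate is available for nonnegative functions; [f] is the difference of [p] and [q],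
   both nonnegative and integrable. *)
pose p u := `|f u|; pose q u := `|f u| - f u.
have mp : measurable_fun setT p by exact: measurableT_comp.
have mq : measurable_fun setT q by exact: measurable_funB.
have p0 u : 0 <= p u by exact: normr_ge0.
have q0 u : 0 <= q u by rewrite subr_ge0 ler_norm.
have hp := tempered_norm hY; have hq := temperedB hp hY.
have ip := rintegrable_norm (hf _ t0); have iq := rintegrableB ip (hf _ t0).
have -> : mean (Q theta) (fun w => f (rvec (G theta) w)) =
    mean (Q theta) (fun w => p (rvec (G theta) w) - q (rvec (G theta) w)).
  by apply: eq_mean => w; rewrite /p /q; ring.
rewrite meanB// (mean_gamma_ge0 mp p0 t0 hp) (mean_gamma_ge0 mq q0 t0 hq).
rewrite -mulrBr -laplB//; congr (_ * _); apply: eq_mean => w.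
by rewrite /p /q; ring.
Qed.

Section minima.
Context d' (T' : measurableType d') (P : probability T' R) (n : nat).
Variable U : 'I_n -> {RV P >-> R}.
Hypothesis hU : uniform01_sample U.
Hypothesis Kn : (k * m <= n)%N.
Variable a : R.
Hypothesis am : a <= m%:R^-1.

(** With [a] at most [1 / m], these points lie in the open cube where [integral_shifted_kth]
    applies. For the Gamma vector at rate 1 this is almost surely the event that [gamma_sum] is
    below [a]. *)
Definition near_zero (x : fspace 'I_m R) : bool :=
  [forall i, 0 < x i] && (\sum_i x i < a).

Lemma measurable_near_zero : measurable_fun setT near_zero.
Proof.
have me i := @measurable_fun_eval 'I_m R i.
apply: measurable_and.
  by apply: measurable_forallb => i; exact: measurable_fun_ltr.
by apply: measurable_fun_ltr => //; exact: measurable_sum.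
Qed.

Lemma core_risk_minima (f : fspace 'I_m R -> R) : measurable_fun setT f ->
  core_risk mu gamma_sum (k * m) a n (fun w => f (rvec (G 1) w)) =
  (\int[P]_w (if near_zero (shifted_kth k (rvec U w))
              then (f (shifted_kth k (rvec U w)) - n%:R) ^+ 2 else 0)%:E)%E.
Proof.
move=> mf.
pose F (x : fspace 'I_m R) : \bar R :=
  (if near_zero x then (f x - n%:R) ^+ 2 else 0)%:E.
have mF : measurable_fun setT F.
  apply/measurable_EFinP; apply: measurable_fun_ifT => //.
    exact: measurable_near_zero.
  by apply: measurable_funX; exact: measurable_funB.
have F0 x : (0 <= F x)%E by rewrite lee_fin; case: ifP => // _; exact: sqr_ge0.
have Fs x : F x != 0%E -> forall i, 0 < x i < m%:R^-1.
  rewrite /F; case: ifPn => [/andP[/forallP x0 xa] _ i|]; last by rewrite eqxx.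
  rewrite x0 (lt_le_trans _ am)// (le_lt_trans _ xa)// (bigD1 i)//= lerDl.
  by apply: sumr_ge0 => j _; exact: ltW.
have k0 : (0 < k)%N by exact: leq_trans hk.
rewrite -[RHS]/(\int[P]_w F (shifted_kth k (rvec U w)))%E.
rewrite (integral_shifted_kth k0 hm Kn hU (hG ltr01) mF F0 Fs).
apply: ae_eq_integral => //.
- apply/measurable_EFinP; apply: measurable_core; first exact: measurable_gamma_sum.
  exact: measurable_estimator.
- apply: emeasurable_funM; first exact: measurableT_comp mF (measurable_rvec _).
  have mS : measurable_fun setT (fun w => \sum_i G 1 i w).
    by apply: measurable_sum => i; exact: measurable_funP.
  by apply/measurable_EFinP; exact: (measurable_min_weight (k * m) mS n).
apply: filterS gamma_ae_pos => w w0 _.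
have sE : \sum_i G 1 i w = gamma_sum w.
  by apply: eq_bigr => i _; rewrite gtr0_norm.
rewrite /F /near_zero /rvec sE; have -> /= : [forall i, 0 < G 1 i w].
  by apply/forallP.
by case: ifP => _; rewrite ?mul0e -?EFinM.
Qed.

End minima.
End gamma_model.

Lemma littleo_sq (R : realType) (e : nat -> R) (C : R) (N : nat) :
  (forall n, (N <= n)%N -> `|e n| <= C * n%:R) -> e =o_\oo (fun n => n%:R ^+ 2 : R).
Proof.
move=> h; apply/eqoP => eps eps0; near=> n.
have Nn : (N <= n)%N by near: n; exact: nbhs_infty_ge.
have Cn : C / eps <= n%:R by near: n; exact: nbhs_infty_ger.
rewrite (le_trans (h n Nn))// ger0_norm ?exprn_ge0// expr2 mulrA ler_wpM2r//.
by rewrite mulrC -ler_pdivrMr.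
Unshelve. all: by end_near. Qed.

(** A k-th value equal to the lower end of its bucket forces some [U j] to sit exactly there. *)
Lemma kth_min_ae_gt (R : realType) (k m n : nat) d (T : measurableType d)
    (P : probability T R) (U : 'I_n -> {RV P >-> R}) :
  (0 < k)%N -> (0 < m)%N -> uniform01_sample U ->
  {ae P, forall w, forall i : 'I_m, 0 < shifted_kth k (rvec U w) i}.
Proof.
move=> k0 m0 hU; apply: filter_forall => i.
have : {ae P, forall w, forall j, U j w != i%:R / m%:R}.
  by apply: filter_forall => j; exact: ae_neq.
apply: filterS => w hw; rewrite /shifted_kth subr_gt0 lt_neqAle kth_min_ge// andbT.
apply/eqP => e.
have lohi : i%:R / m%:R < i.+1%:R / m%:R :> R.
  by rewrite ltr_pM2r ?invr_gt0 ?ltr0n// ltr_nat.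
have := kth_min_le k0 (rvec U w) lohi; rewrite -e lexx => /esym kc.
have /card_gt0P[j] := leq_trans k0 kc.
rewrite !inE => /andP[/andP[lo _] hi]; have := hw j.
by rewrite eq_le; move: lo hi; rewrite /rvec => -> ->.
Qed.

Lemma core_risk_ae_eq d (T : measurableType d) (R : realType) (mu : probability T R)
    (s : T -> R) K a n (Y Z : T -> R) :
  measurable_fun setT s -> measurable_fun setT Y -> measurable_fun setT Z ->
  {ae mu, forall x, Y x = Z x} ->
  core_risk mu s K a n Y = core_risk mu s K a n Z.
Proof.
move=> ms mY mZ YZ; apply: ae_eq_integral => //.
- by apply/measurable_EFinP; exact: measurable_core.
- by apply/measurable_EFinP; exact: measurable_core.
- by apply: filterS YZ => x -> _.
Qed.

(** * Differentiability of the mean estimate *)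

Section drift.
Context (R : realType) (k m : nat).
Hypotheses (hk : (2 <= k)%N) (hm : (1 <= m)%N).
Context d (T : measurableType d) (Q : R -> probability T R).
Variable G : forall theta : R, 'I_m -> {RV (Q theta) >-> R}.
Hypothesis hG : forall theta : R, 0 < theta -> gamma_sample k theta (G theta).
Variable f : fspace 'I_m R -> R.
Hypothesis mf : measurable_fun setT f.
Hypothesis hf : forall theta, 0 < theta ->
  rintegrable (Q theta) (fun w => f (rvec (G theta) w)).

Local Notation s := (gamma_sum G).
Local Notation slope := (mean_slope (Q 1) s (k * m) (fun w => f (rvec (G 1) w))).
Local Notation mean_estimate :=
  (fun theta => mean (Q theta) (fun w => f (rvec (G theta) w))).

Let hY := tempered_estimator hG mf hf.
Let ms := measurable_gamma_sum G.
Let s0 := gamma_sum_ge0 G.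

Lemma mean_estimate_is_derive (theta : R) : 0 < theta ->
  is_derive theta 1 mean_estimate (slope theta).
Proof.
move=> t0.
pose phi (t : R) := t ^+ (k * m) * lapl (Q 1) s (fun w => f (rvec (G 1) w)) t.
have dl := lapl_is_derive ms s0 hY t0.
have dX : is_derive theta 1 (fun t : R => t ^+ (k * m))
    ((k * m)%:R * theta ^+ (k * m).-1).
  apply: DeriveDef; first exact: exprn_derivable.
  by rewrite exp_derive /GRing.scale /= mulr1.
have : is_derive theta 1 phi (slope theta).
  rewrite /phi; apply: is_derive_eq; rewrite /mean_slope /GRing.scale /=.
  have : (0 < k * m)%N by rewrite muln_gt0 hm; lia.
  case: (k * m)%N => // q _ /=; rewrite exprS; field.
  by rewrite gt_eqF.
apply: near_eq_is_derive; near=> t; apply/esym/mean_gamma => //.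
by near: t; exact: lt_nbhsr.
Unshelve. all: by end_near. Qed.

Lemma slope_continuous (theta : R) : 0 < theta -> {for theta, continuous slope}.
Proof.
move=> t0; rewrite /mean_slope; apply: cvgM.
  exact: exprn_continuous.
apply: cvgB; last exact: (lapl_continuous ms s0 (tempered_mul ms s0 hY) t0).
apply: cvgM; last exact: (lapl_continuous ms s0 hY t0).
by apply: cvgM; [exact: cvg_cst|apply: cvgV; rewrite ?gt_eqF].
Qed.

End drift.

(** * Full risk of the minima against its core *)

Section risk_of_minima.
Context (R : realType) (k m : nat).
Hypotheses (hk : (2 <= k)%N) (hm : (1 <= m)%N).
Context d (T : measurableType d) (Q : R -> probability T R).
Variable G : forall theta : R, 'I_m -> {RV (Q theta) >-> R}.
Hypothesis hG : forall theta : R, 0 < theta -> gamma_sample k theta (G theta).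
Context d' (T' : measurableType d') (P : nat -> probability T' R).
Variable U : forall n : nat, 'I_n -> {RV (P n) >-> R}.
Hypothesis hU : forall n : nat, (0 < n)%N -> uniform01_sample (@U n).

Local Notation s := (gamma_sum G).
Local Notation K := (k * m)%N.

Let ms := measurable_gamma_sum G.
Let s0 := gamma_sum_ge0 G.
Let lap := gamma_sum_laplace hG.

Let k0 : (0 < k)%N. Proof. exact: leq_trans hk. Qed.
Let K2 : (2 <= K)%N. Proof. by rewrite (leq_trans hk)// leq_pmulr. Qed.

(** At most [1 / 4], for the lower bound on the weight, and at most [1 / m], so that a sum below it
    keeps every minimum inside its bucket. *)
Definition cutoff : R := (4 * m%:R)^-1.
Let a := cutoff.

Let m1 : 1 <= m%:R :> R. Proof. by rewrite ler1n. Qed.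

Lemma cutoff_gt0 : 0 < a.
Proof. by rewrite invr_gt0 mulr_gt0// ltr0n. Qed.

Lemma cutoff_le4 : a <= 1 / 4.
Proof.
rewrite /a /cutoff div1r lef_pV2 ?posrE ?mulr_gt0 ?ltr0n//.
by rewrite ler_peMr.
Qed.

Lemma cutoff_le_inv : a <= m%:R^-1.
Proof. by rewrite lef_pV2 ?posrE ?mulr_gt0 ?ltr0n// ler_peMl// ler1n. Qed.

Definition minima_risk (f : fspace 'I_m R -> R) (n : nat) : \bar R :=
  (\int[P n]_w ((f (shifted_kth k (rvec (@U n) w)) - n%:R) ^+ 2)%:E)%E.

Local Notation core f n :=
  (core_risk (Q 1) s K a n (fun w => f (rvec (G 1) w))).

Let mX n : measurable_fun setT
  (fun w => shifted_kth k (rvec (@U n) w) : fspace 'I_m R).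
Proof.
apply: measurableT_comp; first exact: measurable_shifted_kth.
exact: measurable_rvec.
Qed.

Let mS n : measurable_fun setT
  (fun w => near_zero a (shifted_kth k (rvec (@U n) w) : fspace 'I_m R)).
Proof. exact: measurableT_comp (measurable_near_zero _) (@mX n). Qed.

Lemma core_le_minima_risk (f : fspace 'I_m R -> R) n : measurable_fun setT f ->
  (K <= n)%N -> (core f n <= minima_risk f n)%E.
Proof.
move=> mf Kn; have n0 : (0 < n)%N by apply: leq_trans Kn; apply: leq_trans K2.
rewrite (core_risk_minima hk hm hG (hU n0) Kn cutoff_le_inv mf).
have mfX : measurable_fun setT
    (fun w => (f (shifted_kth k (rvec (@U n) w)) - n%:R) ^+ 2).
  by apply: measurable_funX; apply: measurable_funB => //; exact: measurableT_comp.
apply: ge0_le_integral => //.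
- by move=> w _; rewrite lee_fin; case: ifP => // _; exact: sqr_ge0.
- by apply/measurable_EFinP; apply: measurable_fun_ifT.
- exact/measurable_EFinP.
- by move=> w _; rewrite lee_fin; case: ifP => // _; exact: sqr_ge0.
Qed.

(* Away from [S = near_zero] the estimator is at most [c], and by [core_mass_ge]
   [S] has probability [1 - O(1 / n)]. *)
Lemma minima_risk_le (f : fspace 'I_m R -> R) (c : R) : measurable_fun setT f ->
  (3 <= K)%N ->
  (forall x, (forall i, 0 < x i) -> a <= \sum_i x i -> `|f x| <= c) ->
  exists C : R, exists N : nat, forall n, (N <= n)%N ->
    (minima_risk f n <= core f n + (C * n%:R)%:E)%E.
Proof.
move=> mf K3 fc.
have [C0 [N0 hC]] := core_mass_ge ms s0 lap cutoff_gt0 cutoff_le4.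
exists ((2 * c ^+ 2 + 2) * `|C0|), (maxn N0 K) => n; rewrite geq_max => /andP[N0n Kn].
have n0 : (0 < n)%N by apply: leq_trans Kn; apply: leq_trans K2.
have n0' : 0 < n%:R :> R by rewrite ltr0n.
have n1 : 1 <= n%:R :> R by rewrite ler1n.
pose X w : fspace 'I_m R := shifted_kth k (rvec (@U n) w).
pose S w := near_zero a (X w).
(* Bounds the squared error off [S]. Being [O(n ^+ 2)], it contributes [O(n)] once multiplied by a
   probability [O(1 / n)]. *)
pose B : R := 2 * c ^+ 2 + 2 * n%:R ^+ 2.
have B0 : 0 <= B by rewrite addr_ge0// mulr_ge0// sqr_ge0.
pose g w : R := if S w then (f (X w) - n%:R) ^+ 2 else 0.
pose h w : R := if S w then 1 else 0.
have mfX : measurable_fun setT (fun w => (f (X w) - n%:R) ^+ 2).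
  apply: measurable_funX; apply: measurable_funB => //.
  exact: measurableT_comp mf (@mX n).
have mg : measurable_fun setT g by apply: measurable_fun_ifT => //; exact: mS.
have mh : measurable_fun setT h by apply: measurable_fun_ifT => //; exact: mS.
have i1 : rintegrable (P n) (fun=> 1).
  exact: (finite_measure_integrable_cst (P n) 1 measurableT).
have ih : rintegrable (P n) h.
  by apply: rintegrable_le i1 => // w; rewrite /h; case: ifP; rewrite ?normr1 ?normr0.
have i1h : rintegrable (P n) (fun w => 1 - h w) by exact: rintegrableB.
have mean1 : mean (P n) (fun=> 1) = 1.
  by rewrite /mean /Rintegral integral_cst//= probability_setT mul1e.
have hh : 1 - C0 / n%:R <= mean (P n) h.
  rewrite -lee_fin EFin_mean//; apply: le_trans (hC n N0n) _.
  rewrite (core_risk_minima hk hm hG (hU n0) Kn cutoff_le_inv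
    (f := fun=> n%:R + 1) (measurable_cst _)).
  rewrite le_eqVlt; apply/orP; left; apply/eqP/eq_integral => w _.
  by rewrite /h /S /X addrAC subrr add0r expr1n.
rewrite (core_risk_minima hk hm hG (hU n0) Kn cutoff_le_inv mf).
rewrite -/(X _) -/(S _).
apply: (@le_trans _ _ (\int[P n]_w ((g w)%:E + (B * (1 - h w))%:E))%E).
  apply: ae_ge0_le_integral => //.
  - by move=> w _; rewrite lee_fin sqr_ge0.
  - exact/measurable_EFinP.
  - move=> w _; rewrite -EFinD lee_fin /g /h; case: ifP => _.
      by rewrite subrr mulr0 addr0 sqr_ge0.
    by rewrite subr0 mulr1 add0r.
  - apply: emeasurable_funD; apply/measurable_EFinP => //.
    by apply: measurable_funM => //; exact: measurable_funB.
  apply: filterS (kth_min_ae_gt k0 hm (hU n0)) => w w0 _.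
  rewrite -EFinD lee_fin /g /h; case: ifPn => [_|/negP wS].
    by rewrite subrr mulr0 addr0.
  rewrite add0r subr0 mulr1.
  have : `|f (X w)| <= c.
    apply: fc => //; rewrite leNgt; apply/negP => wa; apply: wS.
    by apply/andP; split => //; apply/forallP.
  move=> fxc; have : f (X w) ^+ 2 <= c ^+ 2.
    rewrite -(real_normK (num_real (f (X w)))) lerXn2r ?nnegrE//.
    exact: le_trans fxc.
  by have := sqr_ge0 (f (X w) + n%:R); rewrite /B; nra.
rewrite ge0_integralD//; first last.
- apply/measurable_EFinP; apply: measurable_funM => //; exact: measurable_funB.
- move=> w _; rewrite lee_fin /h; case: ifP; rewrite ?subrr ?subr0 ?mulr0 ?mulr1//.
- exact/measurable_EFinP.
- by move=> w _; rewrite lee_fin /g; case: ifP => // _; exact: sqr_ge0.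
rewrite leeD2l//.
rewrite -(EFin_mean (rintegrableZ B i1h)) lee_fin (meanZ _ i1h) meanB// mean1.
have nC : 1 - mean (P n) h <= `|C0| / n%:R.
  have : C0 / n%:R <= `|C0| / n%:R by rewrite ler_wpM2r ?invr_ge0 ?ler_norm// ltW.
  by lra.
apply: le_trans (ler_wpM2l B0 nC) _.
have Bn : B / n%:R <= (2 * c ^+ 2 + 2) * n%:R.
  rewrite ler_pdivrMr// -mulrA -expr2 mulrDl lerD2r ler_peMr ?exprn_ege1//.
  by rewrite mulr_ge0// sqr_ge0.
by rewrite mulrCA [leRHS]mulrAC [leRHS]mulrC ler_wpM2l.
Qed.

End risk_of_minima.

(** * The inverse sum as an estimator *)

Section inverse_sum_estimator.
Context (R : realType) (k m : nat).
Hypothesis hm : (1 <= m)%N.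

Definition xi_hat_coords (u : fspace 'I_m R) : R :=
  estimate (@xi_hat R k m) (\row_i u i).

Lemma measurable_xi_hat_coords : measurable_fun setT xi_hat_coords.
Proof.
pose D := [set u : fspace 'I_m R | punctured_orthant (\row_i u i)].
pose t (u : fspace 'I_m R) : R := \sum_i `|u i|.
have mt : measurable_fun setT t.
  by apply: measurable_sum => i; apply: measurableT_comp => //; exact: measurable_fun_eval.
apply: (eq_measurable_fun (fun u => (k * m - 1)%:R / t u * \1_D u)).
  move=> u _; rewrite /xi_hat_coords /estimate patchE indicE.
  have -> : (\row_i u i \in @punctured_orthant R m) = (u \in D).
    by apply/idP/idP => /set_mem h; apply/mem_set.
  case: ifPn => [/set_mem [u0 _]|_]; last by rewrite mulr0.
  rewrite mulr1 /xi_hat; congr (_ / _); apply: eq_bigr => i _.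
  by rewrite mxE ger0_norm//; have := u0 i; rewrite mxE.
apply: measurable_funM.
  by apply: measurable_divs => // u; exact: sumr_ge0.
by apply: measurable_indic; exact: measurable_punctured_orthant.
Qed.

Lemma xi_hat_coordsE (u : fspace 'I_m R) : (forall i, 0 < u i) ->
  xi_hat_coords u = (k * m - 1)%:R / \sum_i u i.
Proof.
move=> u0; rewrite /xi_hat_coords /estimate patchE mem_set.
  by rewrite /xi_hat; congr (_ / _); apply: eq_bigr => i _; rewrite mxE.
split; first by move=> i; rewrite mxE ltW.
apply/eqP => h; have := u0 (Ordinal hm).
have := congr1 (fun x : 'I_1 -> 'I_m -> R => x ord0 (Ordinal hm)) h.
by rewrite !mxE => ->; rewrite ltxx.
Qed.

End inverse_sum_estimator.

Section inverse_sum.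
Context d (T : measurableType d) (R : realType) (mu : probability T R).
Variables (s : T -> R) (K : nat).
Hypotheses (ms : measurable_fun setT s) (s0 : forall x, 0 <= s x).
Hypothesis spos : {ae mu, forall x, 0 < s x}.
Hypothesis K2 : (2 <= K)%N.
Hypothesis lap : forall t, 0 < t ->
  (\int[mu]_x (tilt s t x)%:E = (t ^- K)%:E)%E.

Let invE : (fun x => K.-1%:R / s x) = (fun x => K.-1%:R * (1 / s x)).
Proof. by apply/funext => x; rewrite div1r. Qed.

Lemma tempered_inverse : tempered mu s (fun x => K.-1%:R / s x).
Proof. by rewrite invE; apply: temperedZ; exact: (tempered_inv ms s0 spos K2 lap). Qed.

(** Unbiasedness of [(K - 1) / s] in the Gamma model, so that the lower bound for unbiased
    estimators applies to it as well. *)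
Lemma lapl_inverse t : 0 < t -> lapl mu s (fun x => K.-1%:R / s x) t = t ^- K.-1.
Proof.
move=> t0; rewrite invE laplZ//; last exact: (tempered_inv ms s0 spos K2 lap).
rewrite (lapl_inv ms s0 spos K2 lap)// mulrA div1r divff ?mul1r//.
by rewrite pnatr_eq0; lia.
Qed.

End inverse_sum.

Theorem theorem3p1 (R : realType) (k m : nat) (hk : (2 <= k)%N) (hm : (1 <= m)%N)
    (d : measure_display) (Omega : measurableType d)
    (P : nat -> probability Omega R)
    (U : forall n : nat, 'I_n -> {RV (P n) >-> R})
    (hU : forall n : nat, (0 < n)%N -> uniform01_sample (U n))
    (d' : measure_display) (Omega' : measurableType d')
    (Q : R -> probability Omega' R)
    (G : forall theta : R, 'I_m -> {RV (Q theta) >-> R})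
    (hG : forall theta : R, 0 < theta -> gamma_sample k theta (G theta))
    (xi : 'rV[R]_m -> R)
    (hxi : {within @punctured_orthant R m, continuous xi})
    (hO : exists2 r : R, 0 < r &
      exists C : R, \forall x \near (0 : 'rV[R]_m),
        @punctured_orthant R m x -> `|xi x| <= C * (`|x| `^ r)^-1)
    (hE : forall theta : R, 0 < theta ->
      (Q theta).-integrable setT (EFin \o gamma_estimate (G theta) xi)) :
  let b (theta : R) :=
    fine ('E_(Q theta)[gamma_estimate (G theta) xi])%E - theta in
  let risk (n : nat) (f : 'rV[R]_m -> R) := quadratic_risk k (U n) f in
  [/\ forall theta : R, 0 < theta ->
        derivable b theta 1 /\ {for theta, continuous (derive1 b)},
      exists (c : R) (e : nat -> R),
        e =o_\oo (fun n => n%:R ^+ 2 : R) /\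
        (* The relative error 1 - c / n is needed: when (1 + b')^2 is not o(n), the
           bound with the error term o(n^2) alone can fail. It is absorbed by e
           whenever (1 + b')^2 = o(n), in particular when b' is bounded. *)
        \forall n \near \oo,
          ((n%:R ^+ 2 / (k * m)%:R * (1 + derive1 b n%:R) ^+ 2 * (1 - c / n%:R)
            + e n)%:E <= risk n xi)%E
    & (forall theta : R, 0 < theta ->
        ('E_(Q theta)[gamma_estimate (G theta) xi] = theta%:E)%E) ->
      exists e1 e2 : nat -> R,
        [/\ e1 =o_\oo (fun n => n%:R ^+ 2 : R),
            e2 =o_\oo (fun n => n%:R ^+ 2 : R),
            \forall n \near \oo,
              (risk n (@xi_hat R k m) + (e1 n)%:E <= risk n xi)%E &
            \forall n \near \oo,
              (risk n (@xi_hat R k m) =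
                (n%:R ^+ 2)%:E / ((k * m - 2)%:R)%:E + (e2 n)%:E)%E]].
Proof.
move=> b risk.
pose K := (k * m)%N.
have K2 : (2 <= K)%N by rewrite (leq_trans hk)// leq_pmulr.
pose f (u : fspace 'I_m R) : R := estimate xi (\row_i u i).
pose fh : fspace 'I_m R -> R := @xi_hat_coords R k m.
have mf : measurable_fun setT f by exact: measurable_estimate.
have mfh : measurable_fun setT fh by exact: measurable_xi_hat_coords.
have hf theta : 0 < theta ->
    rintegrable (Q theta) (fun w => f (rvec (G theta) w)) by exact: hE.
pose s := gamma_sum G; pose mu := Q 1; pose a : R := cutoff R m.
pose Y w := f (rvec (G 1) w).
have ms : measurable_fun setT s := measurable_gamma_sum G.
have s0 : forall w, 0 <= s w := gamma_sum_ge0 G.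
have spos : {ae mu, forall w, 0 < s w} := gamma_sum_ae_pos hk hm hG.
have lap : forall t, 0 < t -> (\int[mu]_w (tilt s t w)%:E = (t ^- K)%:E)%E :=
  gamma_sum_laplace hG.
have a0 : 0 < a := cutoff_gt0 R hm; have a4 : a <= 1 / 4 := cutoff_le4 R hm.
have hY : tempered mu s Y := tempered_estimator hG mf hf.
have bE : b = (fun theta => mean (Q theta) (fun w => f (rvec (G theta) w)) - theta).
  by apply/funext => theta; rewrite /b unlock.
have db (theta : R) : 0 < theta -> is_derive theta 1 b (mean_slope mu s K Y theta - 1).
  move=> t0; rewrite bE; have dm := mean_estimate_is_derive hk hm hG mf hf t0.
  by apply: is_derive_eq.
have db1 theta : 0 < theta -> derive1 b theta = mean_slope mu s K Y theta - 1.
  by move=> t0; rewrite derive1E; have [] := db _ t0.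
have riskE n g : risk n g = minima_risk k U (fun u => estimate g (\row_i u i)) n.
  by rewrite /risk /quadratic_risk unlock.
have core_le (g : fspace 'I_m R -> R) (n : nat) : measurable_fun setT g -> (K <= n)%N ->
    (core_risk mu s K a n (fun w => g (rvec (G 1%R) w)) <= minima_risk k U g n)%E.
  exact: (core_le_minima_risk hk hm hG hU).
split.
- move=> theta t0; split; first by have [] := db _ t0.
  have : {for theta, continuous (fun t => mean_slope mu s K Y t - 1)}.
    by apply: cvgB; [exact: slope_continuous|exact: cvg_cst].
  rewrite /prop_for /continuous_at db1// => h.
  apply: cvg_trans h; apply: near_eq_cvg; near=> t.
  by rewrite db1//; near: t; exact: lt_nbhsr.
(* Since [b] subtracts [theta] from the mean, [1 + derive1 b] is the slope of the mean. *)
- have [c [C [N hN]]] := core_risk_cramer_rao ms s0 K2 lap a0 a4 hY.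
  exists c, (fun=> - C); split.
    apply: (@littleo_sq R (fun=> - C) `|C| 1) => n n1.
    by rewrite normrN ler_peMr// ler1n.
  near=> n; have n0 : 0 < n%:R :> R by rewrite ltr0n; near: n; exists 1%N.
  have Kn : (K <= n)%N by near: n; exact: nbhs_infty_ge.
  have Nn : (N <= n)%N by near: n; exact: nbhs_infty_ge.
  rewrite riskE; apply: le_trans (core_le _ _ mf Kn).
  by rewrite db1// subrKC; exact: hN.
move=> unb.
(* Unbiasedness at all rates determines the Laplace transform of [Y]: multiplied by [t ^+ K], it is
   [t]. *)
have hub t : 0 < t -> lapl mu s Y t = t ^- K.-1.
  move=> t0; have := mean_gamma hG mf hf t0.
  have -> : mean (Q t) (fun w => f (rvec (G t) w)) = t.
    by have := unb t t0; rewrite unlock => e; rewrite /mean /Rintegral e.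
  have tK : t ^+ K != 0 by rewrite expf_neq0// gt_eqF.
  move=> e; apply: (mulfI tK); rewrite -e.
  by rewrite -(prednK (ltnW K2)) exprS mulfK// expf_neq0// gt_eqF.
have mI : measurable_fun setT (fun w => K.-1%:R / s w) by exact: measurable_divs.
have hI := tempered_inverse ms s0 spos K2 lap.
have hIub := lapl_inverse ms s0 spos K2 lap.
have core_hat n : core_risk mu s K a n (fun w => fh (rvec (G 1) w)) =
    core_risk mu s K a n (fun w => K.-1%:R / s w).
  apply: core_risk_ae_eq ms (measurable_estimator G mfh) mI _.
  apply: filterS (gamma_ae_pos hk hm hG) => w w0.
  rewrite /fh xi_hat_coordsE// subn1; congr (_ / _); apply: eq_bigr => i _.
  by rewrite gtr0_norm.
have risk_xiE n : risk n xi = minima_risk k U f n by exact: riskE.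
have risk_hatE n : risk n (@xi_hat R k m) = minima_risk k U fh n by exact: riskE.
have K2E : (k * m - 2)%:R = K.-2%:R :> R by rewrite subn2.
(* For [K = 2], the quotient of a positive number by [K - 2 = 0] is [+oo] in the extended reals, and
   both risks are infinite, so both error terms can be 0. *)
have [K3|K3] := leqP 3 K; last first.
  have KE : K = 2%N by lia.
  exists (fun _ : nat => 0 : R), (fun _ : nat => 0 : R).
  have o0 : (fun _ : nat => 0 : R) =o_\oo (fun n => n%:R ^+ 2 : R).
    by apply: (@littleo_sq R (fun=> 0) 0 0) => n _; rewrite normr0 mul0r.
  have inf g n : measurable_fun setT g -> (K <= n)%N ->
      core_risk mu s K a n (fun w => g (rvec (G 1) w)) = +oo%E ->
      minima_risk k U g n = +oo%E.
    by move=> mg Kn ginf; apply/eqP; rewrite -leye_eq -ginf; exact: core_le.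
  split => //; near=> n; have Kn : (K <= n)%N by near: n; exact: nbhs_infty_ge.
    rewrite risk_xiE (inf f n mf Kn) ?leey//.
    exact: core_risk_infinite ms s0 spos lap a0 a4 _ hY hub n KE Kn.
  rewrite risk_hatE (inf fh n mfh Kn); last first.
    rewrite core_hat.
    exact: core_risk_infinite ms s0 spos lap a0 a4 _ hI hIub n KE Kn.
  rewrite K2E KE /= adde0 inver eqxx gt0_muley// lte_fin exprn_gt0// ltr0n.
  by rewrite (leq_trans _ Kn)// ltnW.
have [C1 [N1 h1]] := core_risk_unbiased_ge ms s0 spos K3 lap a0 a4 hY hub.
(* The inverse sum is itself unbiased in the model, so its risk is also bounded below; with [h3] and
   [h4] this makes the estimate two-sided. *)
have [C2 [N2 h2]] := core_risk_unbiased_ge ms s0 spos K3 lap a0 a4 hI hIub.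
have [C3 [N3 h3]] := core_risk_inverse_le ms s0 spos K3 lap a0 a4.
(* Away from 0 the inverse sum is bounded, as [minima_risk_le] asks. *)
have fhc x : (forall i, 0 < x i) -> a <= \sum_i x i -> `|fh x| <= K.-1%:R / a.
  move=> x0 ax; have sx := lt_le_trans a0 ax.
  rewrite /fh xi_hat_coordsE// subn1 ger0_norm ?divr_ge0 ?(ltW sx)//.
  by rewrite ler_wpM2l// lef_pV2.
have [C4 [N4 h4]] := minima_risk_le hk hm hG hU mfh K3 fhc.
pose v n : R := n%:R ^+ 2 / K.-2%:R.
pose N := maxn (maxn N1 N2) (maxn (maxn N3 N4) K).
have bounds n : (N <= n)%N -> exists2 r, risk n (@xi_hat R k m) = r%:E &
    v n - C2 * n%:R <= r <= v n + (C3 + C4) * n%:R.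
  rewrite !geq_max => /andP[/andP[_ n2] /andP[/andP[n3 n4] Kn]].
  have lo := le_trans (h2 n n2) _; move: lo; rewrite -core_hat.
  move=> /(_ _ (core_le fh n mfh Kn)).
  have := h4 n n4; rewrite core_hat => up.
  have {up} := le_trans up (leeD2r _ (h3 n n3)).
  rewrite -risk_hatE -EFinD -addrA -mulrDl.
  case: (risk n _) => [r||]; rewrite ?leye_eq// ?leeNy_eq// !lee_fin => up lo.
  by exists r => //; rewrite lo up.
(* Covers both error terms: [C1] and [C3 + C4] bound the gap between the lower bound for [xi] and
   the upper bound for the inverse sum, [C2] and [C3 + C4] the deviation of the latter from [v]. *)
pose C := `|C1| + `|C2| + `|C3 + C4|.
exists (fun n => - (C * n%:R)), (fun n => fine (risk n (@xi_hat R k m)) - v n).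
split.
- apply: (@littleo_sq R (fun n => - (C * n%:R)) C 0) => n _.
  by rewrite normrN ger0_norm// mulr_ge0// !addr_ge0.
- apply: (@littleo_sq R _ C N) => n /bounds[r -> /andP[lo up]] /=.
  have n0 : 0 <= n%:R :> R by [].
  have c1 := mulr_ge0 (normr_ge0 C1) n0.
  have c2 : C2 * n%:R <= `|C2| * n%:R by rewrite ler_wpM2r ?ler_norm.
  have c3 : (C3 + C4) * n%:R <= `|C3 + C4| * n%:R by rewrite ler_wpM2r ?ler_norm.
  have c2' := mulr_ge0 (normr_ge0 C2) n0.
  have c3' := mulr_ge0 (normr_ge0 (C3 + C4)) n0.
  by rewrite /C !(mulrDl _ _ n%:R) ler_norml; apply/andP; split; lra.
- near=> n; have Nn : (N <= n)%N by near: n; exact: nbhs_infty_ge.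
  have [r -> /andP[_ up]] := bounds n Nn.
  have := Nn; rewrite !geq_max => /andP[/andP[n1 _] /andP[_ Kn]].
  rewrite risk_xiE; apply: le_trans (core_le _ _ mf Kn).
  apply: le_trans (h1 n n1); rewrite -EFinD lee_fin -/(v n).
  have c1 : C1 * n%:R <= `|C1| * n%:R by rewrite ler_wpM2r ?ler_norm.
  have c3 : (C3 + C4) * n%:R <= `|C3 + C4| * n%:R by rewrite ler_wpM2r ?ler_norm.
  have c2 : 0 <= `|C2| * n%:R by rewrite mulr_ge0.
  by rewrite /C !(mulrDl _ _ n%:R); lra.
- near=> n; have [r rE _] : exists2 r, risk n (@xi_hat R k m) = r%:E & True.
    have Nn : (N <= n)%N by near: n; exact: nbhs_infty_ge.
    by have [r rE _] := bounds n Nn; exists r.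
  have k2 : K.-2%:R != 0 :> R by rewrite pnatr_eq0; lia.
  by rewrite rE /= K2E inver (negbTE k2) -EFinM -EFinD /v addrC subrK.
Unshelve. all: by end_near. Qed.
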